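(* For any $1\le \ell\le k$, $p\in[1,\infty)$ and $\boldsymbol{u}\in (L^1(\hat K))^2$ such that $\operatorname{div}\boldsymbol{u}\in W^{\ell,p}(\hat K)$, it holds $$\|\operatorname{div}(\boldsymbol{u}-\hat{\boldsymbol{\mathcal I}}_{BDM}\boldsymbol{u})\|_{L^p(\hat K)}\lesssim \sum_{|\boldsymbol{\alpha}|=\ell}\|\partial_x^{\alpha_1}\partial_y^{\alpha_2}\operatorname{div}\boldsymbol{u}\|_{L^p(\hat K)},$$ where $\boldsymbol{\alpha}=(\alpha_1,\alpha_2)$ is a multiindex of degree $|\boldsymbol{\alpha}|=\alpha_1+\alpha_2=\ell$ and $\hat{\boldsymbol{\mathcal I}}_{BDM}$ is the Brezzi-Douglas-Marini interpolation operator of order $k$ on $\hat K$.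
   Context: $\hat K=[0,1]^2$ is the reference square with boundary $\partial\hat K$ and unit normal $\boldsymbol{n}$; $k$ and $\ell$ are integers. $\mathcal P_k(\hat K)$ is the space of polynomials on $\hat K$ of total degree at most $k$ (trivial for negative degree). For a face (edge) $\hat F$ of $\hat K$, $\mathcal P_k(\hat F)$ is the space of polynomials of total degree at most $k$ on $\hat F$. For a scalar function $\phi$, $\operatorname{curl}\phi=(\partial_y\phi,-\partial_x\phi)$. $L^p$ is the Lebesgue space and $W^{\ell,p}$ the corresponding Sobolev space of (weak) derivatives up to order $\ell$. $A\lesssim B$ means that there is a generic constant $C>0$ (not depending on $\boldsymbol{u}$) with $A\le C\cdot B$. The Brezzi-Douglas-Marini space is $$BDM_k(\hat K)=(\mathcal P_k(\hat K))^2\oplus\operatorname{span}\{\operatorname{curl}(x^{k+1}y),\ \operatorname{curl}(xy^{k+1})\}.$$ The interpolation operator $\hat{\boldsymbol{\mathcal I}}_{BDM}:(C(\hat K))^2\to BDM_k(\hat K)$ is given for any $\boldsymbol{v}\in (C(\hat K))^2$ by $$\int_{\hat F}\big((\hat{\boldsymbol{\mathcal I}}_{BDM}\boldsymbol{v}-\boldsymbol{v})\cdot\boldsymbol{n}\big)\,q=0\quad\text{for all } q\in\mathcal P_k(\hat F)\text{ and all faces }\hat F\subset\partial\hat K,$$ $$\int_{\hat K}(\hat{\boldsymbol{\mathcal I}}_{BDM}\boldsymbol{v}-\boldsymbol{v})\cdot\boldsymbol{q}=0\quad\text{for all }\boldsymbol{q}\in(\mathcal P_{k-2}(\hat K))^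2.$$
   Formalization: The interpolant is undefined for general u in L^1 with div u in W^{l,p} (e.g. u = curl log|z|), so u is also required to be continuous on the closed square or to have a normal trace (by Green's formula) given by integrable functions on the edges. *)

(* Defs.v *)
From HB Require Import structures.
From mathcomp Require Import all_boot all_order all_algebra.
From mathcomp Require Import all_classical all_reals all_analysis.

Set Implicit Arguments.
Unset Strict Implicit.
Unset Printing Implicit Defensive.
Import Order.TTheory GRing.Theory Num.Theory.
Import numFieldNormedType.Exports.

Local Open Scope classical_set_scope.
Local Open Scope ring_scope.

Definition Khat (R : realType) : set (R * R) := `[0, 1] `*` `[0, 1].
Arguments Khat R : clear implicits.

Definition leb2 (R : realType) :=
  (@lebesgue_measure R \x @lebesgue_measure R)%E.

Definition dot (R : realType) (v w : R * R) : R := v.1 * w.1 + v.2 * w.2.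

Definition intK (R : realType) (f : R * R -> R) : R :=
  \int[@leb2 R]_(z in Khat R) f z.

(* Functions on the square are represented by functions on the plane whose
   values outside the square are irrelevant. *)
Definition LpK (R : realType) (p : R) (f : R * R -> R) : Prop :=
  f \_ (Khat R) \in Lfun (@leb2 R) p%:E.

Definition LpK_norm (R : realType) (p : R) (f : R * R -> R) : \bar R :=
  'N[@leb2 R]_p%:E[EFin \o f \_ (Khat R)].

Definition LpK_field (R : realType) (p : R) (u : R * R -> R * R) : Prop :=
  LpK p (fst \o u) /\ LpK p (snd \o u).

Definition pdx (R : realType) (f : R * R -> R) : R * R -> R := 'D_(1, 0) f.
Definition pdy (R : realType) (f : R * R -> R) : R * R -> R := 'D_(0, 1) f.

Definition partial (R : realType) (a b : nat) (f : R * R -> R) : R * R -> R :=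
  iter a (@pdx R) (iter b (@pdy R) f).

Definition grad (R : realType) (f : R * R -> R) : R * R -> R * R :=
  fun z => (pdx f z, pdy f z).

Definition curl (R : realType) (f : R * R -> R) : R * R -> R * R :=
  fun z => (pdy f z, - pdx f z).

Fixpoint class_C (R : realType) (n : nat) (f : R * R -> R) : Prop :=
  continuous f /\
  if n is m.+1 then
    [/\ forall z, derivable f z (1, 0), forall z, derivable f z (0, 1),
        class_C m (pdx f) & class_C m (pdy f)]
  else True.

Definition smooth (R : realType) (f : R * R -> R) : Prop :=
  forall n, class_C n f.

Definition test_function (R : realType) (phi : R * R -> R) : Prop :=
  [/\ smooth phi, compact (closure [set z | phi z != 0])
    & closure [set z | phi z != 0] `<=` (Khat R)°].

(* Weak derivatives are taken in the open square.  They are required to be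
   integrable on the whole square, and not only locally integrable, which is no
   restriction for derivatives in L^p of the square with p >= 1. *)
Definition is_weak_partial (R : realType) (a b : nat) (f g : R * R -> R) : Prop :=
  [/\ LpK 1 f, LpK 1 g
    & forall phi, test_function phi ->
        intK (fun z => f z * partial a b phi z) =
        (-1) ^+ (a + b) * intK (fun z => g z * phi z)].

Definition is_weak_div (R : realType) (u : R * R -> R * R) (d : R * R -> R) : Prop :=
  [/\ LpK_field 1 u, LpK 1 d
    & forall phi, test_function phi ->
        intK (fun z => dot (u z) (grad phi z)) = - intK (fun z => d z * phi z)].

(* The weak derivative and the weak divergence are unique up to null sets;
   a representative is chosen (and the zero function if there is none). *)
Definition weak_partial (R : realType) (a b : nat) (f : R * R -> R) : R * R -> R :=
  xget (cst 0) [set g | is_weak_partial a b f g].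

Definition weak_div (R : realType) (u : R * R -> R * R) : R * R -> R :=
  xget (cst 0) [set d | is_weak_div u d].

Definition sobolev (R : realType) (l : nat) (p : R) (f : R * R -> R) : Prop :=
  LpK p f /\
  forall a b, (a + b <= l)%N -> exists2 g, is_weak_partial a b f g & LpK p g.

(* Polynomial functions of total degree at most m; P`_i`_j is the coefficient
   of x^i y^j.  For m < 0 only the zero function is left. *)
Definition polyK (R : realType) (m : int) : set (R * R -> R) :=
  [set f | exists2 P : {poly {poly R}},
     forall i j : nat, P`_i`_j != 0 -> i%:Z + j%:Z <= m
     & forall z, f z = P.[z.1%:P].[z.2]].

Definition polyK_field (R : realType) (m : int) : set (R * R -> R * R) :=
  [set q | polyK m (fst \o q) /\ polyK m (snd \o q)].

(* (false, s) is the edge x = s and (true, s) is the edge y = s, where s stands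
   for 0 or 1; both are parametrized by arc length over [0, 1]. *)
Definition edge : Type := (bool * bool)%type.

Definition edge_point (R : realType) (F : edge) (t : R) : R * R :=
  if F.1 then (t, F.2%:R) else (F.2%:R, t).

Definition edge_normal (R : realType) (F : edge) : R * R :=
  let s : R := if F.2 then 1 else -1 in if F.1 then (0, s) else (s, 0).

Definition int01 (R : realType) (h : R -> R) : R :=
  \int[@lebesgue_measure R]_(t in `[0, 1]) h t.

(* g F is the normal component of u on the edge F.  For u continuous on the
   square it is the pointwise one.  A field u in L^1 with divergence in L^1 has
   a normal trace in the sense of distributions only; the moments of u on the
   single edges make sense when this trace is given by integrable functions on
   the edges, which are then determined almost everywhere by Green's formula. *)
Definition is_normal_trace (R : realType) (u : R * R -> R * R)
    (g : edge -> R -> R) : Prop :=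
  ({within Khat R, continuous u} /\
   forall F t, t \in `[0, 1] -> g F t = dot (u (edge_point F t)) (edge_normal R F))
  \/
  (exists d, [/\ is_weak_div u d,
     forall F, (@lebesgue_measure R).-integrable `[0, 1] (EFin \o g F)
     & forall phi, smooth phi ->
         intK (fun z => dot (u z) (grad phi z) + d z * phi z) =
         \sum_(F : edge) int01 (fun t => g F t * phi (edge_point F t))]).

Definition BDM (R : realType) (k : nat) : set (R * R -> R * R) :=
  [set w | exists v a b, polyK_field k%:Z v /\
     forall z, w z = v z
       + a *: curl (fun y : R * R => y.1 ^+ k.+1 * y.2) z
       + b *: curl (fun y : R * R => y.1 * y.2 ^+ k.+1) z].

(* The fields on which the moments defining the interpolant make sense; all
   fields continuous on the square are among them. *)
Definition BDM_domain (R : realType) (u : R * R -> R * R) : Prop :=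
  exists g, is_normal_trace u g.

Definition is_BDM_interpolant (R : realType) (k : nat)
    (u w : R * R -> R * R) : Prop :=
  [/\ BDM k w,
      exists2 g, is_normal_trace u g &
        forall (F : edge) (q : {poly R}), (size q <= k.+1)%N ->
          int01 (fun t =>
            (dot (w (edge_point F t)) (edge_normal R F) - g F t) * q.[t]) = 0
    & forall q, polyK_field (k%:Z - 2) q ->
        intK (fun z => dot (w z - u z) (q z)) = 0].

Definition BDM_interp (R : realType) (k : nat) (u : R * R -> R * R) :
    R * R -> R * R :=
  xget (cst (0, 0)) [set w | is_BDM_interpolant k u w].

(* Main.v *)
(* Write d = div u, k for the order, and w for the interpolant. Green's formula with
   monomials x^i y^j of degree at most k-1, together with the edge and interior
   conditions defining w, gives that div w and d have the same moments of degree at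
   most k-1; since div w is itself a polynomial of degree at most k-1, it is the
   L^2 projection of d. Hence for every polynomial q of degree at most l-1 the
   difference div w - q is bounded by the L^1 norm of d - q (norms on a
   finite-dimensional space are equivalent), and ||d - div w|| <= C ||d - q|| in L^p.
   Bramble-Hilbert provides q, by iterating a Poincare representation formula.
   Green's formula for a field continuous up to the boundary is obtained by
   testing with monomials times a cutoff. Products phi(x) psi(y) suffice as test
   functions throughout. *)
Require Import Defs.
From HB Require Import structures.
From mathcomp Require Import all_boot all_order all_algebra.
From mathcomp Require Import all_classical all_reals all_analysis.
From mathcomp Require Import measurable_realfun lra.
Import Order.TTheory GRing.Theory Num.Theory.
Import numFieldNormedType.Exports.
Local Open Scope classical_set_scope.
Local Open Scope ring_scope.

Set Implicit Arguments.
Unset Strict Implicit.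
Unset Printing Implicit Defensive.

(** * Smooth functions of one variable, cutoffs and bumps *)

Section Smooth1.
Context {R : realType}.
Implicit Types (f g : R -> R) (n : nat).

(** The weight of the Poincare formula is a mollifier [rho] supported inside ]0, 1[ rather than the
    constant 1. For such a weight the transpose of the primitive operator maps test functions to
    test functions, so the formula follows by duality directly from the definition of weak
    derivatives, with no approximation by smooth functions. The same duality gives the additivity of
    the operators, which holds only almost everywhere because slices of integrable functions may
    fail to be integrable on a null set.

    The interpolant and the weak divergence are choices with a default value. An interpolant is
    therefore constructed explicitly for every admissible field, and the case of a missing weak
    divergence is treated apart.

    The divergence of the interpolant has lower degree than the interpolant suggests: the two extra
    fields of the space are curls and contribute nothing. *)

Fixpoint diffn n f : Prop :=
  if n is m.+1 then
    exists2 g : R -> R, (forall x : R, is_derive x (1 : R) f (g x)) & diffn m g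
  else continuous f.

Definition smooth1 f := forall n, diffn n f.

Lemma is_derive1_continuous f g :
  (forall x : R, is_derive x (1 : R) f (g x)) -> continuous f.
Proof.
by move=> fg x; apply/differentiable_continuous/derivable1_diffP; case: (fg x).
Qed.

Lemma diffn_continuous n f : diffn n f -> continuous f.
Proof. by case: n => //= n [g fg _]; exact: is_derive1_continuous fg. Qed.

Lemma diffnW n f : diffn n.+1 f -> diffn n f.
Proof.
elim: n f => [|n IH] f; first exact: (@diffn_continuous 1).
by case=> g fg /IH; exists g.
Qed.

Lemma diffnD n f g : diffn n f -> diffn n g -> diffn n (f \+ g).
Proof.
elim: n f g => [|n IH] f g; first by move=> cf cg x; apply: cvgD; [exact: cf|exact: cg].
move=> [f' ff' f'n] [g' gg' g'n]; exists (f' \+ g'); last exact: IH.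
by move=> x; exact: is_deriveD.
Qed.

Lemma diffnM n f g : diffn n f -> diffn n g -> diffn n (f \* g).
Proof.
elim: n f g => [|n IH] f g; first by move=> cf cg x; apply: cvgM; [exact: cf|exact: cg].
move=> df dg; have [f' ff' f'n] := df; have [g' gg' g'n] := dg.
exists ((f \* g') \+ (g \* f')); last first.
  by apply: diffnD; apply: IH => //; exact: diffnW.
by move=> x; exact: (is_deriveM (ff' x) (gg' x)).
Qed.

Lemma diffn_cst n c : diffn n (cst c : R -> R).
Proof.
elim: n c => [|n IH] c; first by move=> x; exact: cvg_cst.
by exists (cst 0) => // x; exact: is_derive_cst.
Qed.

Lemma diffn_id n : diffn n (id : R -> R).
Proof.
case: n => [|n]; first by move=> x; exact: cvg_id.
by exists (cst (1 : R)); [move=> x; exact: is_derive_id|exact: (diffn_cst n 1)].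
Qed.

Lemma diffn_affine n f a b : diffn n f -> diffn n (fun x => f (a * x + b)).
Proof.
elim: n f => [|n IH] f.
  move=> cf x; apply: (@continuous_comp _ _ _ (fun x => a * x + b) f); last exact: cf.
  by apply: cvgD; [apply: cvgM; [exact: cvg_cst|exact: cvg_id]|exact: cvg_cst].
case=> g fg gn; exists (fun x => a * g (a * x + b)); last first.
  by apply: (@diffnM _ (cst a) (fun x => g (a * x + b))); [exact: diffn_cst|exact: IH].
move=> x; rewrite mulrC.
apply: (@is_derive1_comp _ f (fun x => a * x + b) x _ _ (fg _)).
have -> : (fun x : R => a * x + b) = (a *: id) \+ cst b by [].
by apply: is_derive_eq; rewrite addr0 /GRing.scale /= mulr1.
Qed.

Lemma smooth1M f g : smooth1 f -> smooth1 g -> smooth1 (f \* g).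
Proof. by move=> sf sg n; exact: diffnM. Qed.

Lemma smooth1D f g : smooth1 f -> smooth1 g -> smooth1 (f \+ g).
Proof. by move=> sf sg n; exact: diffnD. Qed.

Lemma smooth1_cst c : smooth1 (cst c).
Proof. by move=> n; exact: diffn_cst. Qed.

Lemma smooth1X i : smooth1 (fun x => x ^+ i).
Proof.
move=> n; elim: i => [|i IH].
  have -> : (fun x : R => x ^+ 0) = cst 1 by rewrite funeqE => x; rewrite expr0.
  exact: diffn_cst.
have -> : (fun x : R => x ^+ i.+1) = id \* (fun x => x ^+ i).
  by rewrite funeqE => x; rewrite exprS.
by apply: diffnM => //; exact: diffn_id.
Qed.

Lemma smooth1_affine f a b : smooth1 f -> smooth1 (fun x => f (a * x + b)).
Proof. by move=> sf n; exact: diffn_affine. Qed.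

Lemma smooth1_derive f : smooth1 f ->
  (forall x : R, is_derive x (1 : R) f ((derive1 f) x)) /\ smooth1 (derive1 f).
Proof.
move=> sf; have eqd n g : (forall x : R, is_derive x (1 : R) f (g x)) -> g = (derive1 f).
  by move=> fg; rewrite funeqE => x; rewrite derive1E; case: (fg x).
split.
  by have [g fg _] := sf 1%N; rewrite -(eqd 1%N _ fg).
by move=> n; have [g fg] := sf n.+1; rewrite -(eqd n _ fg).
Qed.

Lemma smooth1_primitive f g : (forall x : R, is_derive x (1 : R) f (g x)) ->
  smooth1 g -> smooth1 f.
Proof. by move=> fg sg [|n]; [exact: is_derive1_continuous fg|exists g]. Qed.

Lemma smooth1_continuous f : smooth1 f -> continuous f.
Proof. by move=> /(_ 0). Qed.

(* P (1/x) exp (-1/x) on the positive half-line; all its derivatives have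
   the same shape, with P replaced by X^2 (P - P'). *)
Definition flat (P : {poly R}) (x : R) : R :=
  if 0 < x then P.[x^-1] * expR (- x^-1) else 0.

(** The exponential series dominates its term of index n. *)
Lemma pow_expRN n (t : R) : 0 <= t -> t ^+ n * expR (- t) <= n`!%:R.
Proof.
move=> t0; case: n => [|n].
  by rewrite expr0 mul1r fact0 -expR0 ler_expR oppr_le0.
rewrite expRN ler_pdivrMr ?expR_gt0// -ler_pdivrMl ?ltr0n ?fact_gt0//.
rewrite mulrC (le_trans _ (expR_ge1Dxn n t0))//; lra.
Qed.

(** Each monomial of [P] in t = 1/x is estimated with two spare powers, t^(i+2) exp(-t) <= (i+2)!,
    and these leave the factor x^2. Decay of second order makes the derivative at 0 exist and
    vanish. *)
Lemma flat_ratio_bound (P : {poly R}) :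
  exists2 C : R, 0 <= C & forall x, 0 < x -> `|P.[x^-1] * expR (- x^-1)| <= C * x ^+ 2.
Proof.
pose C := \sum_(i < size P) `|P`_i| * i.+2`!%:R.
exists C; first by apply: sumr_ge0 => i _; apply: mulr_ge0 => //; exact: ler0n.
move=> x x0; rewrite normrM (ger0_norm (expR_ge0 _)) horner_coef.
apply: (@le_trans _ _ ((\sum_(i < size P) `|P`_i| * (x^-1) ^+ i) * expR (- x^-1))).
  rewrite ler_wpM2r ?expR_ge0//; apply: le_trans (ler_norm_sum _ _ _) _.
  apply: ler_sum => i _; rewrite normrM normrX.
  by have -> : `|x^-1| = x^-1 by rewrite ger0_norm// invr_ge0 ltW.
rewrite /C !mulr_suml; apply: ler_sum => i _.
rewrite -!mulrA ler_wpM2l//.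
have := @pow_expRN i.+2 x^-1; rewrite invr_ge0 => /(_ (ltW x0)) H.
rewrite (_ : x^-1 ^+ i * expR (- x^-1) = x^-1 ^+ i.+2 * expR (- x^-1) * x ^+ 2).
  by rewrite ler_wpM2r// exprn_ge0// ltW.
rewrite mulrAC -[i.+2]addn2 exprD -[_ ^+ i * _ * _]mulrA -exprMn mulVf ?gt_eqF//.
by rewrite expr1n mulr1.
Qed.

Lemma is_derive_flat P (x : R) :
  is_derive x (1 : R) (flat P) (flat ('X^2 * (P - P^`())) x).
Proof.
case: (ltgtP x 0) => x0.
- rewrite {2}/flat ltNge ltW//=.
  apply: (@near_eq_is_derive _ _ _ (cst 0)).
  + near=> y; rewrite /flat /= ifF//; apply/negbTE; rewrite -leNgt ltW//.
    near: y; exact: lt_nbhsl.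
- rewrite {2}/flat x0.
  have dV : is_derive x (1 : R) (fun y : R => y^-1) (- (x^-1 ^+ 2)).
    apply: is_derive_eq (_ : - x ^- 2 *: (1 : R) = _).
      by apply: (@is_deriveV _ id); rewrite ?gt_eqF//.
    by rewrite exprVn /GRing.scale/= mulr1.
  have dP := is_derive1_comp (is_derive_poly P x^-1) dV.
  have dN : is_derive x (1 : R) (fun y : R => - y^-1) (- (- (x^-1 ^+ 2))) by exact: is_deriveN.
  have dE := @is_derive1_comp _ expR (fun y => - y^-1) x _ _ (is_derive_expR _) dN.
  have dK : is_derive x (1 : R) (fun y => P.[y^-1] * expR (- y^-1))
      (('X^2 * (P - P^`())).[x^-1] * expR (- x^-1)).
    apply: is_derive_eq (is_deriveM dP dE) _.
    rewrite /GRing.scale /= hornerM hornerXn hornerD hornerN.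
    move: (x^-1) => t; move: (P.[t]) (P^`().[t]) (expR (- t)) => u v w; lra.
  apply: near_eq_is_derive dK.
  by near=> y; rewrite /flat /= ifT//; near: y; exact: lt_nbhsr.
- rewrite x0 {2}/flat ltxx.
  have [C C0 HC] := flat_ratio_bound P.
  (* Caratheodory's criterion at 0: the difference quotient is [flat P z / z], at most C |z| in
     absolute value by the ratio bound. *)
  apply/is_derive1_caratheodory; exists (fun z => flat P z / z); split.
  + move=> z; rewrite subr0 {2}/flat ltxx subr0.
    have [->|z0] := eqVneq z 0; first by rewrite mulr0 /flat ltxx.
    by rewrite divfK.
  + suff cv : flat P z / z @[z --> (0 : R)] --> (0 : R).
      by rewrite /prop_for /continuous_at invr0 mulr0.
    apply/cvgr0Pnorm_le => e e0.
    change (\forall z \near (0 : R), `|flat P z / z| <= e).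
    have eC : 0 < e / (C + 1) by rewrite divr_gt0//; lra.
    apply: filterS (nbhs0_lt eC) => z.
    rewrite ltr_pdivlMr; last by lra.
    have [z0 _|z0] := leP z 0; first by rewrite /flat ltNge z0 mul0r normr0 ltW.
    rewrite (ger0_norm (ltW z0)) => zC.
    rewrite /flat z0 normrM normfV (ger0_norm (ltW z0)) ler_pdivrMr//.
    apply: le_trans (HC _ z0) _; rewrite expr2 mulrA ler_wpM2r ?(ltW z0)//.
    nra.
  + by rewrite invr0 mulr0.
Unshelve. all: by end_near.
Qed.

Lemma smooth1_flat P : smooth1 (flat P).
Proof.
move=> n; elim: n P => [|n IH] P.
  exact: is_derive1_continuous (is_derive_flat P).
by exists (flat ('X^2 * (P - P^`()))); [exact: is_derive_flat|exact: IH].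
Qed.

Definition hexp : R -> R := flat 1.

Lemma hexp_gt0 x : 0 < x -> 0 < hexp x.
Proof. by move=> x0; rewrite /hexp /flat x0 hornerC mul1r expR_gt0. Qed.

Lemma hexp_le0 x : x <= 0 -> hexp x = 0.
Proof. by move=> x0; rewrite /hexp /flat ltNge x0. Qed.

Lemma hexp_ge0 x : 0 <= hexp x.
Proof. by case: (leP x 0) => [/hexp_le0->//|/hexp_gt0/ltW]. Qed.

Lemma hexp_le1 x : hexp x <= 1.
Proof.
case: (leP x 0) => [/hexp_le0->//|x0].
by rewrite /hexp /flat x0 hornerC mul1r -expR0 ler_expR oppr_le0 invr_ge0 ltW.
Qed.

Lemma cvg_hexp x : 0 < x -> hexp (n.+1%:R * x) @[n --> \oo] --> (1 : R).
Proof.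
move=> x0; have -> : (fun n : nat => hexp (n.+1%:R * x)) = (fun n => expR (- (x^-1 * harmonic n))).
  rewrite funeqE => n; rewrite /hexp /flat mulr_gt0// hornerC mul1r invfM mulrC//.
rewrite -expR0; apply: continuous_cvg; first exact: continuous_expR.
rewrite -oppr0; apply: cvgN; rewrite -(mulr0 x^-1); apply: cvgM; first exact: cvg_cst.
exact: cvg_harmonic.
Qed.

(** The scaling by n+1 makes the bumps converge to the indicator of ]a, b[ while they stay between 0
    and 1, so dominated convergence can turn test functions into indicators. *)
Definition bump (a b : R) (n : nat) (x : R) : R :=
  hexp (n.+1%:R * (x - a)) * hexp (n.+1%:R * (b - x)).

Lemma smooth1_bump a b n : smooth1 (bump a b n).
Proof.
rewrite /bump; apply: smooth1M.
  rewrite (_ : (fun _ => _) = fun x => hexp (n.+1%:R * x + (- (n.+1%:R * a)))); last first.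
    by rewrite funeqE => x; rewrite mulrBr.
  by apply: smooth1_affine; exact: smooth1_flat.
rewrite (_ : (fun _ => _) = fun x => hexp (- n.+1%:R * x + n.+1%:R * b)); last first.
  by rewrite funeqE => x; rewrite mulrBr addrC mulNr.
by apply: smooth1_affine; exact: smooth1_flat.
Qed.

Lemma bump_ge0 a b n x : 0 <= bump a b n x.
Proof. by rewrite mulr_ge0// hexp_ge0. Qed.

Lemma bump_le1 a b n x : bump a b n x <= 1.
Proof. by rewrite mulr_ile1// ?hexp_ge0// hexp_le1. Qed.

Lemma bump_out a b n x : ~~ (a < x < b) -> bump a b n x = 0.
Proof.
rewrite negb_and -!leNgt => /orP[xa|bx]; rewrite /bump.
  by rewrite hexp_le0 ?mul0r// mulr_ge0_le0// subr_le0.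
by rewrite mulrC hexp_le0 ?mul0r// mulr_ge0_le0// subr_le0.
Qed.

Lemma bump_gt0 a b n x : a < x < b -> 0 < bump a b n x.
Proof. by move=> /andP[ax xb]; rewrite mulr_gt0// hexp_gt0// mulr_gt0// subr_gt0. Qed.

Lemma cvg_bump a b x : bump a b n x @[n --> \oo] --> (\1_(`]a, b[%classic) x : R).
Proof.
rewrite indicE mem_setE in_itv/=; have [/andP[ax xb]|axb] := boolP (_ < _ < _).
  by rewrite -(mulr1 1); apply: cvgM; apply: cvg_hexp; rewrite subr_gt0.
have -> : (fun n => bump a b n x) = cst 0 by rewrite funeqE => n; exact: bump_out.
exact: cvg_cst.
Qed.

Definition test1 f := smooth1 f /\
  exists a b : R, [/\ 0 < a, a < b, b < 1 & forall x : R, ~~ (a <= x <= b) -> f x = 0].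

Lemma test1_bump a b n : 0 < a -> a < b -> b < 1 -> test1 (bump a b n).
Proof.
move=> a0 ab b1; split; first exact: smooth1_bump.
exists a, b; split=> // x axb; apply: bump_out; apply: contra axb => /andP[? ?].
by rewrite !ltW.
Qed.

Lemma test1M f g : smooth1 f -> test1 g -> test1 (f \* g).
Proof.
move=> sf [sg [a [b [a0 ab b1 g0]]]]; split; first exact: smooth1M.
by exists a, b; split=> // x /g0 /= ->; rewrite mulr0.
Qed.

Lemma test1_derive f : test1 f -> test1 (derive1 f).
Proof.
move=> [sf [a [b [a0 ab b1 f0]]]]; have [fd sd] := smooth1_derive sf.
split=> //; exists a, b; split=> // x xab; rewrite derive1E.
apply: derive_val; apply: (@near_eq_is_derive _ _ _ (cst 0)).
- move: xab; rewrite negb_and -!ltNge => /orP[xa|bx]; near=> y; rewrite /= f0//.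
    by rewrite negb_and -!ltNge; apply/orP; left; near: y; exact: lt_nbhsl.
  by rewrite negb_and -!ltNge; apply/orP; right; near: y; exact: lt_nbhsr.
Unshelve. all: by end_near.
Qed.

End Smooth1.

(** * Products of one-variable functions as test functions on the square *)

Section Tensor.
Context {R : realType}.
Implicit Types (f g : R -> R) (z : R * R).
Local Notation leb := (@lebesgue_measure R).

(** The primitive from 0 vanishes on the left of the support of [f], and on its right because the
    total integral is zero. *)
Lemma test1_primitive f : test1 f -> \int[leb]_x f x = 0 ->
  exists2 F, test1 F & derive1 F = f.
Proof.
move=> [sf [a [b [a0 ab b1 f0]]]] intf.
pose F x := \int[leb]_(t in `[0, x]) f t.
have f0l x : x < a -> f x = 0 by move=> xa; apply: f0; rewrite negb_and -!ltNge xa.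
have f0r x : b < x -> f x = 0 by move=> xa; apply: f0; rewrite negb_and -!ltNge xa orbT.
have cf := smooth1_continuous sf.
have Fl x : x < a -> F x = 0.
  move=> xa; rewrite /F (@eq_Rintegral _ _ _ _ _ (cst 0)) ?Rintegral_cst ?mul0r//.
  by move=> t; rewrite inE/= in_itv/= => /andP[_ tx]; rewrite f0l// (le_lt_trans tx).
have Fr x : b < x -> F x = 0.
  move=> bx; rewrite -[RHS]intf /F Rintegral_mkcond; apply: eq_Rintegral => t _.
  rewrite patchE; case: ifPn => //; rewrite notin_setE/= in_itv/= => /negP.
  rewrite negb_and -!ltNge => /orP[t0|xt]; first by rewrite f0l// (lt_trans t0).
  by rewrite f0r// (lt_trans bx).
have dF (x : R) : is_derive x (1 : R) F (f x).
  (* Points left of [a] are handled apart, since the fundamental theorem of calculus is applied on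
     [0, x + 1] and needs 0 < x. *)
  have [xa|ax] := ltP x a.
    rewrite (f0l _ xa); apply: (@near_eq_is_derive _ _ _ (cst 0)).
    by near=> y; rewrite Fl//; near: y; exact: lt_nbhsl.
  have x0 : 0 < x by exact: lt_le_trans ax.
  have [] := @continuous_FTC1_closed _ f 0 x (x + 1) _ _ x0 (cf x).
  - by rewrite ltrDl.
  - apply: continuous_compact_integrable; first exact: segment_compact.
    by apply: continuous_subspaceT => y; exact: cf.
  - by move=> dF F'; apply: DeriveDef; [exact: dF|rewrite -derive1E; exact: F'].
exists F; last by rewrite funeqE => x; rewrite derive1E; exact: derive_val.
split; first exact: smooth1_primitive dF sf.
exists a, b; split=> // x; rewrite negb_and -!ltNge => /orP[]; [exact: Fl|exact: Fr].
Unshelve. all: by end_near.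
Qed.

Definition tens f g z : R := f z.1 * g z.2.

Lemma continuous_tens f g : continuous f -> continuous g -> continuous (tens f g).
Proof.
move=> cf cg z; apply: cvgM.
  by apply: (@continuous_comp _ _ _ fst f); [exact: cvg_fst|exact: cf].
by apply: (@continuous_comp _ _ _ snd g); [exact: cvg_snd|exact: cg].
Qed.

Lemma is_derive_tensx f g f' : (forall x : R, is_derive x (1 : R) f (f' x)) ->
  forall z, is_derive z ((1, 0) : R * R) (tens f g) (tens f' g z).
Proof.
move=> df z.
have [d1 d2] := df z.1.
have cv : h^-1 *: (tens f g (h *: ((1, 0) : R * R) + z) - tens f g z) @[h --> 0^'] --> tens f' g z.
  have -> : (fun h : R => h^-1 *: (tens f g (h *: ((1, 0) : R * R) + z) - tens f g z)) =
     (fun h => h^-1 *: (f (h *: 1 + z.1) - f z.1) * g z.2).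
    by rewrite funeqE => h; rewrite /tens /= scaler0 add0r -mulrBl /GRing.scale/= mulrA.
  by apply: cvgM; [rewrite /tens -d2; exact: d1|exact: cvg_cst].
by apply: DeriveDef; [apply/cvg_ex; eexists; exact: cv|apply/cvg_lim].
Qed.

Lemma is_derive_tensy f g g' : (forall x : R, is_derive x (1 : R) g (g' x)) ->
  forall z, is_derive z ((0, 1) : R * R) (tens f g) (tens f g' z).
Proof.
move=> df z.
have [d1 d2] := df z.2.
have cv : h^-1 *: (tens f g (h *: ((0, 1) : R * R) + z) - tens f g z) @[h --> 0^'] --> tens f g' z.
  have -> : (fun h : R => h^-1 *: (tens f g (h *: ((0, 1) : R * R) + z) - tens f g z)) =
     (fun h => f z.1 * (h^-1 *: (g (h *: 1 + z.2) - g z.2))).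
    by rewrite funeqE => h; rewrite /tens /= scaler0 add0r -mulrBr /GRing.scale/= mulrCA.
  by apply: cvgM; [exact: cvg_cst|rewrite /tens -d2; exact: d1].
by apply: DeriveDef; [apply/cvg_ex; eexists; exact: cv|apply/cvg_lim].
Qed.

Lemma pdx_tens f g f' : (forall x : R, is_derive x (1 : R) f (f' x)) ->
  pdx (tens f g) = tens f' g.
Proof.
by move=> df; rewrite funeqE => z; apply: derive_val; exact: is_derive_tensx.
Qed.

Lemma pdy_tens f g g' : (forall x : R, is_derive x (1 : R) g (g' x)) ->
  pdy (tens f g) = tens f g'.
Proof.
by move=> df; rewrite funeqE => z; apply: derive_val; exact: is_derive_tensy.
Qed.

Lemma class_C_tens n f g : diffn n f -> diffn n g -> class_C n (tens f g).
Proof.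
elim: n f g => [|n IH] f g df dg.
  by split=> //; exact: continuous_tens.
have [f' ff' f'n] := df; have [g' gg' g'n] := dg; split.
  by apply: continuous_tens; apply: diffn_continuous; eassumption.
split.
- by move=> z; have := is_derive_tensx g ff' z; case.
- by move=> z; have := is_derive_tensy f gg' z; case.
- by rewrite (pdx_tens _ ff'); apply: IH => //; exact: diffnW.
- by rewrite (pdy_tens _ gg'); apply: IH => //; exact: diffnW.
Qed.

Lemma smooth_tens f g : smooth1 f -> smooth1 g -> smooth (tens f g).
Proof. by move=> sf sg n; exact: class_C_tens. Qed.

(** A closed rectangle inside the open square contains the nonzero set, hence also its closure. *)
Lemma test_function_tens f g : test1 f -> test1 g -> test_function (tens f g).
Proof.
move=> [sf [a [b [a0 ab b1 f0]]]] [sg [c [d [c0 cd d1 g0]]]].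
have sub : closure [set z | tens f g z != 0] `<=` `[a, b] `*` `[c, d].
  have cl : closed (`[a, b] `*` `[c, d] : set (R * R)).
    rewrite (_ : _ `*` _ = fst @^-1` `[a, b] `&` snd @^-1` `[c, d])//.
    apply: closedI.
      apply: ((continuous_closedP (fst : R * R -> R)).1 _); last exact: itv_closed.
      by move=> z; exact: cvg_fst.
    apply: ((continuous_closedP (snd : R * R -> R)).1 _); last exact: itv_closed.
    by move=> z; exact: cvg_snd.
  rewrite ((closure_id _).1 cl); apply: closure_subset => z /=.
  rewrite mulf_eq0 negb_or => /andP[fz gz]; rewrite !in_itv/=.
  by split; [apply: contraNT fz => /f0/eqP|apply: contraNT gz => /g0/eqP].
split.
- exact: smooth_tens.
- apply: subclosed_compact sub; first exact: closed_closure.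
  by apply: compact_setX; exact: segment_compact.
- apply: subset_trans sub _ => z [] /=; rewrite !in_itv/= => /andP[az zb] /andP[cz zd].
  have nb (x u v : R) : 0 < u -> u <= x -> x <= v -> v < 1 -> nbhs x `[0, 1]%classic.
    move=> u0 ux xv v1; have /near_in_itvoo : x \in `]0, 1[.
      by rewrite in_itv/= (lt_le_trans u0 ux) (le_lt_trans xv v1).
    by apply: filterS => y; rewrite !inE; exact: subset_itv_oo_cc.
  exists (`[0, 1], `[0, 1])%classic => //=; split.
    exact: nb a0 az zb b1.
  exact: nb c0 cz zd d1.
Qed.

Lemma smooth1_iter a f : smooth1 f -> smooth1 (iter a (@derive1 _ _) f).
Proof. by move=> sf; elim: a => //= a IH; have [] := smooth1_derive IH. Qed.

Lemma partial_tens a b f g : smooth1 f -> smooth1 g ->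
  partial a b (tens f g) = tens (iter a (@derive1 _ _) f) (iter b (@derive1 _ _) g).
Proof.
move=> sf sg; rewrite /partial.
have -> : iter b (@pdy R) (tens f g) = tens f (iter b (@derive1 _ _) g).
  elim: b => //= b ->; apply: pdy_tens.
  by have [] := smooth1_derive (smooth1_iter b sg).
elim: a => //= a ->; apply: pdx_tens.
by have [] := smooth1_derive (smooth1_iter a sf).
Qed.

End Tensor.

(** * Real-valued integrals *)

Section RealIntegrals.
Context d (T : measurableType d) (R : realType) (mu : {measure set T -> \bar R}).
Implicit Types f g : T -> R.

Lemma aeS (P Q : set T) : (forall x, P x -> Q x) ->
  (\forall x \ae mu, P x) -> \forall x \ae mu, Q x.
Proof. by move=> PQ; apply: filterS. Qed.

Lemma aeS2 (P Q S : set T) : (forall x, P x -> Q x -> S x) ->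
  (\forall x \ae mu, P x) -> (\forall x \ae mu, Q x) -> \forall x \ae mu, S x.
Proof. by move=> PQ; apply: filterS2. Qed.

Lemma integrableD_EFin f g : mu.-integrable setT (EFin \o f) ->
  mu.-integrable setT (EFin \o g) -> mu.-integrable setT (EFin \o (f \+ g)).
Proof. by move=> fi gi; exact: (integrableD measurableT fi gi). Qed.

Lemma integrableB_EFin f g : mu.-integrable setT (EFin \o f) ->
  mu.-integrable setT (EFin \o g) -> mu.-integrable setT (EFin \o (f \- g)).
Proof. by move=> fi gi; exact: (integrableB measurableT fi gi). Qed.

Lemma integrable_EFin_measurable f : mu.-integrable setT (EFin \o f) ->
  measurable_fun setT f.
Proof. by move=> /measurable_int/measurable_EFinP. Qed.

Lemma integrable_dominated f g : measurable_fun setT f ->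
  mu.-integrable setT (EFin \o g) -> (forall x, `|f x| <= `|g x|) ->
  mu.-integrable setT (EFin \o f).
Proof.
move=> mf gi fg; apply: le_integrable gi => //; first exact/measurable_EFinP.
by move=> x _; rewrite /= lee_fin.
Qed.

Lemma integrable_norm f : mu.-integrable setT (EFin \o f) ->
  mu.-integrable setT (EFin \o (fun x => `|f x|)).
Proof. by move=> fi; exact: integrable_abse fi. Qed.

Lemma integrable_bounded_mul f g M : measurable_fun setT f ->
  (forall x, `|f x| <= M) -> mu.-integrable setT (EFin \o g) ->
  mu.-integrable setT (EFin \o (f \* g)).
Proof.
move=> mf fM gi; have mg := integrable_EFin_measurable gi.
have M0 : forall x : T, 0 <= M by move=> x; exact: le_trans (fM x).
apply: (@integrable_dominated _ (M \o* g)); first exact: measurable_funM.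
  rewrite (_ : EFin \o _ = (fun x => M%:E * (EFin \o g) x)%E); first exact: integrableZl.
  by rewrite funeqE => x /=; rewrite -EFinM mulrC.
move=> x /=; rewrite !normrM mulrC ler_wpM2l// (ger0_norm (M0 x)); exact: fM.
Qed.

Lemma Rintegral_ae_eq f g : measurable_fun setT f -> measurable_fun setT g ->
  (\forall x \ae mu, f x = g x) -> \int[mu]_x f x = \int[mu]_x g x.
Proof.
move=> mf mg fg; congr fine; apply: ae_eq_integral => //; try exact/measurable_EFinP.
by apply: filterS fg => x -> _.
Qed.

Lemma Rintegral_dominated_cvg (f_ : nat -> T -> R) f g :
  (forall n, measurable_fun setT (f_ n)) -> measurable_fun setT f ->
  mu.-integrable setT (EFin \o g) ->
  (forall x, f_ n x @[n --> \oo] --> f x) ->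
  (forall n x, `|f_ n x| <= g x) ->
  \int[mu]_x f_ n x @[n --> \oo] --> \int[mu]_x f x.
Proof.
move=> mf_ mf gi ff fg.
have mfE_ n : measurable_fun setT (EFin \o f_ n) by exact/measurable_EFinP.
have mfE : measurable_fun setT (EFin \o f) by exact/measurable_EFinP.
have cvE : \forall x \ae mu, setT x -> (EFin \o f_ n) x @[n --> \oo] --> (EFin \o f) x.
  by apply: aeW => x _; apply: cvg_EFin; [exact: nearW|exact: ff].
have dE : \forall x \ae mu, forall n, setT x -> (`|(EFin \o f_ n) x| <= (EFin \o g) x)%E.
  by apply: aeW => x n _; rewrite /= lee_fin.
have [fi _ cv] := dominated_convergence measurableT mfE_ mfE cvE gi dE.
apply: fine_cvg; rewrite [X in _ --> X]fineK; first exact: cv.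
exact: integrable_fin_num.
Qed.

Lemma Rintegral_eq0_ae f : mu.-integrable setT (EFin \o f) ->
  (forall E, measurable E -> \int[mu]_(x in E) f x = 0) ->
  \forall x \ae mu, f x = 0.
Proof.
move=> fi f0; have : ae_eq mu setT (EFin \o f) (cst 0%E).
  apply: integral_ae_eq => // E _ mE; rewrite integral0 -[LHS]fineK.
    by rewrite -/(Rintegral mu E f) f0.
  by apply: integrable_fin_num => //; exact: integrableS fi.
by apply: filterS => x /(_ I) [].
Qed.

Lemma Rintegral_norm_eq0 f : mu.-integrable setT (EFin \o f) ->
  (\forall x \ae mu, f x = 0) -> forall E, measurable E -> \int[mu]_(x in E) f x = 0.
Proof.
move=> fi f0 E mE; rewrite /Rintegral (ae_eq_integral (cst 0%E)) ?integral0//.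
  by apply: measurable_funS (measurable_int _ fi).
by apply: filterS f0 => x /= -> _.
Qed.

End RealIntegrals.

(** [fine] sends infinite values to 0, so replacing inner integrals by their real values preserves
    integrability. *)
Lemma norm_fine_le (R : realType) (x : \bar R) : (`|(fine x)%:E| <= `|x|)%E.
Proof. by case: x => [r||] //=; rewrite normr0 leey. Qed.

(** * Fubini's theorem with real-valued inner integrals *)

Section RealFubini.
Context d1 d2 (T1 : measurableType d1) (T2 : measurableType d2) (R : realType).
Variables (m1 : {sigma_finite_measure set T1 -> \bar R})
          (m2 : {sigma_finite_measure set T2 -> \bar R}).
Variable f : T1 * T2 -> R.
Hypothesis fi : (m1 \x m2)%E.-integrable setT (EFin \o f).

Lemma ae_int_xsection : \forall x \ae m1, m2.-integrable setT (EFin \o (fun y => f (x, y))).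
Proof. exact: (ae_integrable1 fi). Qed.

Lemma ae_int_ysection : \forall y \ae m2, m1.-integrable setT (EFin \o (fun x => f (x, y))).
Proof. exact: (ae_integrable2 fi). Qed.

Lemma integrable_Rint_xsection :
  m1.-integrable setT (EFin \o (fun x => \int[m2]_y f (x, y))).
Proof.
have iF := integrable_fubini_F fi.
have mF : measurable_fun setT (EFin \o (fun x => \int[m2]_y f (x, y))).
  by apply/measurable_EFinP; apply: measurableT_comp => //; exact: measurable_int iF.
by apply: le_integrable iF => // x _; exact: norm_fine_le.
Qed.

(** The inner integral is dominated by that of the absolute value, whose iterated integral is
    finite. *)
Lemma integrable_fubini_G : m2.-integrable setT (fubini_G m1 (EFin \o f)).
Proof.
have mf := measurable_int _ fi.
apply/integrableP; split; first exact: (measurable_fubini_G fi).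
have lty := (integrable21ltyP m1 m2 mf).1 fi.
apply: le_lt_trans lty.
apply: ge0_le_integral => //.
- exact: measurableT_comp _ (measurable_fubini_G fi).
- by apply: (measurable_fun_fubini_tonelli_G (abse \o (EFin \o f))); first [by move=> z; exact: abse_ge0|exact: measurableT_comp].
- move=> y _; apply: le_abse_integral => //.
  exact: measurableT_comp.
Qed.

Lemma integrable_Rint_ysection :
  m2.-integrable setT (EFin \o (fun y => \int[m1]_x f (x, y))).
Proof.
have iF := integrable_fubini_G.
have mF : measurable_fun setT (EFin \o (fun y => \int[m1]_x f (x, y))).
  by apply/measurable_EFinP; apply: measurableT_comp => //; exact: measurable_int iF.
by apply: le_integrable iF => // x _; exact: norm_fine_le.
Qed.

(** Sections fail to be integrable only on a null set; elsewhere [fine] loses nothing. *)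
Lemma Rfubini12 : \int[(m1 \x m2)%E]_z f z = \int[m1]_x \int[m2]_y f (x, y).
Proof.
rewrite /Rintegral -integral12_prod_meas1//; congr fine.
apply: ae_eq_integral => //.
- exact: measurable_int (integrable_fubini_F fi).
- exact: measurable_int integrable_Rint_xsection.
- apply: filterS ae_int_xsection => x ix _.
  by rewrite fineK//; exact: integrable_fin_num.
Qed.

Lemma Rfubini21 : \int[(m1 \x m2)%E]_z f z = \int[m2]_y \int[m1]_x f (x, y).
Proof.
rewrite /Rintegral -integral21_prod_meas1//; congr fine.
apply: ae_eq_integral => //.
- exact: measurable_int integrable_fubini_G.
- exact: measurable_int integrable_Rint_ysection.
- apply: filterS ae_int_ysection => x ix _.
  by rewrite fineK//; exact: integrable_fin_num.
Qed.

End RealFubini.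

(** * The fundamental lemma of the calculus of variations on the interval *)

Section Fund.
Context {R : realType}.
Local Notation leb := (@lebesgue_measure R).
Implicit Types (f g : R -> R) (F G : R * R -> R).

Lemma smooth1_measurable f : smooth1 f -> measurable_fun setT f.
Proof. by move=> /smooth1_continuous; exact: continuous_measurable_fun. Qed.

Lemma Rintegral_indic d (T : measurableType d) (mu : {measure set T -> \bar R})
    (f : T -> R) (E : set T) : \int[mu]_(x in E) f x = \int[mu]_x (f x * \1_E x).
Proof.
rewrite Rintegral_mkcond; apply: eq_Rintegral => x _; rewrite patchE indicE.
by case: ifPn => _; rewrite ?mulr1 ?mulr0.
Qed.

(** Dominated convergence along the bumps of ]a, b[, which tend to its indicator. *)
Lemma test_int_itv f a b : leb.-integrable setT (EFin \o f) ->
  (forall phi, test1 phi -> \int[leb]_x (f x * phi x) = 0) ->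
  0 < a -> a < b -> b < 1 -> \int[leb]_(x in `]a, b[) f x = 0.
Proof.
move=> fi f0 a0 ab b1; rewrite Rintegral_indic.
have mf := integrable_EFin_measurable fi.
have := @Rintegral_dominated_cvg _ _ _ leb (fun n x => f x * bump a b n x)
  (fun x => f x * \1_(`]a, b[%classic) x) (fun x => `|f x|).
have -> : (fun n => \int[leb]_x (f x * bump a b n x)) = cst 0.
  by rewrite funeqE => n; apply: f0; exact: test1_bump.
move=> cv; have {cv} : (0 : R) @[_ --> \oo] --> \int[leb]_x (f x * \1_(`]a, b[%classic) x).
  apply: cv.
  - by move=> n; apply: measurable_funM => //; exact: smooth1_measurable (smooth1_bump _ _ _).
  - by apply: measurable_funM => //; exact: measurable_indic.
  - exact: integrable_abse fi.
  - by move=> x; apply: cvgM; [exact: cvg_cst|exact: cvg_bump].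
  - move=> n x; rewrite normrM ler_piMr// ger0_norm ?bump_ge0//; exact: bump_le1.
move=> /cvg_lim <- //; exact: lim_cst.
Qed.

(** Since [f] has integral zero over intervals inside ]0, 1[, its primitive is constant there.
    Lebesgue differentiation recovers [f] as the derivative of the primitive almost everywhere, and
    the two endpoints form a null set. *)
Lemma fundamental1 f : leb.-integrable setT (EFin \o f) ->
  (forall x, ~~ (0 <= x <= 1) -> f x = 0) ->
  (forall phi, test1 phi -> \int[leb]_x (f x * phi x) = 0) ->
  \forall x \ae leb, f x = 0.
Proof.
move=> fi fout f0.
have fiE E : measurable E -> leb.-integrable E (EFin \o f) by move=> mE; exact: integrableS fi.
pose F x := \int[leb]_(t in `]-oo, x]) f t.
have Fcst y x : 0 < y -> y < x -> x < 1 -> F x = F y.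
  move=> y0 yx x1; apply/eqP; rewrite -subr_eq0 /F.
  rewrite (@Rintegral_itvB _ f -oo%O (BRight x) y)//; last by rewrite bnd_simp ltW.
  - rewrite -Rintegral_itv_bndo_bndc; last exact: fiE.
    by rewrite test_int_itv.
  - exact: fiE.
have dF0 (x : R) : 0 < x -> x < 1 -> is_derive x (1 : R) F 0.
  move=> x0 x1; apply: (@near_eq_is_derive _ _ _ (cst (F (x / 2)))).
  near=> y; have : x / 2 < y by near: y; apply: lt_nbhsr; lra.
  have : y < 1 by near: y; exact: lt_nbhsl.
  by move=> y1 xy /=; rewrite (@Fcst (x / 2))//; lra.
have aeF : \forall x \ae leb, derivable F x 1 /\ derive1 F x = f x.
  apply: FTC1Ny; first by move=> y; exact: fiE.
  by have := integrable_locally measurableT fi; rewrite patch_setT.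
have ae01 : \forall x \ae leb, x != 0 /\ x != 1.
  have n (c : R) : \forall x \ae leb, x != c.
    exists [set c]; split => //; first exact: lebesgue_measure_set1.
    by move=> x /= /negP; rewrite negbK => /eqP.
  by apply: aeS2 (n 0) (n 1) => x.
apply: aeS2 aeF ae01 => x [dF Fx] [x0 x1].
have [|xout] := boolP (0 <= x <= 1); last exact: fout.
rewrite !le_eqVlt (eq_sym 0) (negbTE x0) (negbTE x1)/= => /andP[{}x0 {}x1].
by rewrite -Fx derive1E; apply: derive_val; exact: dF0.
Unshelve. all: by end_near.
Qed.

Local Notation leb2 := (leb \x leb)%E.

Lemma integrable_tens f g : leb.-integrable setT (EFin \o f) ->
  leb.-integrable setT (EFin \o g) -> leb2.-integrable setT (EFin \o tens f g).
Proof.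
move=> fi gi; have mf := integrable_EFin_measurable fi; have mg := integrable_EFin_measurable gi.
apply/integrable12ltyP.
  apply/measurable_EFinP; apply: measurable_funM.
    exact: measurableT_comp mf measurable_fst.
  exact: measurableT_comp mg measurable_snd.
have [_ fy] := integrableP _ _ _ fi; have [_ gy] := integrableP _ _ _ gi.
have mnf : measurable_fun setT (fun x => `|f x|%:E).
  by apply/measurable_EFinP; exact: measurableT_comp.
have mng : measurable_fun setT (fun x => `|g x|%:E).
  by apply/measurable_EFinP; exact: measurableT_comp.
rewrite (_ : (\int[leb]_x _)%E = ((\int[leb]_x `|f x|%:E) * (\int[leb]_x `|g x|%:E))%E).
  by rewrite lte_mul_pinfty// ?integral_ge0// ge0_fin_numE ?integral_ge0.
rewrite -ge0_integralZr//; last by apply: integral_ge0.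
apply: eq_integral => x _; rewrite -ge0_integralZl//.
by apply: eq_integral => y _; rewrite /tens/= normrM EFinM.
Qed.

Lemma Rintegral_tens f g : leb.-integrable setT (EFin \o f) ->
  leb.-integrable setT (EFin \o g) ->
  \int[leb2]_z tens f g z = (\int[leb]_x f x) * (\int[leb]_x g x).
Proof.
move=> fi gi; rewrite Rfubini12; last exact: integrable_tens.
rewrite -RintegralZr//; apply: eq_Rintegral => x _.
by rewrite -RintegralZl.
Qed.

Lemma test1_bounded f : test1 f -> exists M : R, forall x, `|f x| <= M.
Proof.
move=> [sf [a [b [a0 ab b1 f0]]]].
have /compact_bounded[M [_ HM]] : compact (f @` `[a, b]).
  apply: continuous_compact; last exact: segment_compact.
  by apply: continuous_subspaceT => x; exact: smooth1_continuous.
exists (`|M| + 1) => x; have [xab|/f0 ->] := boolP (a <= x <= b).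
  by apply: HM; [rewrite ltr_pwDr// ler_norm|exists x].
by rewrite normr0 addr_ge0.
Qed.

Lemma test1_integrable f : test1 f -> leb.-integrable setT (EFin \o f).
Proof.
move=> tf; have [M HM] := test1_bounded tf; have [sf [a [b [a0 ab b1 f0]]]] := tf.
have -> : f = f \_ `[a, b].
  rewrite funeqE => x; rewrite patchE; case: ifPn => //.
  by rewrite notin_setE/= in_itv/= => /negP/f0.
have := @integrable_mkcond _ _ _ leb `[a, b]%classic (EFin \o f) (measurable_itv `[a, b]).
rewrite restrict_EFin => -[+ _]; apply.
apply: continuous_compact_integrable; first exact: segment_compact.
by apply: continuous_subspaceT => x; exact: smooth1_continuous.
Qed.

End Fund.

(** * Fubini's theorem with a bounded factor of one variable *)

Section FubiniMul.
Context d1 d2 (T1 : measurableType d1) (T2 : measurableType d2) (R : realType).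
Variables (m1 : {sigma_finite_measure set T1 -> \bar R})
          (m2 : {sigma_finite_measure set T2 -> \bar R}).
Variable F : T1 * T2 -> R.
Hypothesis Fi : (m1 \x m2)%E.-integrable setT (EFin \o F).

Lemma integrable_mul_fst (phi : T1 -> R) M : measurable_fun setT phi ->
  (forall x, `|phi x| <= M) ->
  (m1 \x m2)%E.-integrable setT (EFin \o (fun z => F z * phi z.1)).
Proof.
move=> mphi phiM; rewrite (_ : (fun _ => _) = (phi \o fst) \* F); last first.
  by rewrite funeqE => z /=; rewrite mulrC.
apply: (@integrable_bounded_mul _ _ _ _ _ _ M) => //.
  exact: measurableT_comp mphi measurable_fst.
by move=> z; exact: phiM.
Qed.

Lemma integrable_mul_snd (psi : T2 -> R) M : measurable_fun setT psi ->
  (forall x, `|psi x| <= M) ->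
  (m1 \x m2)%E.-integrable setT (EFin \o (fun z => F z * psi z.2)).
Proof.
move=> mphi phiM; rewrite (_ : (fun _ => _) = (psi \o snd) \* F); last first.
  by rewrite funeqE => z /=; rewrite mulrC.
apply: (@integrable_bounded_mul _ _ _ _ _ _ M) => //.
  exact: measurableT_comp mphi measurable_snd.
by move=> z; exact: phiM.
Qed.

(** On every integrable section the factor leaves the inner integral; the other sections form a null
    set. *)
Lemma Rfubini12_mul (phi : T1 -> R) M : measurable_fun setT phi ->
  (forall x, `|phi x| <= M) ->
  \int[(m1 \x m2)%E]_z (F z * phi z.1) = \int[m1]_x (\int[m2]_y F (x, y) * phi x).
Proof.
move=> mphi phiM; have Fpi := integrable_mul_fst mphi phiM.
rewrite Rfubini12//; apply: Rintegral_ae_eq.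
- exact: integrable_EFin_measurable (integrable_Rint_xsection Fpi).
- apply: measurable_funM => //.
  exact: integrable_EFin_measurable (integrable_Rint_xsection Fi).
- by apply: aeS (ae_int_xsection Fi) => x ix /=; rewrite RintegralZr.
Qed.

Lemma Rfubini21_mul (psi : T2 -> R) M : measurable_fun setT psi ->
  (forall x, `|psi x| <= M) ->
  \int[(m1 \x m2)%E]_z (F z * psi z.2) = \int[m2]_y (\int[m1]_x F (x, y) * psi y).
Proof.
move=> mphi phiM; have Fpi := integrable_mul_snd mphi phiM.
rewrite Rfubini21//; apply: Rintegral_ae_eq.
- exact: integrable_EFin_measurable (integrable_Rint_ysection Fpi).
- apply: measurable_funM => //.
  exact: integrable_EFin_measurable (integrable_Rint_ysection Fi).
- by apply: aeS (ae_int_ysection Fi) => x ix /=; rewrite RintegralZr.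
Qed.

End FubiniMul.

(** * The fundamental lemma on the square *)

Section Fund2.
Context {R : realType}.
Local Notation leb := (@lebesgue_measure R).
Local Notation leb2 := (leb \x leb)%E.

(** One variable at a time. For a fixed test function in y, the integral over y is a function of x
    to which the one-dimensional lemma applies, so the factor in x may become any indicator. Then
    the same is done in y, and [F] has integral zero over all measurable rectangles. *)
Lemma fundamental2 (F : R * R -> R) : leb2.-integrable setT (EFin \o F) ->
  (forall z, ~ Khat R z -> F z = 0) ->
  (forall phi psi, test1 phi -> test1 psi -> \int[leb2]_z (F z * tens phi psi z) = 0) ->
  \forall z \ae leb2, F z = 0.
Proof.
move=> Fi Fout F0.
have b1 (A : set R) : forall x : R, `|\1_A x : R| <= 1.
  by move=> x; rewrite ger0_norm ?indicE//; case: (_ \in _).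
have step1 psi : test1 psi -> forall A, measurable A ->
    \int[leb2]_z (F z * \1_A z.1 * psi z.2) = 0.
  move=> tpsi A mA; have [M HM] := test1_bounded tpsi.
  have mpsi := smooth1_measurable tpsi.1.
  have Fpi := integrable_mul_snd Fi mpsi HM.
  under eq_Rintegral => z _ do rewrite mulrAC.
  have mA1 : measurable_fun setT (\1_A : R -> R) by exact: measurable_indic.
  rewrite (Rfubini12_mul Fpi mA1 (b1 A)).
  rewrite -(Rintegral_indic leb _ A); apply: Rintegral_norm_eq0 mA.
    exact: integrable_Rint_xsection Fpi.
  apply: fundamental1.
  - exact: integrable_Rint_xsection Fpi.
  - move=> x x01; rewrite (@eq_Rintegral _ _ _ _ _ (cst 0)) ?Rintegral_cst ?mul0r//.
    move=> y _; rewrite Fout ?mul0r//= => -[/=]; rewrite in_itv/=.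
    by rewrite (negbTE x01).
  - move=> phi tphi; have [M' HM'] := test1_bounded tphi.
    rewrite -(Rfubini12_mul Fpi _ HM'); last exact: smooth1_measurable tphi.1.
    rewrite -[RHS](F0 _ _ tphi tpsi); apply: eq_Rintegral => z _.
    by rewrite /tens mulrAC mulrA.
have step2 A B : measurable A -> measurable B ->
    \int[leb2]_z (F z * \1_A z.1 * \1_B z.2) = 0.
  move=> mA mB.
  have mA1 : measurable_fun setT (\1_A : R -> R) by exact: measurable_indic.
  have FAi := integrable_mul_fst Fi mA1 (b1 A).
  have mB1 : measurable_fun setT (\1_B : R -> R) by exact: measurable_indic.
  rewrite (Rfubini21_mul FAi mB1 (b1 B)).
  rewrite -(Rintegral_indic leb _ B); apply: Rintegral_norm_eq0 mB.
    exact: integrable_Rint_ysection FAi.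
  apply: fundamental1.
  - exact: integrable_Rint_ysection FAi.
  - move=> y y01; rewrite (@eq_Rintegral _ _ _ _ _ (cst 0)) ?Rintegral_cst ?mul0r//.
    move=> x _; rewrite Fout ?mul0r//= => -[_ /=]; rewrite in_itv/=.
    by rewrite (negbTE y01).
  - move=> psi tpsi; have [M' HM'] := test1_bounded tpsi.
    rewrite -(Rfubini21_mul FAi _ HM'); last exact: smooth1_measurable tpsi.1.
    exact: step1.
apply: Rintegral_eq0_ae => // E mE.
pose G := [set A `*` B | A in @measurable _ (measurableTypeR R) & B in @measurable _ (measurableTypeR R)].
(* Rectangles are stable under intersection and generate the product sigma-algebra; complements are
   settled by the vanishing of the total integral. *)
apply: (@dynkin_induction _ _ G (fun E => \int[leb2]_(x in E) F x = 0)).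
- exact: measurable_prod_measurableType.
- move=> X Y [X1 mX1 [X2 mX2 <-{X}]] [Y1 mY1 [Y2 mY2 <-{Y}]].
  exists (X1 `&` Y1); first exact: measurableI.
  by exists (X2 `&` Y2); [exact: measurableI|rewrite setXI].
- rewrite -[RHS](step2 setT setT)//; apply: eq_Rintegral => z _.
  by rewrite !indicT !mulr1.
- move=> _ [A mA [B mB <-]]; rewrite Rintegral_indic -[RHS](step2 A B)//.
  apply: eq_Rintegral => z _; rewrite -mulrA; congr (_ * _).
  by rewrite !indicE in_setX; case: (_ \in _); rewrite ?mul1r ?mul0r.
- move=> S mS S0; have := @Rintegral_setU _ _ _ leb2 S (~` S) F mS (measurableC mS).
  rewrite setUv S0 add0r => <- //; last first.
    by apply/disj_setPS; rewrite setICr.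
  rewrite -[RHS](step2 setT setT)//; apply: eq_Rintegral => z _.
  by rewrite !indicT !mulr1.
- move=> H mH tH H0; rewrite /Rintegral integral_bigcup//; last first.
    by apply: integrableS Fi => //; exact: bigcupT_measurable.
  rewrite eseries0// => i _ _.
  rewrite -[LHS]fineK; last by apply: integrable_fin_num => //; exact: integrableS Fi.
  by rewrite -/(Rintegral leb2 (H i) F) H0.
- by rewrite -measurable_prod_measurableType.
Qed.

End Fund2.

(** * Polynomials in two variables *)

Section Bipoly.
Context {R : realType}.
Implicit Types (f g : R * R -> R) (n i j : nat).

Definition mono i j (z : R * R) : R := z.1 ^+ i * z.2 ^+ j.

(** The index [n] is the degree plus one, so that [bipoly 0] is the zero space and degree -1 needs
    no special treatment. *)
Definition bipoly n f := exists c : nat -> nat -> R,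
  forall z, f z = \sum_(a : 'I_n * 'I_n | (a.1 + a.2 < n)%N) c a.1 a.2 * mono a.1 a.2 z.

Lemma bipolyD n f g : bipoly n f -> bipoly n g -> bipoly n (f \+ g).
Proof.
move=> [c fc] [d gd]; exists (fun i j => c i j + d i j) => z.
by rewrite /= fc gd -big_split; apply: eq_bigr => a _; rewrite mulrDl.
Qed.

Lemma bipoly0 n : bipoly n (cst 0).
Proof. by exists (fun _ _ => 0) => z; rewrite big1// => a _; rewrite mul0r. Qed.

Lemma bipoly_cmono n c i j : (i + j < n)%N -> bipoly n (fun z => c * mono i j z).
Proof.
move=> ijn; exists (fun i' j' => if (i' == i) && (j' == j) then c else 0) => z.
have lin : (i < n)%N by exact: leq_ltn_trans (leq_addr _ _) ijn.
have ljn : (j < n)%N by exact: leq_ltn_trans (leq_addl _ _) ijn.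
rewrite (bigD1 (Ordinal lin, Ordinal ljn))//= !eqxx/= big1 ?addr0// => -[i' j'] /= /andP[_ ne].
case: ifPn; last by rewrite mul0r.
by move=> /andP[/eqP ii /eqP jj]; move: ne; rewrite -pair_eqE/= -!val_eqE/= ii jj !eqxx.
Qed.

(** Reduces additive statements about polynomials to a single monomial. *)
Lemma bipoly_ind n (P : (R * R -> R) -> Prop) : P (cst 0) ->
  (forall f g, P f -> P g -> P (f \+ g)) ->
  (forall c i j, (i + j < n)%N -> P (fun z => c * mono i j z)) ->
  forall f, bipoly n f -> P f.
Proof.
move=> P0 PD Pm f [c fc].
have -> : f = \sum_(a : 'I_n * 'I_n | (a.1 + a.2 < n)%N) (fun z => c a.1 a.2 * mono a.1 a.2 z).
  by rewrite funeqE => z; rewrite fct_sumE fc.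
elim/big_ind: _ => //.
by move=> a an; exact: Pm.
Qed.

Lemma bipolyZ n a f : bipoly n f -> bipoly n (fun z => a * f z).
Proof.
move=> [c fc]; exists (fun i j => a * c i j) => z.
by rewrite fc mulr_sumr; apply: eq_bigr => b _; rewrite mulrA.
Qed.

Lemma bipolyB n f g : bipoly n f -> bipoly n g -> bipoly n (f \- g).
Proof.
move=> bf bg; rewrite (_ : f \- g = f \+ (fun z => -1 * g z)).
  by apply: bipolyD => //; exact: bipolyZ.
by rewrite funeqE => z /=; rewrite mulN1r.
Qed.

Lemma bipoly_mono n i j : (i + j < n)%N -> bipoly n (mono i j).
Proof.
move=> /(bipoly_cmono 1); congr bipoly; rewrite funeqE => z; exact: mul1r.
Qed.

Lemma bipoly_leq n m f : (n <= m)%N -> bipoly n f -> bipoly m f.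
Proof.
move=> nm; apply: bipoly_ind; [exact: bipoly0|exact: bipolyD|].
by move=> c i j ijn; apply: bipoly_cmono; exact: leq_trans nm.
Qed.

Lemma bipoly_mulmono n i j f : bipoly n f -> bipoly (n + (i + j)) (fun z => f z * mono i j z).
Proof.
move: f; apply: bipoly_ind.
- rewrite (_ : (fun _ => _) = cst 0); first exact: bipoly0.
  by rewrite funeqE => z; rewrite mul0r.
- move=> f g bf bg; rewrite (_ : (fun _ => _) = (fun z => f z * mono i j z) \+ (fun z => g z * mono i j z)).
    exact: bipolyD.
  by rewrite funeqE => z; rewrite /= mulrDl.
- move=> c i' j' ij; rewrite (_ : (fun _ => _) = (fun z => c * mono (i' + i) (j' + j) z)).
    by apply: bipoly_cmono; rewrite addnACA ltn_add2r.
  by rewrite funeqE => z; rewrite /mono !exprD; lra.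
Qed.

(** The case n = 0 is the trivial space of degree -1, the interior test space for interpolation of
    order 1. *)
Lemma polyK_bipoly n (m : int) f : m = n%:Z - 1 -> (polyK m f <-> bipoly n f).
Proof.
move=> ->.
have lt_n i j : (i%:Z + j%:Z <= n%:Z - 1) = (i + j < n)%N.
  by rewrite lerBrDr -PoszD -[1]/(1%:Z) -PoszD lez_nat addn1.
split.
- move=> [P Pn fP]; exists (fun i j => P`_i`_j) => z.
  have P0 i j : (n <= i + j)%N -> P`_i`_j = 0.
    by move=> nij; apply/eqP; apply: contraTT nij => /Pn; rewrite lt_n -ltnNge.
  have sP : (size P <= n)%N.
    apply/leq_sizeP => i ni; apply/polyP => j; rewrite coef0 P0//.
    exact: leq_trans (leq_addr _ _).
  have sPi (i : nat) : (size (P`_i)%R <= n)%N.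
    by apply/leq_sizeP => j nj; rewrite P0//; exact: leq_trans (leq_addl _ _).
  rewrite fP (horner_coef_wide _ sP) horner_sum.
  transitivity (\sum_(i < n) \sum_(j < n) P`_i`_j * mono i j z).
    apply: eq_bigr => i _.
    rewrite hornerM horner_exp hornerC (horner_coef_wide _ (sPi i)) mulr_suml.
    by apply: eq_bigr => j _; rewrite /mono -mulrA (mulrC (z.1 ^+ i)).
  rewrite pair_big/= [RHS]big_mkcond/=; apply: eq_bigr => a _.
  by case: ltnP => // na; rewrite P0// mul0r.
- apply: bipoly_ind.
  + by exists 0 => [i j|z]; rewrite ?coef0 ?eqxx// !horner0.
  + move=> f1 f2 [P1 Pn1 fP1] [P2 Pn2 fP2]; exists (P1 + P2).
      move=> i j; rewrite !coefD => ne; have [e1|] := eqVneq (P1`_i`_j) 0; last exact: Pn1.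
      by apply: Pn2; apply: contraNN ne => /eqP e2; rewrite e1 e2 addr0.
    by move=> z; rewrite /= fP1 fP2 !hornerD.
  + move=> c i j ijn; exists ((c *: 'X^j)%:P * 'X^i).
      move=> i' j'; rewrite coefCM coefXn; case: (i' =P i) => [->|_]; last by rewrite mulr0 coef0 eqxx.
      rewrite mulr1 coefZ coefXn; case: (j' =P j) => [->|_]; last by rewrite mulr0 eqxx.
      by rewrite lt_n.
    move=> z; rewrite hornerM hornerC hornerXn hornerM hornerZ hornerXn horner_exp hornerC.
    by rewrite /mono; lra.
Qed.

End Bipoly.

(** * The primitive with vanishing weighted mean, and its transpose *)

Section Kernel.
Context {R : realType}.
Local Notation leb := (@lebesgue_measure R).
Local Notation leb2 := (leb \x leb)%E.
Local Notation J := (\1_(`[0, 1]%classic : set R) : R -> R).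
Implicit Types (f g phi psi : R -> R).

(** A zero integral would make the bump vanish almost everywhere, but it is positive on an interval
    of positive length. *)
Lemma integral_bump_gt0 (a b : R) n : 0 < a -> a < b -> b < 1 ->
  0 < \int[leb]_x bump a b n x.
Proof.
move=> a0 ab b1; rewrite lt_neqAle Rintegral_ge0 ?andbT; last first.
  by move=> x _; exact: bump_ge0.
apply/eqP => /esym int0.
have bi := test1_integrable (test1_bump n a0 ab b1).
have mb := integrable_EFin_measurable bi.
have ae0 : ae_eq leb setT (EFin \o bump a b n) (cst 0%E).
  apply/(ae_eq_integral_abs leb measurableT); first exact/measurable_EFinP.
  transitivity (\int[leb]_x (bump a b n x)%:E)%E.
    by apply: eq_integral => x _; rewrite gee0_abs// lee_fin bump_ge0.
  by rewrite -(fineK (integrable_fin_num measurableT bi)); congr EFin.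
have [N [mN N0 sub]] := ae0.
have : (leb `]a, b[%classic <= leb N)%E.
  apply: le_measure; rewrite ?inE//.
  move=> x /= xab; apply: sub => /= /(_ I) [] /eqP.
  by rewrite gt_eqF// bump_gt0//; move: xab; rewrite in_itv.
by rewrite lebesgue_measure_itv/= lte_fin ab N0 -EFinD lee_fin subr_le0 leNgt ab.
Qed.

Definition mollifier (a b x : R) : R := (\int[leb]_y bump a b 0 y)^-1 * bump a b 0 x.

Lemma mollifierP (a b : R) : 0 < a -> a < b -> b < 1 ->
  [/\ test1 (mollifier a b), forall x, 0 <= mollifier a b x,
     \int[leb]_x mollifier a b x = 1 & forall x, ~~ (a < x < b) -> mollifier a b x = 0].
Proof.
move=> a0 ab b1; have gt0 := integral_bump_gt0 0 a0 ab b1.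
have bi := test1_integrable (test1_bump 0 a0 ab b1); split.
- exact: (test1M (smooth1_cst _) (test1_bump 0 a0 ab b1)).
- by move=> x; rewrite mulr_ge0 ?bump_ge0// invr_ge0 ltW.
- by rewrite RintegralZl// mulVf// gt_eqF.
- by move=> x xab; rewrite /mollifier bump_out ?mulr0.
Qed.

Lemma test1_out f x : test1 f -> ~~ (0 < x < 1) -> f x = 0.
Proof.
move=> [_ [a [b [a0 ab b1 f0]]]] x01; apply: f0; apply: contra x01 => /andP[ax xb].
by rewrite (lt_le_trans a0 ax) (le_lt_trans xb b1).
Qed.

Lemma test1_J f x : test1 f -> J x * f x = f x.
Proof.
move=> tf; rewrite indicE mem_setE in_itv/=; have [|x01] := boolP (0 <= x <= 1).
  by rewrite mul1r.
rewrite (test1_out tf) ?mulr0//; apply: contra x01 => /andP[x0 x1]; by rewrite !ltW.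
Qed.

Lemma J_bound x : `|J x| <= 1.
Proof. by rewrite ger0_norm ?indicE//; case: (_ \in _). Qed.

Lemma measurable_J : measurable_fun setT J.
Proof. by apply: measurable_indic; exact: measurable_itv. Qed.

Lemma integrable_J : leb.-integrable setT (EFin \o J).
Proof.
exact: integrable_indic_itv.
Qed.

Lemma Rintegral_J : \int[leb]_x J x = 1.
Proof.
transitivity (\int[leb]_(_ in `[0, 1]) (1 : R)).
  by rewrite [RHS]Rintegral_indic; apply: eq_Rintegral => x _; rewrite mul1r.
by rewrite Rintegral_cst//= lebesgue_measure_itv/= lte_fin ltr01 -EFinD/= subr0 mulr1.
Qed.

Section rho.
Variable rho : R -> R.
Hypothesis trho : test1 rho.
Hypothesis rho0 : forall x, 0 <= rho x.
Hypothesis irho : \int[leb]_x rho x = 1.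

Let ri := test1_integrable trho.

Definition heaviside (w : R * R) : R := (w.2 <= w.1)%R%:R.

Lemma measurable_heaviside : measurable_fun setT heaviside.
Proof.
have m : measurable_fun setT (fun w : R * R => w.2 <= w.1).
  by apply: measurable_fun_ler; [exact: measurable_snd|exact: measurable_fst].
exact: (measurableT_comp (f := fun b : bool => (b%:R : R)) _ m).
Qed.

Lemma heaviside01 w : heaviside w = 0 \/ heaviside w = 1.
Proof. by rewrite /heaviside; case: (w.2 <= w.1)%R; [right|left]. Qed.

Lemma heaviside_bound w : `|heaviside w| <= 1.
Proof. by case: (heaviside01 w) => ->; rewrite ?normr1 ?normr0. Qed.

Lemma measurable_heavisidel s : measurable_fun setT (fun x => heaviside (x, s)).
Proof. by apply: measurableT_comp measurable_heaviside _; exact: measurable_pair2. Qed.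

Definition kap (s : R) : R := \int[leb]_x (heaviside (x, s) * rho x).

(** For w = (x, s), the Heaviside part integrates in s to a primitive in x. [kap s] is the mass of
    [rho] to the right of s, and subtracting it removes the [rho]-mean of that primitive. *)
Definition ker (w : R * R) : R := heaviside w - kap w.2.

Lemma int_heavisideM s g : leb.-integrable setT (EFin \o g) ->
  leb.-integrable setT (EFin \o (fun x => heaviside (x, s) * g x)).
Proof.
move=> gi; exact: (@integrable_bounded_mul _ _ _ leb _ _ _ (measurable_heavisidel s) (fun x => heaviside_bound (x, s)) gi).
Qed.

Lemma kap_itv s : 0 <= kap s <= 1.
Proof.
apply/andP; split.
  by apply: Rintegral_ge0 => x _; rewrite mulr_ge0//; case: (heaviside01 (x, s)) => ->.
rewrite -irho; apply: le_Rintegral => //; first exact: int_heavisideM.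
by move=> x _; rewrite ler_piMl//; case: (heaviside01 (x, s)) => ->.
Qed.

Lemma measurable_kap : measurable_fun setT kap.
Proof.
have m : measurable_fun setT (fun w : R * R => (heaviside w * rho w.1)%:E).
  apply/measurable_EFinP; apply: measurable_funM; first exact: measurable_heaviside.
  exact: measurableT_comp (integrable_EFin_measurable ri) measurable_fst.
have mG : measurable_fun setT (fubini_G leb (fun w : R * R => (heaviside w * rho w.1)%:E)).
  apply: (@measurable_fun_fubini_tonelli_G _ _ _ _ _ leb _ m) => w.
  by rewrite lee_fin mulr_ge0//; case: (heaviside01 w) => ->.
exact: measurableT_comp (fine_measurable measurableT) mG.
Qed.

Lemma measurable_ker : measurable_fun setT ker.
Proof.
apply: measurable_funB; first exact: measurable_heaviside.
exact: measurableT_comp measurable_kap measurable_snd.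
Qed.

Lemma ker_bound w : `|ker w| <= 1.
Proof.
have /andP[k0 k1] := kap_itv w.2; rewrite /ker.
by case: (heaviside01 w) => ->; rewrite ler_norml; lra.
Qed.

Lemma measurable_kerl s : measurable_fun setT (fun x => ker (x, s)).
Proof. by apply: measurableT_comp measurable_ker _; exact: measurable_pair2. Qed.

Lemma measurable_kerr x : measurable_fun setT (fun s => ker (x, s)).
Proof. by apply: measurableT_comp measurable_ker _; exact: measurable_pair1. Qed.

(** The transpose of the primitive operator [Bop] below. *)
Definition tker phi s := \int[leb]_x (ker (x, s) * phi x).

(** The function [chi], which is [phi] minus c [rho], has integral zero and hence a primitive F that
    is a test function; [tker phi] is -F. *)
Lemma tkerP phi : test1 phi ->
  test1 (tker phi) /\
  derive1 (tker phi) = (fun x => (\int[leb]_y phi y) * rho x - phi x).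
Proof.
move=> tphi; have phii := test1_integrable tphi.
set c := \int[leb]_y phi y.
pose chi x := phi x - c * rho x.
have tchi : test1 chi.
  have [sp [a [b [a0 ab b1 p0]]]] := tphi; have [sr [a' [b' [a0' ab' b1' r0]]]] := trho.
  split.
    rewrite (_ : chi = phi \+ (cst (- c) \* rho)); last first.
      by rewrite funeqE => x; rewrite /chi /= mulNr.
    by apply: smooth1D => //; apply: smooth1M => //; exact: smooth1_cst.
  exists (Num.min a a'), (Num.max b b'); split.
  - by rewrite lt_min a0 a0'.
  - by rewrite gt_min lt_max ab.
  - by rewrite gt_max b1 b1'.
  - move=> x; rewrite negb_and -!ltNge lt_min gt_max => xab.
    rewrite /chi p0 ?r0 ?mulr0 ?subr0//.
      by rewrite negb_and -!ltNge; case/orP: xab => /andP[h1 h2]; rewrite ?h1 ?h2 ?orbT.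
    by rewrite negb_and -!ltNge; case/orP: xab => /andP[h1 h2]; rewrite ?h1 ?h2 ?orbT.
have int_c : leb.-integrable setT (EFin \o (fun x => c * rho x)).
  exact: (integrableZl measurableT c ri).
have chi0 : \int[leb]_x chi x = 0.
  by rewrite /chi RintegralB// RintegralZl// irho mulr1 subrr.
have chii := test1_integrable tchi.
(* Integrating [kap s] against [phi] gives c [kap s], which is also the Heaviside integral of the
   [rho] part of [chi]. *)
have tkerE s : tker phi s = \int[leb]_x (heaviside (x, s) * chi x).
  have h1 := int_heavisideM s phii; have h2 := int_heavisideM s ri.
  transitivity (\int[leb]_x (heaviside (x, s) * phi x) - kap s * c).
    rewrite /c -RintegralZl// -RintegralB//; last exact: (integrableZl measurableT (kap s) phii).
    by apply: eq_Rintegral => x _; rewrite /ker mulrBl.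
  rewrite /kap -RintegralZr// -RintegralB//; last exact: (integrableZr measurableT c h2).
  by apply: eq_Rintegral => x _; rewrite /chi mulrBr; lra.
have [F tF dF] := test1_primitive tchi chi0.
have [sF _] := tF; have [dFx _] := smooth1_derive sF.
have tkF s : tker phi s = - F s.
  rewrite tkerE.
  (* Past 1 both sides vanish; below 1 the integral over [s, 1] is F(1) - F(s) with F(1) = 0. *)
  have [s1|s1] := leP 1 s.
    rewrite (test1_out tF) ?oppr0; last by rewrite negb_and -!leNgt s1 orbT.
    rewrite (@eq_Rintegral _ _ _ _ _ (cst 0)) ?Rintegral_cst ?mul0r// => x _ /=.
    rewrite /heaviside /=; case: leP => [sx|]; last by rewrite mul0r.
    by rewrite (test1_out tchi) ?mulr0// negb_and -!leNgt (le_trans s1 sx) orbT.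
  transitivity (\int[leb]_(x in `[s, 1]) chi x).
    rewrite [RHS]Rintegral_indic; apply: eq_Rintegral => x _.
    rewrite mulrC indicE mem_setE in_itv/= /heaviside/=.
    have [x1|x1] := leP x 1; first by rewrite andbT.
    by rewrite (test1_out tchi) ?mul0r// negb_and -!leNgt (ltW x1) orbT.
  rewrite /Rintegral (@continuous_FTC2 _ _ F)//.
  - by rewrite (test1_out tF (x := 1)) ?sub0e// ltxx andbF.
  - by apply: continuous_subspaceT => x; apply: smooth1_continuous; exact: tchi.1.
  - split.
    + by move=> x _; case: (dFx x).
    + by apply: cvg_at_right_filter; exact: smooth1_continuous.
    + by apply: cvg_at_left_filter; exact: smooth1_continuous.
  - by move=> x _; rewrite dF.
have -> : tker phi = cst (-1) \* F by rewrite funeqE => s; rewrite tkF /= mulN1r.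
split; first by apply: test1M tF; exact: smooth1_cst.
rewrite funeqE => x; rewrite derive1E.
have : is_derive x (1 : R) (cst (-1) \* F) (cst (-1) x *: derive1 F x + F x *: 0).
  by apply: (is_deriveM (is_derive_cst (-1 : R) x (1 : R)) (dFx x)).
case=> _ ->; rewrite dF /GRing.scale /= mulr0 addr0 /chi; lra.
Qed.

(* The primitive of [g] on [0, 1] whose mean against [rho] vanishes. *)
Definition Bop g x := \int[leb]_s (ker (x, s) * g s).

Lemma int_kerMr x g : leb.-integrable setT (EFin \o g) ->
  leb.-integrable setT (EFin \o (fun s => ker (x, s) * g s)).
Proof.
move=> gi; exact: (@integrable_bounded_mul _ _ _ leb _ _ _ (measurable_kerr x) (fun s => ker_bound (x, s)) gi).
Qed.

Lemma Bop_bound g x : leb.-integrable setT (EFin \o g) -> `|Bop g x| <= \int[leb]_s `|g s|.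
Proof.
move=> gi; apply: le_trans (le_normr_Rintegral _ _) _ => //; first exact: int_kerMr.
apply: le_Rintegral => //.
- by apply: integrable_norm; exact: int_kerMr.
- exact: integrable_norm.
- by move=> s _; rewrite normrM ler_piMl// ker_bound.
Qed.

Lemma int_tens_ker f g : leb.-integrable setT (EFin \o f) ->
  leb.-integrable setT (EFin \o g) ->
  leb2.-integrable setT (EFin \o (fun w => ker w * tens f g w)).
Proof.
move=> fi gi; apply: (@integrable_bounded_mul _ _ _ leb2 _ _ _ measurable_ker ker_bound).
exact: integrable_tens.
Qed.

Lemma integrable_mulBop f g : leb.-integrable setT (EFin \o f) ->
  leb.-integrable setT (EFin \o g) -> leb.-integrable setT (EFin \o (fun x => f x * Bop g x)).
Proof.
move=> fi gi; have := integrable_Rint_xsection (int_tens_ker fi gi).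
congr (_.-integrable _ _); rewrite funeqE => x /=; congr EFin.
rewrite /Bop -RintegralZl//; last exact: int_kerMr.
by apply: eq_Rintegral => s _; rewrite /tens/= mulrCA.
Qed.

(** Fubini's theorem, available because the kernel is bounded by 1. *)
Lemma Bop_dual f g : leb.-integrable setT (EFin \o f) ->
  leb.-integrable setT (EFin \o g) ->
  \int[leb]_x (f x * Bop g x) = \int[leb]_s (g s * tker f s).
Proof.
move=> fi gi; have H := int_tens_ker fi gi.
transitivity (\int[leb2]_w (ker w * tens f g w)).
  rewrite Rfubini12//; apply: eq_Rintegral => x _.
  rewrite /Bop -RintegralZl//; last exact: int_kerMr.
  by apply: eq_Rintegral => s _; rewrite /tens/= mulrCA.
rewrite Rfubini21//; apply: eq_Rintegral => s _.
rewrite /tker -RintegralZl//.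
  by apply: eq_Rintegral => x _; rewrite /tens/=; lra.
exact: (@integrable_bounded_mul _ _ _ leb _ _ _ (measurable_kerl s) (fun x => ker_bound (x, s)) fi).
Qed.

End rho.
End Kernel.

(* The library only lets canonical structures find that a product measure is
   sigma-finite when its factors are subprobabilities. *)
Section PlaneMeasure.
Context {R : realType}.
Local Notation leb := (@lebesgue_measure R).

Definition plane_measure := (leb \x leb)%E.

HB.instance Definition _ := Measure.on plane_measure.

Let plane_measure_sigma_finite : sigma_finite setT plane_measure.
Proof.
have /sigma_finiteP[F [TF ndF Foo]] := sigma_finiteT leb.
exists (fun n => F n `*` F n).
  rewrite -setXTT TF predeqE => -[x y]; split.
    move=> [/= [n _ Fnx] [k _ Fky]]; exists (maxn n k) => //; split.
    - by move: x Fnx; exact/subsetPset/ndF/leq_maxl.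
    - by move: y Fky; exact/subsetPset/ndF/leq_maxr.
  by move=> [n _ []/= ? ?]; split; exists n.
move=> k; have [mF Fk] := Foo k; split; first exact: measurableX.
by rewrite /plane_measure product_measure1E// lte_mul_pinfty// ge0_fin_numE.
Qed.

HB.instance Definition _ := Measure_isSigmaFinite.Build _ _ _ plane_measure
  plane_measure_sigma_finite.

End PlaneMeasure.

(** * The Poincare representation formula *)

Section Poincare.
Context {R : realType}.
Local Notation leb := (@lebesgue_measure R).
Local Notation leb2 := (leb \x leb)%E.
Local Notation J := (\1_(`[0, 1]%classic : set R) : R -> R).
Implicit Types (f g phi psi : R -> R) (G : R * R -> R).

(** Extension by zero lets every integral be taken over the whole plane. *)
Definition L1K G := leb2.-integrable setT (EFin \o G) /\ forall z, ~ Khat R z -> G z = 0.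

Lemma L1K_JJ G : L1K G -> forall z, J z.1 * (J z.2 * G z) = G z.
Proof.
move=> [_ G0] z; have [[/= z1 z2]|/G0 ->] := pselect (Khat R z); last by rewrite !mulr0.
by rewrite !indicE !mem_setE z1 z2 !mul1r.
Qed.

Lemma L1KD G H : L1K G -> L1K H -> L1K (G \+ H).
Proof.
move=> [Gi G0] [Hi H0]; split; first exact: integrableD_EFin.
by move=> z nz; rewrite /= G0// H0// addr0.
Qed.

Lemma L1KB G H : L1K G -> L1K H -> L1K (G \- H).
Proof.
move=> [Gi G0] [Hi H0]; split; first exact: integrableB_EFin.
by move=> z nz; rewrite /= G0// H0// subr0.
Qed.

Lemma L1K_tens f g : leb.-integrable setT (EFin \o f) -> leb.-integrable setT (EFin \o g) ->
  L1K (tens (fun x => J x * f x) (fun y => J y * g y)).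
Proof.
move=> fi gi.
have Ji h : leb.-integrable setT (EFin \o h) -> leb.-integrable setT (EFin \o (fun x => J x * h x)).
  exact: (@integrable_bounded_mul _ _ _ leb _ _ _ measurable_J J_bound).
split; first by apply: integrable_tens; exact: Ji.
move=> z nz; rewrite /tens !indicE !mem_setE.
have [z1|] := boolP (z.1 \in `[0, 1]); last by rewrite !mul0r.
have [z2|] := boolP (z.2 \in `[0, 1]); last by rewrite mul0r mulr0.
by exfalso; apply: nz; split.
Qed.

Lemma L1K_mul_tens G phi psi : L1K G -> test1 phi -> test1 psi ->
  leb2.-integrable setT (EFin \o (fun z => G z * tens phi psi z)).
Proof.
move=> [Gi _] tp ts; have [M HM] := test1_bounded tp; have [N HN] := test1_bounded ts.
have h := integrable_mul_fst Gi (smooth1_measurable tp.1) HM.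
have := integrable_mul_snd h (smooth1_measurable ts.1) HN.
by congr (_.-integrable _ _); rewrite funeqE => z /=; rewrite /tens mulrA.
Qed.

Section rho.
Variable rho : R -> R.
Hypothesis trho : test1 rho.
Hypothesis rho0 : forall x, 0 <= rho x.
Hypothesis irho : \int[leb]_x rho x = 1.

Local Notation ker := (ker rho).
Local Notation Bop := (Bop rho).
Local Notation tker := (tker rho).

(* For [rho] of integral 1, G(x,y) minus the [rho]-mean of G(.,y) is the
   primitive [Aop1] of the x-derivative, and that mean minus its own [rho]-mean is
   the primitive [Aop2] of the averaged y-derivative. *)
Definition Aop1 G (z : R * R) : R := J z.1 * Bop (fun s => G (s, z.2)) z.1.

Definition Aop2 G (z : R * R) : R :=
  J z.1 * (J z.2 * Bop (fun t => \int[leb]_s (G (s, t) * rho s)) z.2).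

(** The operator is the inner integral of a function [H] of three variables. With s as outermost
    variable, Tonelli bounds the integral of |H| by that of |G|, because the kernel is at most 1 and
    x ranges over an interval of length 1. *)
Lemma L1K_Aop1 G : L1K G -> L1K (Aop1 G).
Proof.
move=> [Gi G0]; split; last first.
  move=> z nz; rewrite /Aop1 indicE mem_setE; have [z1|] := boolP (z.1 \in `[0, 1]); last by rewrite mul0r.
  rewrite /Bop (@eq_Rintegral _ _ _ _ _ (cst 0)) ?Rintegral_cst ?mul0r ?mulr0// => s _ /=.
  by rewrite G0 ?mulr0// => -[/= _ z2]; apply: nz.
pose H (w : (R * R) * R) : R := J w.1.1 * (ker (w.1.1, w.2) * G (w.2, w.1.2)).
have mG := integrable_EFin_measurable Gi.
have mH : measurable_fun setT H.
  apply: measurable_funM.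
    apply: (measurableT_comp measurable_J); exact: (measurableT_comp measurable_fst measurable_fst).
  apply: measurable_funM.
    apply: (measurableT_comp (measurable_ker trho rho0)).
    by apply: measurable_fun_pair; [exact: (measurableT_comp measurable_fst measurable_fst)|exact: measurable_snd].
  apply: (measurableT_comp mG).
  by apply: measurable_fun_pair; [exact: measurable_snd|exact: (measurableT_comp measurable_snd measurable_fst)].
have Hi : (@plane_measure R \x leb)%E.-integrable setT (EFin \o H).
  have mHE : measurable_fun setT (EFin \o H) by exact/measurable_EFinP.
  apply: (proj2 (integrable21ltyP (@plane_measure R) leb mHE)).
  have lty := (integrable12ltyP leb leb (measurable_int _ Gi)).1 Gi.
  apply: le_lt_trans lty.
  apply: ge0_le_integral => //.
  - by move=> s _; apply: integral_ge0.
  - apply: (@measurable_fun_fubini_tonelli_G _ _ _ _ _ (@plane_measure R) (fun w => `|(EFin \o H) w|)%E) => //.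
    by apply: measurableT_comp => //; exact/measurable_EFinP.
  - apply: (@measurable_fun_fubini_tonelli_F _ _ _ _ _ leb (fun w => `|(EFin \o G) w|)%E) => //.
    by apply: measurableT_comp => //; exact/measurable_EFinP.
  move=> s _.
  have mGs : measurable_fun setT (fun y => `|G (s, y)|%:E).
    apply/measurable_EFinP; apply: measurableT_comp => //.
    by apply: (measurableT_comp mG); exact: measurable_pair1.
  apply: (@le_trans _ _ (\int[leb2]_w (J w.1 * `|G (s, w.2)|)%:E)%E).
    apply: ge0_le_integral => //.
    - apply/measurable_EFinP; apply: measurableT_comp => //.
      by apply: (measurableT_comp mH); exact: measurable_pair2.
    - apply/measurable_EFinP; apply: measurable_funM; first exact: (measurableT_comp measurable_J measurable_fst).
      apply: measurableT_comp => //; apply: (measurableT_comp mG).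
      by apply: measurable_fun_pair; [exact: measurable_cst|exact: measurable_snd].
    move=> w _; rewrite /H /= lee_fin !normrM.
    have J0 : 0 <= J w.1 by rewrite indicE.
    by rewrite (ger0_norm J0) ler_wpM2l// ler_piMl// ker_bound.
  have mJG : measurable_fun setT (fun w : R * R => (J w.1 * `|G (s, w.2)|)%:E).
    apply/measurable_EFinP; apply: measurable_funM; first exact: (measurableT_comp measurable_J measurable_fst).
    apply: measurableT_comp => //; apply: (measurableT_comp mG).
    by apply: measurable_fun_pair; [exact: measurable_cst|exact: measurable_snd].
  have JG0 (w : R * R) : (0 <= (J w.1 * `|G (s, w.2)|)%:E)%E by rewrite lee_fin mulr_ge0// indicE.
  have -> : (\int[leb2]_w (J w.1 * `|G (s, w.2)|)%:E =
     \int[leb]_x ((J x)%:E * \int[leb]_y `|G (s, y)|%:E))%E.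
    rewrite (@fubini_tonelli1 _ _ _ _ _ leb leb _ mJG JG0).
    apply: eq_integral => x _; rewrite /fubini_F /= -ge0_integralZl//.
  have iG0 : (0 <= \int[leb]_y `|G (s, y)|%:E)%E by apply: integral_ge0.
  have J0 x : setT x -> (0 <= (J x)%:E)%E by rewrite lee_fin indicE.
  have mJE : measurable_fun setT (fun x => (J x)%:E) by apply/measurable_EFinP; exact: measurable_J.
  rewrite (ge0_integralZr leb measurableT mJE J0 iG0).
  by rewrite integral_indic//= setIT lebesgue_measure_itv/= lte_fin ltr01 -EFinD subr0 mul1e.
have := integrable_Rint_xsection Hi.
congr (_.-integrable _ _); rewrite funeqE => -[x y] /=; congr EFin.
rewrite /Aop1 /Bop /H /=.
rewrite [J x]indicE; case: (_ \in _).
  by rewrite mul1r; apply: eq_Rintegral => s' _; rewrite mul1r.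
rewrite mul0r (@eq_Rintegral _ _ _ _ _ (cst 0)) ?Rintegral_cst ?mul0r// => s' _.
by rewrite mul0r.
Qed.

Lemma integrable_slice G : L1K G -> leb.-integrable setT
  (EFin \o (fun t => \int[leb]_s (G (s, t) * rho s))).
Proof.
move=> [Gi _]; have [M HM] := test1_bounded trho.
have := integrable_mul_fst Gi (smooth1_measurable trho.1) HM.
exact: integrable_Rint_ysection.
Qed.

Lemma integrable_JBop g : leb.-integrable setT (EFin \o g) ->
  leb.-integrable setT (EFin \o (fun x => J x * Bop g x)).
Proof. exact: (integrable_mulBop trho rho0 irho integrable_J). Qed.

Lemma L1K_Aop2 G : L1K G -> L1K (Aop2 G).
Proof.
move=> LG; have gi := integrable_slice LG.
have [_ G0] := LG; have Ji := integrable_J (R := R).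
split.
  exact: (integrable_tens Ji (integrable_JBop gi)).
move=> z nz; rewrite /Aop2 !indicE !mem_setE.
have [z1|] := boolP (z.1 \in `[0, 1]); last by rewrite !mul0r.
have [z2|] := boolP (z.2 \in `[0, 1]); last by rewrite mul0r mulr0.
by exfalso; apply: nz; split.
Qed.

(** On almost every horizontal line the slice of [G] is integrable, and the one-dimensional duality
    applies to it. *)
Lemma Aop1_dual G phi psi : L1K G -> test1 phi -> test1 psi ->
  \int[leb2]_z (Aop1 G z * tens phi psi z) =
  \int[leb2]_z (G z * tens (tker phi) psi z).
Proof.
move=> LG tp ts; have LA := L1K_Aop1 LG.
have [tk _] := tkerP trho irho tp.
have H1 := L1K_mul_tens LA tp ts; have H2 := L1K_mul_tens LG tk ts.
rewrite (Rfubini21 H1) (Rfubini21 H2); apply: Rintegral_ae_eq.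
- exact: integrable_EFin_measurable (integrable_Rint_ysection H1).
- exact: integrable_EFin_measurable (integrable_Rint_ysection H2).
apply: aeS (ae_int_ysection LG.1) => y iy /=.
have phii := test1_integrable tp.
transitivity ((\int[leb]_x (phi x * Bop (fun s => G (s, y)) x)) * psi y).
  rewrite -RintegralZr//; last exact: (integrable_mulBop trho rho0 irho phii iy).
  apply: eq_Rintegral => x _; rewrite /Aop1 /tens/=.
  by rewrite -[in RHS](test1_J x tp); lra.
have gk : leb.-integrable setT (EFin \o (fun s => G (s, y) * tker phi s)).
  have [M HM] := test1_bounded tk.
  have := @integrable_bounded_mul _ _ _ leb _ _ _ (smooth1_measurable tk.1) HM iy.
  by congr (_.-integrable _ _); rewrite funeqE => s /=; rewrite mulrC.
rewrite (Bop_dual trho rho0 irho)// -RintegralZr//.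
by apply: eq_Rintegral => s _; rewrite /tens/= mulrA.
Qed.

(** Inside the square [Aop2 G] does not depend on x, which produces the integral of [phi]; in y it
    is the one-dimensional duality for the [rho]-mean of [G]. *)
Lemma Aop2_dual G phi psi : L1K G -> test1 phi -> test1 psi ->
  \int[leb2]_z (Aop2 G z * tens phi psi z) =
  (\int[leb]_x phi x) * \int[leb2]_z (G z * tens rho (tker psi) z).
Proof.
move=> LG tp ts; have [tk _] := tkerP trho irho ts; have [M HM] := test1_bounded tk.
have [N HN] := test1_bounded trho.
have gi := integrable_slice LG; have phii := test1_integrable tp; have psii := test1_integrable ts.
have -> : (fun z => Aop2 G z * tens phi psi z) =
    tens phi (fun y => psi y * Bop (fun t => \int[leb]_s (G (s, t) * rho s)) y).
  rewrite funeqE => z; rewrite /Aop2 /tens -[in RHS](test1_J z.1 tp) -[in RHS](test1_J z.2 ts); lra.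
rewrite Rintegral_tens//; last exact: (integrable_mulBop trho rho0 irho psii gi).
rewrite (Bop_dual trho rho0 irho)//; congr (_ * _).
have Gr := integrable_mul_fst LG.1 (smooth1_measurable trho.1) HN.
rewrite -(Rfubini21_mul Gr (smooth1_measurable tk.1) HM).
by apply: eq_Rintegral => z _; rewrite /tens mulrA.
Qed.

Definition weakx G H := forall phi psi, test1 phi -> test1 psi ->
  \int[leb2]_z (G z * tens (derive1 phi) psi z) = - \int[leb2]_z (H z * tens phi psi z).

Definition weaky G H := forall phi psi, test1 phi -> test1 psi ->
  \int[leb2]_z (G z * tens phi (derive1 psi) z) = - \int[leb2]_z (H z * tens phi psi z).

Definition oneK (z : R * R) : R := J z.1 * J z.2.

Lemma L1K_oneK : L1K oneK.
Proof.
split; first exact: (integrable_tens integrable_J integrable_J).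
move=> z nz; rewrite /oneK !indicE !mem_setE.
have [z1|] := boolP (z.1 \in `[0, 1]); last by rewrite !mul0r.
have [z2|] := boolP (z.2 \in `[0, 1]); last by rewrite mulr0.
by exfalso; apply: nz; split.
Qed.

Lemma L1KZ a G : L1K G -> L1K (fun z => a * G z).
Proof.
move=> [Gi G0]; split; first exact: (integrableZl measurableT a Gi).
by move=> z nz; rewrite G0// mulr0.
Qed.

Lemma poincare G Gx Gy : L1K G -> L1K Gx -> L1K Gy -> weakx G Gx -> weaky G Gy ->
  \forall z \ae leb2,
    G z = (\int[leb2]_w (G w * tens rho rho w)) * oneK z + Aop1 Gx z + Aop2 Gy z.
Proof.
move=> LG LGx LGy wx wy; set c := \int[leb2]_w _.
have L1 := L1KZ c L1K_oneK; have L2 := L1K_Aop1 LGx; have L3 := L1K_Aop2 LGy.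
have LD := L1KB LG (L1KD (L1KD L1 L2) L3).
have : \forall z \ae leb2,
    (G \- ((fun z => c * oneK z) \+ Aop1 Gx \+ Aop2 Gy)) z = 0.
  apply: fundamental2; [exact: LD.1|exact: LD.2|] => phi psi tp ts.
  have [tkp dkp] := tkerP trho irho tp; have [tks dks] := tkerP trho irho ts.
  have iG := L1K_mul_tens LG tp ts; have i1 := L1K_mul_tens L1 tp ts.
  have i2 := L1K_mul_tens L2 tp ts; have i3 := L1K_mul_tens L3 tp ts.
  transitivity (\int[leb2]_z (G z * tens phi psi z)
     - (\int[leb2]_z (c * oneK z * tens phi psi z)
        + \int[leb2]_z (Aop1 Gx z * tens phi psi z)
        + \int[leb2]_z (Aop2 Gy z * tens phi psi z))).
    have i12 := integrableD_EFin i1 i2.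
    rewrite -RintegralD// -RintegralD// -RintegralB//; last exact: integrableD_EFin.
    by apply: eq_Rintegral => z _ /=; lra.
  rewrite Aop1_dual// Aop2_dual//.
  have phii := test1_integrable tp; have psii := test1_integrable ts.
  have -> : \int[leb2]_z (c * oneK z * tens phi psi z) =
      c * ((\int[leb]_x phi x) * \int[leb]_x psi x).
    rewrite -Rintegral_tens// -RintegralZl//; last exact: integrable_tens.
    apply: eq_Rintegral => z _; rewrite /oneK /tens.
    by rewrite -[in RHS](test1_J z.1 tp) -[in RHS](test1_J z.2 ts); lra.
  set p := \int[leb]_x phi x; set q := \int[leb]_x psi x.
  have e1 : \int[leb2]_z (G z * tens phi psi z) =
     p * \int[leb2]_z (G z * tens rho psi z) + \int[leb2]_z (Gx z * tens (tker phi) psi z).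
    have i4 := L1K_mul_tens LG trho ts.
    rewrite -[X in _ + X]opprK -wx// dkp -RintegralZl// -RintegralB//.
    - by apply: eq_Rintegral => z _; rewrite /tens /= -/p; lra.
    - exact: (integrableZl measurableT p i4).
    - have tdk : test1 (derive1 (tker phi)) by exact: test1_derive.
      by have := L1K_mul_tens LG tdk ts; rewrite dkp.
  have e2 : \int[leb2]_z (G z * tens rho psi z) =
     q * c + \int[leb2]_z (Gy z * tens rho (tker psi) z).
    have i4 := L1K_mul_tens LG trho trho.
    rewrite -[X in _ + X]opprK -wy// dks -RintegralZl// -RintegralB//.
    - by apply: eq_Rintegral => z _; rewrite /tens /= -/q; lra.
    - exact: (integrableZl measurableT q i4).
    - have tdk : test1 (derive1 (tker psi)) by exact: test1_derive.
      by have := L1K_mul_tens LG trho tdk; rewrite dks.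
  by rewrite e1 e2; lra.
by apply: aeS => z /= /eqP; rewrite subr_eq0 => /eqP.
Qed.

End rho.
End Poincare.

Lemma ge0_le_poweR (R : realType) (r : R) (x y : \bar R) : 0 <= r -> (0 <= x)%E ->
  (x <= y)%E -> (x `^ r <= y `^ r)%E.
Proof.
move=> r0 x0 xy; apply: gt0_ler_poweR => //; rewrite in_itv/= leey andbT//.
exact: le_trans xy.
Qed.

(** * L^p norms of functions supported on a set of measure 1 *)

Section LpNorm.
Context d (T : measurableType d) (R : realType) (mu : {measure set T -> \bar R}).
Variable p : R.
Hypothesis p1 : 1 <= p.
Implicit Types f g : T -> R.

Let p_gt0 : 0 < p. Proof. exact: lt_le_trans p1. Qed.

Local Notation "'NN' f" := ('N[mu]_p%:E[EFin \o f])%E (at level 10, f at level 9).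

Lemma LnormEFin f : NN f = ((\int[mu]_x (`|f x| `^ p)%:E) `^ p^-1)%E.
Proof. by rewrite unlock. Qed.

Lemma measurable_powR_norm f : measurable_fun setT f ->
  measurable_fun setT (fun x => (`|f x| `^ p)%:E).
Proof.
move=> mf; apply/measurable_EFinP; apply: (measurableT_comp (measurable_powR _)).
exact: measurableT_comp.
Qed.

Lemma ler_Lnorm_int f (g : T -> R) : (\int[mu]_x (`|f x| `^ p)%:E <= \int[mu]_x (`|g x| `^ p)%:E)%E ->
  (NN f <= NN g)%E.
Proof.
move=> fg; rewrite !LnormEFin; apply: ge0_le_poweR; [by rewrite invr_ge0 ltW| |exact: fg].
by apply: integral_ge0 => x _; rewrite lee_fin powR_ge0.
Qed.

Lemma Lnorm_ae_eq f g : measurable_fun setT f -> measurable_fun setT g ->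
  (\forall x \ae mu, f x = g x) -> NN f = NN g.
Proof.
move=> mf mg fg; rewrite !LnormEFin.
suff -> : (\int[mu]_x (`|f x| `^ p)%:E = \int[mu]_x (`|g x| `^ p)%:E)%E by exact: erefl.
apply: ge0_ae_eq_integral => //; try exact: measurable_powR_norm.
by apply: filterS fg => x -> _.
Qed.

Lemma LnormD_le f g : measurable_fun setT f -> measurable_fun setT g ->
  (NN (f \+ g)%R <= NN f + NN g)%E.
Proof. by move=> mf mg; exact: minkowski_EFin. Qed.

Variable E : set T.
Hypotheses (mE : measurable E) (E1 : mu E = 1%E).

Lemma Lnorm_le_cst f c : measurable_fun setT f -> 0 <= c ->
  (forall x, `|f x| <= c) -> (forall x, ~ E x -> f x = 0) -> (NN f <= c%:E)%E.
Proof.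
move=> mf c0 fc f0; apply: (@le_trans _ _ ((c `^ p)%:E `^ p^-1)%E); last first.
  by rewrite poweR_EFin lee_fin -powRrM divff ?gt_eqF// powRr1.
rewrite LnormEFin; apply: ge0_le_poweR; first by rewrite invr_ge0 ltW.
  by apply: integral_ge0 => x _; rewrite lee_fin powR_ge0.
apply: (@le_trans _ _ (\int[mu]_x ((c `^ p) * \1_E x)%:E)%E).
  apply: ge0_le_integral => //; first exact: measurable_powR_norm.
    by apply/measurable_EFinP; apply: measurable_funM => //; exact: measurable_indic.
  move=> x _; rewrite lee_fin indicE; have [xE|xE] := boolP (x \in E).
    by rewrite mulr1 ge0_ler_powR// ?nnegrE// ltW.
  rewrite f0; last by move: xE; rewrite notin_setE.
  by rewrite normr0 powR0 ?gt_eqF// mulr0.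
under eq_integral do rewrite EFinM.
by rewrite ge0_integralZl ?lee_fin ?powR_ge0//= ?integral_indic ?setIT ?E1 ?mule1//; exact/measurable_EFinP.
Qed.

(** Hoelder's inequality against the indicator of [E], whose norm with the conjugate exponent is
    1. *)
Lemma Lnorm1_le f : measurable_fun setT f -> (forall x, ~ E x -> f x = 0) ->
  (\int[mu]_x `|f x|%:E <= NN f)%E.
Proof.
move=> mf f0; move: p1; rewrite le_eqVlt => /predU1P[<-|p_gt1].
  by rewrite Lnorm1.
pose q := p / (p - 1).
have q0 : 0 < q by rewrite divr_gt0// subr_gt0.
have pq : p^-1 + q^-1 = 1.
  by rewrite /q invf_div -{1}(mul1r p^-1) -mulrDl addrC subrK divff// gt_eqF.
have := @hoelder _ _ _ mu f (\1_E) p q mf _ p_gt0 q0 pq.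
have m1 : measurable_fun setT (\1_E : T -> R) by exact: measurable_indic.
move=> /(_ m1).
have -> : f \* \1_E = f.
  rewrite funeqE => x /=; rewrite indicE; have [xE|xE] := boolP (x \in E); first by rewrite mulr1.
  by rewrite f0 ?mul0r//; move: xE; rewrite notin_setE.
rewrite Lnorm1 => /le_trans; apply.
suff -> : ('N[mu]_q%:E[EFin \o \1_E] = 1)%E by rewrite mule1.
rewrite unlock (_ : (\int[mu]_x _)%E = 1%E) ?poweR1r//.
rewrite -E1 -[E in RHS]setIT -integral_indic//; apply: eq_integral => x _ /=.
by rewrite indicE; case: (_ \in _); rewrite /= ?normr1 ?powR1 ?normr0 ?powR0// gt_eqF.
Qed.

End LpNorm.

(** * L^p bounds for the two operators of the representation formula *)

Section AopBounds.
Context {R : realType}.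
Local Notation leb := (@lebesgue_measure R).
Local Notation leb2 := (leb \x leb)%E.
Local Notation J := (\1_(`[0, 1]%classic : set R) : R -> R).
Variable p : R.
Hypothesis p1 : 1 <= p.
Local Notation NN f := ('N[leb2]_p%:E[EFin \o f])%E.

Let p_gt0 : 0 < p. Proof. exact: lt_le_trans p1. Qed.

Lemma leb01 : leb `[0, 1]%classic = 1%E.
Proof. by rewrite lebesgue_measure_itv/= lte_fin ltr01 -EFinD subr0. Qed.

Lemma measurable_Khat : measurable (Khat R).
Proof. by apply: measurableX. Qed.

Lemma leb2_Khat : leb2 (Khat R) = 1%E.
Proof.
pose I01 : set R := `[0, 1]%classic.
transitivity (leb I01 * leb I01)%E; last by rewrite leb01 mule1.
by apply: product_measure1E; exact: measurable_itv.
Qed.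

Lemma leb_itv01_out (x : R) : ~ `[0, 1]%classic x -> J x = 0.
Proof. by move=> nx; rewrite indicE memNset. Qed.

Variable rho : R -> R.
Hypothesis trho : test1 rho.
Hypothesis rho0 : forall x, 0 <= rho x.
Hypothesis irho : \int[leb]_x rho x = 1.

(** As the kernel is at most 1, |Aop1 G (x, y)| is at most the L^1 norm of the slice G(., y), hence
    at most its L^p norm on an interval of length 1. The p-th power of this bound is [h y], and
    integrating it over x in [0, 1] keeps it unchanged. *)
Lemma Lnorm_Aop1 G : L1K G -> (NN (Aop1 rho G) <= NN G)%E.
Proof.
move=> LG; have [Gi G0] := LG; have mG := integrable_EFin_measurable Gi.
have mA := integrable_EFin_measurable (L1K_Aop1 trho rho0 irho LG).1.
apply: ler_Lnorm_int => //.
pose h y := (\int[leb]_s (`|G (s, y)| `^ p)%:E)%E.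
have mGp := measurable_powR_norm p mG.
have Gp0 (z : R * R) : (0 <= (`|G z| `^ p)%:E)%E by rewrite lee_fin powR_ge0.
have mh : measurable_fun setT h.
  exact: (@measurable_fun_fubini_tonelli_G _ _ _ _ _ leb (fun z => (`|G z| `^ p)%:E) mGp Gp0).
have h0 y : (0 <= h y)%E by apply: integral_ge0 => s _; rewrite lee_fin powR_ge0.
have pt z : ((`|Aop1 rho G z| `^ p)%:E <= (J z.1)%:E * h z.2)%E.
  rewrite /Aop1; have [z1|/leb_itv01_out ->] := pselect (`[0, 1]%classic z.1); last first.
    by rewrite mul0r normr0 powR0 ?gt_eqF// mul0e.
  rewrite indicE mem_set// mul1r mul1e.
  have mGs : measurable_fun setT (fun s => G (s, z.2)).
    by apply: (measurableT_comp mG); exact: measurable_pair2.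
  have le1 : (`|Bop rho (fun s => G (s, z.2)) z.1|%:E <= \int[leb]_s `|G (s, z.2)|%:E)%E.
    rewrite -abse_EFin; apply: le_trans (norm_fine_le _) _.
    apply: le_trans (le_abse_integral _ _ _) _ => //.
      apply/measurable_EFinP; apply: measurable_funM => //; exact: measurable_kerr.
    apply: ge0_le_integral => //.
    - apply/measurable_EFinP; apply: measurableT_comp => //.
      by apply: measurable_funM => //; exact: measurable_kerr.
    - by apply/measurable_EFinP; exact: measurableT_comp.
    - by move=> s _; rewrite /= lee_fin normrM ler_piMl// ker_bound.
  have le2 := Lnorm1_le (mu := leb) p1 (measurable_itv _) leb01 mGs.
  have {le1 le2} : (`|Bop rho (fun s => G (s, z.2)) z.1|%:E <= h z.2 `^ p^-1)%E.
    rewrite -LnormEFin; apply: le_trans le1 (le2 _) => s ns.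
    by rewrite G0// => -[].
  move=> /(ge0_le_poweR (ltW p_gt0)).
  by rewrite -poweRrM mulVf ?gt_eqF// poweRe1// poweR_EFin lee_fin; apply.
apply: (@le_trans _ _ (\int[leb2]_z ((J z.1)%:E * h z.2))%E).
  apply: ge0_le_integral => //; first exact: measurable_powR_norm.
  apply: emeasurable_funM.
    by apply/measurable_EFinP; exact: (measurableT_comp measurable_J measurable_fst).
  exact: (measurableT_comp mh measurable_snd).
have mJh : measurable_fun setT (fun z : R * R => (J z.1)%:E * h z.2)%E.
  apply: emeasurable_funM.
    by apply/measurable_EFinP; exact: (measurableT_comp measurable_J measurable_fst).
  exact: (measurableT_comp mh measurable_snd).
have Jh0 (z : R * R) : (0 <= (J z.1)%:E * h z.2)%E by rewrite mule_ge0// lee_fin indicE.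
rewrite (@fubini_tonelli2 _ _ _ _ _ leb leb _ mJh Jh0).
rewrite (@fubini_tonelli2 _ _ _ _ _ leb leb _ mGp Gp0).
apply: ge0_le_integral => //.
- by move=> y _; apply: integral_ge0 => x _; exact: Jh0.
- exact: (@measurable_fun_fubini_tonelli_G _ _ _ _ _ leb _ mJh Jh0).
move=> y _; rewrite /fubini_G/=.
have mJE : measurable_fun setT (fun x => (J x)%:E) by apply/measurable_EFinP; exact: measurable_J.
have J0 x : setT x -> (0 <= (J x)%:E)%E by rewrite lee_fin indicE.
rewrite (ge0_integralZr leb measurableT mJE J0 (h0 y)).
by rewrite integral_indic//= setIT leb01 mul1e.
Qed.

(** [Aop2 G] is bounded pointwise by M times the L^1 norm of [G], and the square has measure 1. *)
Lemma Lnorm_Aop2 M G : (forall x, `|rho x| <= M) -> L1K G ->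
  (NN (Aop2 rho G) <= M%:E * NN G)%E.
Proof.
move=> HM LG; have [Gi G0] := LG; have mG := integrable_EFin_measurable Gi.
have LA := L1K_Aop2 trho rho0 irho LG.
have mA := integrable_EFin_measurable LA.1.
have M0 : 0 <= M by exact: le_trans (HM 0).
have nGi := integrable_norm Gi.
have I0 : 0 <= \int[leb2]_z `|G z| by apply: Rintegral_ge0.
apply: (@le_trans _ _ (M * \int[leb2]_z `|G z|)%:E); last first.
  rewrite EFinM lee_wpmul2l ?lee_fin//.
  have := Lnorm1_le (mu := leb2) p1 measurable_Khat leb2_Khat mG G0.
  by rewrite /Rintegral fineK//; exact: (integrable_fin_num measurableT nGi).
apply: (Lnorm_le_cst (mu := leb2) p1 measurable_Khat leb2_Khat mA) => //.
- by rewrite mulr_ge0.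
- move=> z; rewrite /Aop2 !normrM.
  apply: le_trans (ler_piMl _ (J_bound _)) _; first by rewrite mulr_ge0.
  apply: le_trans (ler_piMl _ (J_bound _)) _ => //.
  have gi := integrable_slice trho LG.
  apply: le_trans (Bop_bound trho rho0 irho _ gi) _.
  rewrite (Rfubini21 nGi) -RintegralZl//; last exact: integrable_Rint_ysection nGi.
  have Gr := integrable_mul_fst Gi (smooth1_measurable trho.1) HM.
  have MG := integrableZl measurableT M (integrable_Rint_ysection nGi).
  rewrite /Rintegral fine_le//.
  + exact: (integrable_fin_num measurableT (integrable_norm gi)).
  + exact: (integrable_fin_num measurableT MG).
  apply: ae_ge0_le_integral => //.
  + exact: measurable_int (integrable_norm gi).
  + by move=> t _; rewrite lee_fin mulr_ge0// Rintegral_ge0.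
  + exact: measurable_int MG.
  apply: aeS2 (ae_int_ysection Gi) (ae_int_ysection Gr) => t it irt _.
  rewrite lee_fin; apply: le_trans (le_normr_Rintegral _ irt) _ => //.
  rewrite -RintegralZl//; last exact: (integrable_norm it).
  apply: le_Rintegral => //.
  + exact: (integrable_norm irt).
  + exact: (integrableZl measurableT M (integrable_norm it)).
  + by move=> s _ /=; rewrite normrM mulrC ler_wpM2r.
- exact: LA.2.
Qed.

End AopBounds.

(** * The two operators on polynomials, and their additivity *)

Section AopPoly.
Context {R : realType}.
Local Notation leb := (@lebesgue_measure R).
Local Notation leb2 := (leb \x leb)%E.
Local Notation J := (\1_(`[0, 1]%classic : set R) : R -> R).
Implicit Types (f g : R * R -> R) (i j : nat).

Definition Jpow i (x : R) : R := J x * x ^+ i.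

Lemma JJpow i x : J x * Jpow i x = Jpow i x.
Proof. by rewrite /Jpow indicE; case: (_ \in _); rewrite ?mul1r ?mul0r. Qed.

Lemma continuous_expr i : continuous (fun x : R => x ^+ i).
Proof. by move=> x; apply: exprn_continuous. Qed.

Lemma is_derive_pow_div i (x : R) :
  is_derive x (1 : R) (fun s : R => s ^+ i.+1 / i.+1%:R) (x ^+ i).
Proof.
have := is_derive_poly (i.+1%:R^-1 *: 'X^(i.+1)) x.
rewrite derivZ derivXn hornerZ hornerMn hornerXn -[_ ^+ _ *+ _]mulr_natl mulrA mulVf ?mul1r ?pnatr_eq0//.
by congr is_derive; rewrite funeqE => s; rewrite hornerZ hornerXn mulrC.
Qed.

Lemma integrable_Jcont (h : R -> R) : {within `[0, 1], continuous h} ->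
  leb.-integrable setT (EFin \o (fun x => J x * h x)).
Proof.
move=> ch; have := @integrable_mkcond _ _ _ leb `[0, 1]%classic (EFin \o h) (measurable_itv _).
rewrite restrict_EFin => -[+ _].
have -> : (fun x => J x * h x) = h \_ `[0, 1]%classic.
  by rewrite funeqE => x; rewrite patchE indicE; case: ifPn => _; rewrite ?mul1r ?mul0r.
by apply; apply: continuous_compact_integrable => //; exact: segment_compact.
Qed.

Lemma integrable_Jpow i : leb.-integrable setT (EFin \o Jpow i).
Proof.
by apply: integrable_Jcont; apply: continuous_subspaceT; exact: continuous_expr.
Qed.

Lemma restrK_JJ f : f \_ (Khat R) = (fun z => J z.1 * J z.2 * f z).
Proof.
rewrite funeqE => z; rewrite patchE !indicE !mem_setE.
case: ifPn => [|nz].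
  by rewrite inE => -[/= -> ->]; rewrite !mul1r.
have [z1|] := boolP (z.1 \in `[0, 1]); last by rewrite !mul0r.
have [z2|] := boolP (z.2 \in `[0, 1]); last by rewrite mulr0 mul0r.
by exfalso; move: nz; rewrite notin_setE; apply; split.
Qed.

Lemma restrK_cmono c i j :
  (fun z => c * mono i j z) \_ (Khat R) = (fun z => c * tens (Jpow i) (Jpow j) z).
Proof.
by rewrite restrK_JJ funeqE => z; rewrite /tens /mono /Jpow; lra.
Qed.

Lemma restrKD f g : (f \+ g) \_ (Khat R) = f \_ (Khat R) \+ g \_ (Khat R).
Proof. by rewrite !restrK_JJ funeqE => z /=; rewrite mulrDr. Qed.

Lemma restrKB f g : (f \- g) \_ (Khat R) = f \_ (Khat R) \- g \_ (Khat R).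
Proof. by rewrite !restrK_JJ funeqE => z /=; rewrite mulrBr. Qed.

Variable rho : R -> R.
Hypothesis trho : test1 rho.
Hypothesis rho0 : forall x, 0 <= rho x.
Hypothesis irho : \int[leb]_x rho x = 1.

(** The constant [kp] is the [rho]-mean of x^(i+1) / (i+1). *)
Lemma Bop_Jpow i : exists kp, forall x, `[0, 1]%classic x ->
  Bop rho (Jpow i) x = x ^+ i.+1 / i.+1%:R - kp.
Proof.
have Ji := integrable_Jpow i.
have hi x : leb.-integrable setT (EFin \o (fun s => heaviside (x, s) * Jpow i s)).
  have m : measurable_fun setT (fun s : R => heaviside (x, s)).
    by apply: (measurableT_comp measurable_heaviside); exact: measurable_pair1.
  exact: (@integrable_bounded_mul _ _ _ leb _ _ _ m (fun s => heaviside_bound (x, s)) Ji).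
have ki : leb.-integrable setT (EFin \o (fun s => kap rho s * Jpow i s)).
  apply: (@integrable_bounded_mul _ _ _ leb _ _ 1 (measurable_kap trho rho0) _ Ji) => s.
  by have /andP[k0 k1] := kap_itv trho rho0 irho s; rewrite ger0_norm.
exists (\int[leb]_s (kap rho s * Jpow i s)) => x /=; rewrite in_itv/= => /andP[x0 x1].
rewrite /Bop -[X in X - _](_ : \int[leb]_s (heaviside (x, s) * Jpow i s) = _).
  by rewrite -RintegralB//; apply: eq_Rintegral => s _; rewrite /ker mulrBl.
transitivity (\int[leb]_(s in `[0, x]) s ^+ i).
  rewrite [RHS]Rintegral_indic; apply: eq_Rintegral => s _.
  rewrite /heaviside /Jpow !indicE !mem_setE !in_itv/=.
  have [s0|s0] := leP 0 s; last by rewrite mul0r !mulr0.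
  have [sx|sx] := leP s x; last by rewrite mul0r mulr0.
  by rewrite (le_trans sx x1) !mul1r mulr1.
move: x0; rewrite le_eqVlt => /predU1P[<-|x0].
  by rewrite set_itv1 Rintegral_set1 expr0n/= mul0r.
have dF := is_derive_pow_div i.
rewrite /Rintegral (@continuous_FTC2 _ _ (fun s => s ^+ i.+1 / i.+1%:R))//.
- by rewrite expr0n/= mul0r subr0.
- by apply: continuous_subspaceT; exact: continuous_expr.
- split.
  + by move=> s _; case: (dF s).
  + by apply: cvg_at_right_filter; exact: (is_derive1_continuous dF).
  + by apply: cvg_at_left_filter; exact: (is_derive1_continuous dF).
- by move=> s _; rewrite derive1E; exact: derive_val.
Qed.

(** The degree rises by at most one: [Aop1] integrates x^i, whereas [Aop2] replaces x^i by its
    [rho]-mean m and integrates y^j. *)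
Lemma Aop_cmono c i j n : (i + j < n)%N -> let f := fun z => c * mono i j z in
  (exists2 q, bipoly n.+1 q & Aop1 rho (f \_ (Khat R)) = q \_ (Khat R)) /\
  (exists2 q, bipoly n.+1 q & Aop2 rho (f \_ (Khat R)) = q \_ (Khat R)).
Proof.
move=> ijn f; rewrite restrK_cmono.
have BopZ a k x : Bop rho (fun s => a * Jpow k s) x = a * Bop rho (Jpow k) x.
  rewrite /Bop -RintegralZl//; last by apply: (int_kerMr trho rho0 irho); exact: integrable_Jpow.
  by apply: eq_Rintegral => s _; rewrite mulrCA.
have iSj : (i.+1 + j < n.+1)%N by rewrite addSn ltnS.
have jn : (j < n)%N by exact: leq_ltn_trans (leq_addl _ _) ijn.
have jS : (0 + j.+1 < n.+1)%N by rewrite add0n ltnS.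
have j0 : (0 + j < n.+1)%N by rewrite add0n ltnS ltnW.
split.
  have [kp Hkp] := Bop_Jpow i.
  exists ((fun z => c / i.+1%:R * mono i.+1 j z) \+ (fun z => - (c * kp) * mono 0 j z)).
    by apply: bipolyD; exact: bipoly_cmono.
  rewrite restrK_JJ funeqE => z; rewrite /Aop1 /mono /=.
  have [z1|/leb_itv01_out ->] := pselect (`[0, 1]%classic z.1); last by rewrite !mul0r.
  have -> : (fun s => c * tens (Jpow i) (Jpow j) (s, z.2)) = (fun s => (c * Jpow j z.2) * Jpow i s).
    by rewrite funeqE => s; rewrite /tens /=; lra.
  rewrite BopZ Hkp// /Jpow expr0; move: (i.+1%:R^-1 : R) => v; lra.
have [kp Hkp] := Bop_Jpow j.
pose m := \int[leb]_s (Jpow i s * rho s).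
exists ((fun z => c * m / j.+1%:R * mono 0 j.+1 z) \+ (fun z => - (c * m * kp) * mono 0 0 z)).
  by apply: bipolyD; exact: bipoly_cmono.
rewrite restrK_JJ funeqE => z; rewrite /Aop2 /mono /=.
have [z2|/leb_itv01_out ->] := pselect (`[0, 1]%classic z.2); last by rewrite !(mul0r, mulr0).
have mi : leb.-integrable setT (EFin \o (fun s => Jpow i s * rho s)).
  have [M HM] := test1_bounded trho.
  have := @integrable_bounded_mul _ _ _ leb _ _ _ (smooth1_measurable trho.1) HM (integrable_Jpow i).
  by congr (_.-integrable _ _); rewrite funeqE => s /=; rewrite mulrC.
have -> : (fun t => \int[leb]_s (c * tens (Jpow i) (Jpow j) (s, t) * rho s)) =
   (fun t => c * m * Jpow j t).
  rewrite funeqE => t; transitivity ((c * Jpow j t) * m); last by rewrite mulrAC.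
  by rewrite /m -RintegralZl//; apply: eq_Rintegral => s _; rewrite /tens/=; lra.
rewrite BopZ Hkp// !expr0; move: (j.+1%:R^-1 : R) => v; lra.
Qed.

(** Testing against a product moves [A] onto the test functions, after which additivity in [G] is
    that of the integral. The fundamental lemma turns this into an identity almost everywhere. *)
Lemma dual_additive (A : (R * R -> R) -> R * R -> R) :
  (forall G, L1K G -> L1K (A G)) ->
  (forall phi psi, test1 phi -> test1 psi -> exists c phi' psi', [/\ test1 phi', test1 psi' &
    forall G, L1K G -> \int[leb2]_z (A G z * tens phi psi z) =
      c * \int[leb2]_z (G z * tens phi' psi' z)]) ->
  forall G H, L1K G -> L1K H -> \forall z \ae leb2, A (G \+ H) z = A G z + A H z.
Proof.
move=> LA dA G H LG LH; have LS := L1KD LG LH.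
have LD := L1KB (LA _ LS) (L1KD (LA _ LG) (LA _ LH)).
have : \forall z \ae leb2, (A (G \+ H) \- (A G \+ A H)) z = 0.
  apply: fundamental2; [exact: LD.1|exact: LD.2|] => phi psi tp ts.
  have [c [phi' [psi' [tp' ts' dAc]]]] := dA _ _ tp ts.
  have i1 := L1K_mul_tens (LA _ LG) tp ts; have i2 := L1K_mul_tens (LA _ LH) tp ts.
  have i3 := L1K_mul_tens (LA _ LS) tp ts.
  have g1 := L1K_mul_tens LG tp' ts'; have g2 := L1K_mul_tens LH tp' ts'.
  transitivity (\int[leb2]_z (A (G \+ H) z * tens phi psi z) -
    (\int[leb2]_z (A G z * tens phi psi z) + \int[leb2]_z (A H z * tens phi psi z))).
    rewrite -RintegralD// -RintegralB//; last exact: integrableD_EFin.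
    by apply: eq_Rintegral => z _ /=; lra.
  rewrite !dAc// -mulrDr -RintegralD//.
  rewrite (_ : \int[leb2]_z ((G \+ H) z * _) = \int[leb2]_z (G z * tens phi' psi' z + H z * tens phi' psi' z)).
    by rewrite subrr.
  by apply: eq_Rintegral => z _ /=; rewrite mulrDl.
by apply: aeS => z /= /eqP; rewrite subr_eq0 => /eqP.
Qed.

Lemma Aop1D G H : L1K G -> L1K H ->
  \forall z \ae leb2, Aop1 rho (G \+ H) z = Aop1 rho G z + Aop1 rho H z.
Proof.
apply: dual_additive => [F LF|phi psi tp ts]; first exact: L1K_Aop1.
exists 1, (tker rho phi), psi; split=> //; first by have [] := tkerP trho irho tp.
by move=> F LF; rewrite Aop1_dual// mul1r.
Qed.

Lemma Aop2D G H : L1K G -> L1K H ->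
  \forall z \ae leb2, Aop2 rho (G \+ H) z = Aop2 rho G z + Aop2 rho H z.
Proof.
apply: dual_additive => [F LF|phi psi tp ts]; first exact: L1K_Aop2.
exists (\int[leb]_x phi x), rho, (tker rho psi); split=> //; first by have [] := tkerP trho irho ts.
by move=> F LF; rewrite Aop2_dual.
Qed.

Lemma L1K_bipoly n f : bipoly n f -> L1K (f \_ (Khat R)).
Proof.
move: f; apply: bipoly_ind.
- split=> [|z nz]; last by rewrite patchE memNset.
  rewrite restrK_JJ (_ : (fun z => _) = cst 0); first exact: integrable0.
  by rewrite funeqE => z /=; rewrite mulr0.
- by move=> f g Lf Lg; rewrite restrKD; exact: L1KD.
- move=> c i j _; rewrite restrK_cmono; apply: L1KZ.
  have := L1K_tens (integrable_Jpow i) (integrable_Jpow j).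
  by congr L1K; rewrite funeqE => z; rewrite /tens !JJpow.
Qed.

Lemma Aop_bipoly n f : bipoly n f ->
  (exists2 q, bipoly n.+1 q & \forall z \ae leb2, Aop1 rho (f \_ (Khat R)) z = (q \_ (Khat R)) z) /\
  (exists2 q, bipoly n.+1 q & \forall z \ae leb2, Aop2 rho (f \_ (Khat R)) z = (q \_ (Khat R)) z).
Proof.
(* The claim carries [bipoly n f] along, because additivity requires both summands to be integrable
   on the square. *)
move=> bf; suff [_ []] : bipoly n f /\
  (exists2 q, bipoly n.+1 q & \forall z \ae leb2, Aop1 rho (f \_ (Khat R)) z = (q \_ (Khat R)) z) /\
  (exists2 q, bipoly n.+1 q & \forall z \ae leb2, Aop2 rho (f \_ (Khat R)) z = (q \_ (Khat R)) z) by [].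
move: f bf; apply: bipoly_ind.
- split; first exact: bipoly0.
  have Z G : G = (fun=> 0) -> Bop rho G = cst 0.
    move=> ->; rewrite funeqE => x; rewrite /Bop (@eq_Rintegral _ _ _ _ _ (cst 0)) ?Rintegral_cst ?mul0r//.
    by move=> s _; rewrite mulr0.
  have zK : (cst 0 : R * R -> R) \_ (Khat R) = cst 0.
    by rewrite restrK_JJ funeqE => z; rewrite mulr0.
  rewrite zK; split; exists (cst 0); try exact: bipoly0; apply: aeW => z; rewrite zK.
    by rewrite /Aop1 Z// mulr0.
  rewrite /Aop2 Z ?mulr0// funeqE => t.
  by rewrite (@eq_Rintegral _ _ _ _ _ (cst 0)) ?Rintegral_cst ?mul0r// => s _; rewrite mul0r.
- move=> f g [bf [[qf bqf Ef] [qf' bqf' Ef']]] [bg [[qg bqg Eg] [qg' bqg' Eg']]].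
  split; first exact: bipolyD.
  have Lf := L1K_bipoly bf; have Lg := L1K_bipoly bg.
  split; [exists (qf \+ qg)|exists (qf' \+ qg')]; try exact: bipolyD.
    apply: aeS2 (Aop1D Lf Lg) (aeS2 (fun z => @pair _ _) Ef Eg) => z.
    by rewrite !restrKD /= => -> [-> ->].
  apply: aeS2 (Aop2D Lf Lg) (aeS2 (fun z => @pair _ _) Ef' Eg') => z.
  by rewrite !restrKD /= => -> [-> ->].
- move=> c i j ijn; split; first exact: bipoly_cmono.
  have [[q bq e] [q' bq' e']] := Aop_cmono c ijn.
  by split; [exists q|exists q'] => //; apply: aeW => z; rewrite ?e ?e'.
Qed.

End AopPoly.

(** * The Bramble-Hilbert lemma *)

Section BrambleHilbert.
Context {R : realType}.
Local Notation leb := (@lebesgue_measure R).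
Local Notation leb2 := (leb \x leb)%E.
Variable p : R.
Hypothesis p1 : 1 <= p.
Local Notation NN f := ('N[leb2]_p%:E[EFin \o f%R])%E.

(** The statement concerns a whole family [G a b] of successive derivatives, so that shifting [a] or
    [b] gives a family for the induction hypothesis. This approximates the two first derivatives by
    [q1] and [q2] of degree below l. Then c + Aop1 q1 + Aop2 q2 is a polynomial of degree below l +
    1, and by the representation formula its error consists of [Aop1] and [Aop2] applied to the two
    smaller errors. *)
Lemma bramble_hilbert l : exists2 C : R, 0 <= C &
  forall G : nat -> nat -> R * R -> R,
    (forall a b, (a + b <= l)%N -> L1K (G a b)) ->
    (forall a b, (a + b < l)%N -> weakx (G a b) (G a.+1 b) /\ weaky (G a b) (G a b.+1)) ->
    exists2 q, bipoly l q &
      (NN (G 0%N 0%N \- q \_ (Khat R)) <= C%:E * \sum_(a < l.+1) NN (G a (l - a)%N))%E.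
Proof.
have [trho rho0 irho _] : [/\ test1 (mollifier (1/4 : R) (3/4)), forall x, 0 <= mollifier (1/4 : R) (3/4) x,
   \int[leb]_x mollifier (1/4 : R) (3/4) x = 1 & forall x : R, ~~ (1/4 < x < 3/4) -> mollifier (1/4) (3/4) x = 0].
  by apply: mollifierP; lra.
set rho := mollifier _ _ in trho rho0 irho.
have [M HM] := test1_bounded trho; have M0 : 0 <= M by exact: le_trans (HM 0).
elim: l => [|l [C C0 IH]].
  exists 1 => // G _ _; exists (cst 0); first exact: bipoly0.
  rewrite mul1e big_ord1 subn0 (_ : _ \- _ = G 0%N 0%N)//.
  by rewrite funeqE => z; rewrite /= restrK_JJ mulr0 subr0.
(* [Aop1] has norm at most 1 and [Aop2] at most M, the bound of [rho]; both act on an error with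
   constant C. *)
exists (C + M * C) => [|G LG wG]; first by rewrite addr_ge0// mulr_ge0.
have [||q1 bq1 H1] := IH (fun a b => G a.+1 b).
- by move=> a b ab; apply: LG; rewrite addSn ltnS.
- by move=> a b ab; apply: wG; rewrite addSn ltnS.
have [||q2 bq2 H2] := IH (fun a b => G a b.+1).
- by move=> a b ab; apply: LG; rewrite addnS ltnS.
- by move=> a b ab; apply: wG; rewrite addnS ltnS.
have [wx wy] := wG 0%N 0%N isT.
have L0 := LG 0%N 0%N isT; have Lx := LG 1%N 0%N isT; have Ly := LG 0%N 1%N isT.
have := poincare trho rho0 irho L0 Lx Ly wx wy.
set c := \int[leb2]_w _ => E0.
have [[Q1 bQ1 E1] _] := Aop_bipoly trho rho0 irho bq1.
have [_ [Q2 bQ2 E2]] := Aop_bipoly trho rho0 irho bq2.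
pose q := (fun z => c * mono 0 0 z) \+ Q1 \+ Q2.
have bq : bipoly l.+1 q.
  by apply: bipolyD => //; apply: bipolyD => //; exact: bipoly_cmono.
exists q => //.
have Lq1 := L1K_bipoly bq1; have Lq2 := L1K_bipoly bq2.
have Ld1 := L1KB Lx Lq1; have Ld2 := L1KB Ly Lq2.
have A1 := Aop1D trho rho0 irho Ld1 Lq1; have A2 := Aop2D trho rho0 irho Ld2 Lq2.
have subK (F H : R * R -> R) : (F \- H) \+ H = F by rewrite funeqE => z /=; rewrite subrK.
rewrite !subK in A1 A2.
have LA1 := L1K_Aop1 trho rho0 irho Ld1; have LA2 := L1K_Aop2 trho rho0 irho Ld2.
have mea F : L1K F -> measurable_fun setT F by move=> [/integrable_EFin_measurable].
have -> : NN (G 0%N 0%N \- q \_ (Khat R)) =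
    NN (Aop1 rho (G 1%N 0%N \- q1 \_ (Khat R)) \+ Aop2 rho (G 0%N 1%N \- q2 \_ (Khat R))).
  apply: Lnorm_ae_eq.
  - by apply: mea; apply: L1KB => //; exact: L1K_bipoly bq.
  - by apply: mea; exact: L1KD.
  apply: aeS2 (aeS2 (fun z => @pair _ _) A1 A2) (aeS2 (fun z => @pair _ _) E0 (aeS2 (fun z => @pair _ _) E1 E2)).
  move=> z [a1 a2] [e0 [e1 e2]] /=.
  rewrite e0 a1 a2 e1 e2 /q !restrKD /= (_ : (fun z => c * mono 0 0 z) \_ (Khat R) = (fun z => c * oneK z)).
    move: (Aop1 _ _ _) (Aop2 _ _ _) (c * _) ((Q1 \_ _) z) ((Q2 \_ _) z); clear=> *; lra.
  by rewrite restrK_JJ funeqE => w; rewrite /mono /oneK !expr0 !mulr1 mulrC.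
apply: le_trans; first by apply: LnormD_le => //; exact: mea.
set S := (\sum_(a < l.+2) _)%E.
have S0 : (0 <= S)%E by apply: sume_ge0 => a _; exact: Lnorm_ge0.
have N0 F : (0 <= NN F)%E by exact: Lnorm_ge0.
(* The derivatives of order l of the x-derivative are the terms of S of positive order in x; [S2] is
   the counterpart in y. *)
have S1 : (\sum_(a < l.+1) NN (G a.+1 (l - a)%N) <= S)%E.
  have -> : S = (NN (G 0%N l.+1) + \sum_(a < l.+1) NN (G a.+1 (l - a)%N))%E.
    by rewrite /S big_ord_recl; congr (_ + _)%E; apply: eq_bigr => a _; rewrite lift0 subSS.
  by rewrite leeDr// Lnorm_ge0.
have S2 : (\sum_(a < l.+1) NN (G a (l - a).+1) <= S)%E.
  have -> : S = (\sum_(a < l.+1) NN (G a (l - a).+1) + NN (G l.+1 0%N))%E.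
    rewrite /S big_ord_recr/= subnn; congr (_ + _)%E; apply: eq_bigr => a _.
    by rewrite subSn// -ltnS.
  by rewrite leeDl// Lnorm_ge0.
rewrite EFinD ge0_muleDl ?lee_fin ?mulr_ge0//; apply: leeD.
  apply: le_trans (Lnorm_Aop1 p1 trho rho0 irho Ld1) _.
  by apply: le_trans H1 _; rewrite lee_wpmul2l// lee_fin.
apply: le_trans (Lnorm_Aop2 p1 trho rho0 irho HM Ld2) _.
rewrite EFinM -muleA lee_wpmul2l ?lee_fin//.
by apply: le_trans H2 _; rewrite lee_wpmul2l// lee_fin.
Qed.

End BrambleHilbert.

(** * Linear systems with a definite Gram matrix *)

Section GramMatrix.
Context {R : realType} (I : finType) (S : pred I) (G : I -> I -> R).
Hypothesis posdef : forall x : I -> R,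
  \sum_(i | S i) \sum_(j | S j) x i * x j * G i j = 0 -> forall i, S i -> x i = 0.

Let n := #|S|.
Let A : 'M[R]_n := \matrix_(i, j) G (enum_val i) (enum_val j).

Let sumS (F : I -> R) : \sum_(i | S i) F i = \sum_(k < n) F (enum_val k).
Proof. by rewrite -big_enum_val. Qed.

(** Extension by zero outside [S], which brings a row vector into the form of [posdef]. *)
Let ext (v : 'rV[R]_n) (i : I) : R := \sum_k v 0 k * (enum_val k == i)%:R.

Let extE v k : ext v (enum_val k) = v 0 k.
Proof.
rewrite /ext (bigD1 k)//= eqxx mulr1 big1 ?addr0// => k' k'k.
by rewrite (inj_eq enum_val_inj) (negbTE k'k) mulr0.
Qed.

(** A vector in the kernel of [A] annihilates the quadratic form, so it is zero. *)
Lemma gram_unit : A \in unitmx.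
Proof.
rewrite -row_free_unit; apply: inj_row_free => v vA.
have q0 : \sum_(i | S i) \sum_(j | S j) ext v i * ext v j * G i j = 0.
  rewrite sumS exchange_big sumS big1// => j _.
  have /rowP/(_ j) := vA; rewrite !mxE => vAj.
  transitivity (v 0 j * \sum_k v 0 k * A k j); last by rewrite vAj mulr0.
  by rewrite mulr_sumr; apply: eq_bigr => k _; rewrite !extE mxE; lra.
apply/rowP => k; rewrite -extE mxE; apply: (posdef q0).
exact: (enum_valP k).
Qed.

Lemma gram_solve (c : I -> R) : exists x : I -> R,
  forall k, S k -> \sum_(i | S i) x i * G i k = c k.
Proof.
pose cv : 'rV[R]_n := \row_k c (enum_val k).
exists (ext (cv *m invmx A)) => k Sk; rewrite sumS.
have [k' ->] : exists k' : 'I_n, k = enum_val k'.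
  by exists (enum_rank_in (Sk : k \in S) k); rewrite enum_rankK_in.
have := mulmxKV gram_unit cv => /rowP/(_ k'); rewrite mxE [in RHS]mxE => <-.
by apply: eq_bigr => i _; rewrite extE [A _ _]mxE.
Qed.

(** The solution is recovered through the inverse matrix; [C] is the sum of the absolute values of
    its entries. *)
Lemma gram_bound : exists2 C : R, 0 <= C & forall (x : I -> R) M, 0 <= M ->
  (forall k, S k -> `|\sum_(i | S i) x i * G i k| <= M) ->
  forall i, S i -> `|x i| <= C * M.
Proof.
pose C := \sum_k \sum_j `|invmx A k j|.
exists C; first by do 2 apply: sumr_ge0 => ? _.
move=> x M M0 xM i Si.
have [i' ->] : exists i' : 'I_n, i = enum_val i'.
  by exists (enum_rank_in (Si : i \in S) i); rewrite enum_rankK_in.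
pose xv : 'rV[R]_n := \row_k x (enum_val k).
have := mulmxK gram_unit xv => /rowP/(_ i'); rewrite mxE [in RHS]mxE => <-.
apply: le_trans (ler_norm_sum _ _ _) _; rewrite /C mulr_suml; apply: ler_sum => k _.
rewrite normrM mulrC.
have h : `|(xv *m A) 0 k| <= M.
  apply: le_trans (xM _ (enum_valP k)); rewrite sumS !mxE.
  by rewrite le_eqVlt; apply/orP; left; apply/eqP; congr `|_|; apply: eq_bigr => j _; rewrite !mxE.
apply: ler_pM => //; rewrite (bigD1 i')//= lerDl; exact: sumr_ge0.
Qed.

End GramMatrix.

(** * Polynomials determined by their moments *)

Section AePoly.
Context {R : realType}.
Local Notation leb := (@lebesgue_measure R).
Local Notation leb2 := (leb \x leb)%E.
Local Notation J := (\1_(`[0, 1]%classic : set R) : R -> R).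

Lemma ae_itv_ex (P : R -> Prop) (a b : R) : (\forall x \ae leb, P x) -> a < b ->
  exists x, a < x < b /\ P x.
Proof.
move=> [N [mN N0 sub]] ab; apply: contrapT => nex.
have : (leb `]a, b[%classic <= leb N)%E.
  apply: le_measure; rewrite ?inE//.
  move=> x /=; rewrite in_itv/= => xab; apply: sub => /= Px; apply: nex.
  by exists x.
by rewrite lebesgue_measure_itv/= lte_fin ab N0 -EFinD lee_fin subr_le0 leNgt ab.
Qed.

(** The unit interval is cut into [size q] pieces. Each contains a root, since no interval is a null
    set, and these are more roots than the degree allows. *)
Lemma ae_poly0 (q : {poly R}) : (\forall x \ae leb, 0 < x < 1 -> q.[x] = 0) -> q = 0.
Proof.
move=> q0; apply/eqP/negPn/negP => qn0.
pose N : R := (size q)%:R.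
have N0 : 0 < N by rewrite ltr0n size_poly_gt0.
have ex i : exists x, (i < size q)%N -> [/\ i%:R / N < x, x < i.+1%:R / N & root q x].
  have [|x [/andP[x1 x2] qx]] := ae_itv_ex (a := i%:R / N) (b := i.+1%:R / N) q0.
    by rewrite ltr_pM2r ?invr_gt0// ltr_nat.
  exists x => iq; split => //; apply/eqP/qx; apply/andP; split.
    by apply: le_lt_trans x1; rewrite divr_ge0 ?ler0n// ltW.
  by apply: lt_le_trans x2 _; rewrite ler_pdivrMr// mul1r ler_nat.
have [f Hf] := choice ex.
have mono i j : (i < j)%N -> (j < size q)%N -> f i < f j.
  move=> ij jq; have [_ f1 _] := Hf _ (ltn_trans ij jq); have [f2 _ _] := Hf _ jq.
  apply: lt_trans f1 (le_lt_trans _ f2).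
  by rewrite ler_pM2r ?invr_gt0// ler_nat.
have := @max_poly_roots _ q [seq f i | i <- iota 0 (size q)] qn0.
rewrite size_map size_iota ltnn => H; suff : false by [].
apply: H.
  apply/allP => x /mapP[i]; rewrite mem_iota add0n => /= iq ->.
  by have [] := Hf _ iq.
rewrite map_inj_in_uniq ?iota_uniq// => i j; rewrite !mem_iota !add0n /= => iq jq fij.
have [ij|ji|//] := ltngtP i j; [have := mono _ _ ij jq|have := mono _ _ ji iq]; by rewrite fij ltxx.
Qed.

Lemma Rintegral0_ae d (T : measurableType d) (mu : {measure set T -> \bar R}) (f : T -> R) :
  mu.-integrable setT (EFin \o f) -> (forall x, 0 <= f x) ->
  \int[mu]_x f x = 0 -> \forall x \ae mu, f x = 0.
Proof.
move=> fi f0 int0.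
have : ae_eq mu setT (EFin \o f) (cst 0%E).
  apply/(ae_eq_integral_abs mu measurableT); first exact: measurable_int fi.
  transitivity (\int[mu]_x (f x)%:E)%E.
    by apply: eq_integral => x _; rewrite gee0_abs// lee_fin.
  by rewrite -(fineK (integrable_fin_num measurableT fi)); congr EFin.
by apply: aeS => x /(_ I) [].
Qed.

Lemma Rintegral_sum d (T : measurableType d) (mu : {measure set T -> \bar R})
    (I : Type) (s : seq I) (P : pred I) (F : I -> T -> R) :
  (forall i, mu.-integrable setT (EFin \o F i)) ->
  mu.-integrable setT (EFin \o (fun x => \sum_(i <- s | P i) F i x)) /\
  \int[mu]_x (\sum_(i <- s | P i) F i x) = \sum_(i <- s | P i) \int[mu]_x F i x.
Proof.
move=> Fi; elim: s => [|i s [IHi IH]].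
  under eq_fun do rewrite big_nil.
  split; first exact: integrable0.
  by rewrite big_nil Rintegral_cst// mul0r.
under eq_fun do rewrite big_cons.
rewrite big_cons; case: (P i); last by split.
by split; [exact: integrableD_EFin|rewrite RintegralD// IH].
Qed.

(** The quadratic form of the moment matrix is the integral of Q^2 over [0, 1]; if it is zero, Q
    vanishes almost everywhere there, hence identically. *)
Lemma gram1 n (c : nat -> R) : exists2 A : {poly R}, (size A <= n)%N &
  forall i, (i < n)%N -> \int[leb]_t (Jpow i t * A.[t]) = c i.
Proof.
pose G (i j : 'I_n) := \int[leb]_t Jpow (i + j) t.
have intE (x : 'I_n -> R) i :
    leb.-integrable setT (EFin \o (fun t => Jpow i t * \sum_(j < n) x j * t ^+ j)) /\
    \int[leb]_t (Jpow i t * \sum_(j < n) x j * t ^+ j) = \sum_(j < n) x j * \int[leb]_t Jpow (j + i) t.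
  have -> : (fun t => Jpow i t * \sum_(j < n) x j * t ^+ j) = (fun t => \sum_(j < n) x j * Jpow (j + i) t).
    rewrite funeqE => t; rewrite mulr_sumr; apply: eq_bigr => j _.
    by rewrite /Jpow exprD; lra.
  have [|ii ->] := @Rintegral_sum _ _ leb _ (index_enum 'I_n) xpredT (fun j t => x j * Jpow (j + i) t).
    by move=> j; exact: (integrableZl measurableT (x j) (integrable_Jpow (j + i))).
  by split => //; apply: eq_bigr => j _; rewrite RintegralZl//; exact: integrable_Jpow.
have posdef (x : 'I_n -> R) : \sum_(i | xpredT i) \sum_(j | xpredT j) x i * x j * G i j = 0 ->
    forall i, xpredT i -> x i = 0.
  move=> q0 i _.
  pose Q : {poly R} := \poly_(i < n) (if insub i is Some k then x k else 0).
  have QE t : Q.[t] = \sum_(i < n) x i * t ^+ i.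
    rewrite (@horner_coef_wide _ n) ?size_poly//; apply: eq_bigr => k _.
    by rewrite coef_poly ltn_ord valK.
  have Q0 : Q = 0.
    have sqE t : J t * Q.[t] ^+ 2 = \sum_(i < n) x i * (Jpow i t * \sum_(j < n) x j * t ^+ j).
      rewrite expr2 {1}QE mulr_suml mulr_sumr; apply: eq_bigr => k _.
      by rewrite -QE /Jpow; lra.
    have sqf : (fun t => J t * Q.[t] ^+ 2) =
        (fun t => \sum_(i < n) x i * (Jpow i t * \sum_(j < n) x j * t ^+ j)).
      by rewrite funeqE.
    have [|ii ie] := @Rintegral_sum _ _ leb _ (index_enum 'I_n) xpredT
        (fun i t => x i * (Jpow i t * \sum_(j < n) x j * t ^+ j)).
      by move=> k; exact: (integrableZl measurableT (x k) (intE x k).1).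
    have ae0 : \forall t \ae leb, J t * Q.[t] ^+ 2 = 0.
      apply: Rintegral0_ae.
      - by rewrite sqf.
      - by move=> t; rewrite mulr_ge0 ?sqr_ge0// indicE.
      - rewrite sqf ie -[RHS]q0; apply: eq_bigr => k _.
        rewrite RintegralZl//; last exact: (intE x k).1.
        rewrite (intE x k).2 mulr_sumr; apply: eq_bigr => j _.
        by rewrite /G addnC mulrA.
    apply: ae_poly0; apply: aeS ae0 => t + /andP[t0 t1].
    rewrite indicE mem_set ?mul1r/=; last by rewrite in_itv/= !ltW.
    by move=> /eqP; rewrite sqrf_eq0 => /eqP.
  by have := congr1 (fun q : {poly R} => q`_i) Q0; rewrite coef_poly ltn_ord valK coef0.
have [x Hx] := gram_solve posdef (fun i => c i).
exists (\poly_(i < n) (if insub i is Some k then x k else 0)); first exact: size_poly.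
move=> i ni; rewrite -(Hx (Ordinal ni))//.
rewrite -[RHS]/(\sum_(j < n) x j * \int[leb]_t Jpow (j + i) t) -(intE x i).2.
apply: eq_Rintegral => t _; congr (_ * _).
rewrite (@horner_coef_wide _ n) ?size_poly//; apply: eq_bigr => k _.
by rewrite coef_poly ltn_ord valK.
Qed.

(** * Moments on the square with a weight that is positive in the interior *)

Section Weight.
Variable W : R * R -> R.
Variable MW : R.
Hypotheses (mW : measurable_fun setT W) (WM : forall z, `|W z| <= MW).
Hypotheses (W0 : forall z, 0 <= W z) (Wgt0 : forall z : R * R, 0 < z.1 < 1 -> 0 < z.2 < 1 -> 0 < W z).
Hypothesis Wout : forall z, ~ Khat R z -> W z = 0.

Lemma integrable_Wbipoly n f : bipoly n f -> leb2.-integrable setT (EFin \o (fun z => W z * f z)).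
Proof.
move=> bf; have := @integrable_bounded_mul _ _ _ leb2 _ _ _ mW WM (L1K_bipoly bf).1.
congr (_.-integrable _ _); rewrite funeqE => z /=; congr EFin.
rewrite restrK_JJ; have [zK|/Wout->] := pselect (Khat R z); last by rewrite !mul0r.
by case: zK => /= z1 z2; rewrite !indicE !mem_set// !mul1r.
Qed.

Lemma integrable_Wmono i j : leb2.-integrable setT (EFin \o (fun z => W z * mono i j z)).
Proof. exact: integrable_Wbipoly (bipoly_mono (ltnSn (i + j))). Qed.

Variable n : nat.
Let I := ('I_n * 'I_n)%type.
Let S (a : I) := (a.1 + a.2 < n)%N.
Let G (a b : I) := \int[leb2]_z (W z * mono (a.1 + b.1) (a.2 + b.2) z).
Let pol (x : I -> R) z := \sum_(a | S a) x a * mono a.1 a.2 z.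

Let monoM i j k l (z : R * R) : mono i j z * mono k l z = mono (i + k) (j + l) z.
Proof. by rewrite /mono !exprD; lra. Qed.

Let polG x i j : leb2.-integrable setT (EFin \o (fun z => W z * (pol x z * mono i j z))) /\
  \int[leb2]_z (W z * (pol x z * mono i j z)) =
  \sum_(a | S a) x a * \int[leb2]_z (W z * mono (a.1 + i) (a.2 + j) z).
Proof.
have -> : (fun z => W z * (pol x z * mono i j z)) =
    (fun z => \sum_(a | S a) x a * (W z * mono (a.1 + i) (a.2 + j) z)).
  rewrite funeqE => z; rewrite /pol mulr_suml mulr_sumr; apply: eq_bigr => a _.
  by rewrite -monoM; lra.
have [|ii ->] := @Rintegral_sum _ _ leb2 _ (index_enum I) S
    (fun a z => x a * (W z * mono (a.1 + i) (a.2 + j) z)).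
  by move=> a; exact: (integrableZl measurableT (x a) (integrable_Wmono _ _)).
by split => //; apply: eq_bigr => a _; rewrite RintegralZl//; exact: integrable_Wmono.
Qed.

(** Two one-variable steps: for almost every s the polynomial vanishes in t, so its coefficients
    [cf j], which are polynomials in s, vanish at almost every s and therefore identically. *)
Let pol_ae0 x : (\forall z \ae leb2, W z * pol x z ^+ 2 = 0) ->
  leb2.-integrable setT (EFin \o (fun z => W z * pol x z ^+ 2)) ->
  forall a, S a -> x a = 0.
Proof.
move=> ae0 ii a Sa.
have aex : \forall s \ae leb, \forall t \ae leb, W (s, t) * pol x (s, t) ^+ 2 = 0.
  have i0 : \int[leb2]_z (W z * pol x z ^+ 2) = 0.
    rewrite (Rintegral_ae_eq (g := cst 0) _ _ ae0) ?Rintegral_cst ?mul0r//.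
    exact: integrable_EFin_measurable ii.
  have := Rintegral0_ae (integrable_Rint_xsection ii).
  move=> /(_ _ _)H; have {}H : \forall s \ae leb, \int[leb]_t (W (s, t) * pol x (s, t) ^+ 2) = 0.
    apply: H => [s|]; last by rewrite -[RHS]i0 (Rfubini12 ii).
    by apply: Rintegral_ge0 => t _; rewrite mulr_ge0 ?sqr_ge0.
  apply: aeS2 H (ae_int_xsection ii) => s s0 si.
  by apply: Rintegral0_ae si _ s0 => t; rewrite mulr_ge0 ?sqr_ge0.
pose cf (j : nat) : {poly R} := \poly_(i < n)
  (if (insub i, insub j) is (Some i', Some j') then if S (i', j') then x (i', j') else 0 else 0).
have cfE (j : 'I_n) s : (cf j).[s] = \sum_(i < n) (if S (i, j) then x (i, j) else 0) * s ^+ i.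
  rewrite (@horner_coef_wide _ n) ?size_poly//; apply: eq_bigr => k _.
  by rewrite coef_poly ltn_ord !valK.
have cf0 (j : 'I_n) : cf j = 0.
  apply: ae_poly0; apply: aeS aex => s st /andP[s0 s1].
  have : \poly_(j < n) (cf j).[s] = 0.
    apply: ae_poly0; apply: aeS st => t + /andP[t0 t1] => /eqP.
    rewrite mulf_eq0 gt_eqF/=; last by apply: Wgt0; rewrite /= ?s0 ?t0.
    rewrite sqrf_eq0 => /eqP p0.
    rewrite (@horner_coef_wide _ n) ?size_poly// -[RHS]p0 /pol.
    rewrite [RHS]big_mkcond/= (eq_bigr (fun a : I => (if S (a.1, a.2) then x (a.1, a.2) else 0) * (s ^+ a.1 * t ^+ a.2))); last first.
      by move=> [i k] _ /=; case: ifP => _; rewrite ?mul0r.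
    rewrite -(pair_bigA _ (fun i j => (if S (i, j) then x (i, j) else 0) * (s ^+ i * t ^+ j))) exchange_big/=.
    apply: eq_bigr => k _; rewrite coef_poly ltn_ord cfE mulr_suml.
    by apply: eq_bigr => i _; rewrite mulrA.
  by move=> /(congr1 (fun q : {poly R} => q`_j)); rewrite coef_poly ltn_ord coef0.
have := congr1 (fun q : {poly R} => q`_(a.1)) (cf0 a.2).
by rewrite coef_poly ltn_ord !valK coef0 -surjective_pairing Sa.
Qed.

Let posdef (x : I -> R) : \sum_(a | S a) \sum_(b | S b) x a * x b * G a b = 0 ->
  forall a, S a -> x a = 0.
Proof.
move=> q0.
have sq z : W z * pol x z ^+ 2 = \sum_(b | S b) x b * (W z * (pol x z * mono b.1 b.2 z)).
  rewrite expr2 {2}/pol mulr_sumr mulr_sumr; apply: eq_bigr => b _; lra.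
have sqf : (fun z => W z * pol x z ^+ 2) = (fun z => \sum_(b | S b) x b * (W z * (pol x z * mono b.1 b.2 z))).
  by rewrite funeqE.
have [|ii ie] := @Rintegral_sum _ _ leb2 _ (index_enum I) S
    (fun b z => x b * (W z * (pol x z * mono b.1 b.2 z))).
  by move=> b; exact: (integrableZl measurableT (x b) (polG x b.1 b.2).1).
apply: pol_ae0; last by rewrite sqf.
apply: Rintegral0_ae; first by rewrite sqf.
  by move=> z; rewrite mulr_ge0 ?sqr_ge0.
rewrite sqf ie -[RHS]q0 exchange_big; apply: eq_bigr => b Sb.
rewrite RintegralZl//; last exact: (polG x b.1 b.2).1.
rewrite (polG x b.1 b.2).2 mulr_sumr; apply: eq_bigr => a Sa.
by rewrite /G; lra.
Qed.

Lemma gram2_solve (c : nat -> nat -> R) : exists2 r, bipoly n r &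
  forall i j, (i + j < n)%N -> \int[leb2]_z (W z * (r z * mono i j z)) = c i j.
Proof.
have [x Hx] := gram_solve posdef (fun a => c a.1 a.2).
exists (pol x).
  exists (fun i j => if (insub i, insub j) is (Some i', Some j') then x (i', j') else 0) => z.
  by apply: eq_bigr => a _; rewrite !valK -surjective_pairing.
move=> i j ij.
have ni : (i < n)%N by exact: leq_ltn_trans (leq_addr _ _) ij.
have nj : (j < n)%N by exact: leq_ltn_trans (leq_addl _ _) ij.
by rewrite (polG x i j).2 -(Hx (Ordinal ni, Ordinal nj)).
Qed.

(** The moments control the coefficients through the inverse Gram matrix, and monomials are at most
    1 on the square. *)
Lemma gram2_bound : exists2 C : R, 0 <= C & forall r M, bipoly n r -> 0 <= M ->
  (forall i j, (i + j < n)%N -> `|\int[leb2]_z (W z * (r z * mono i j z))| <= M) ->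
  forall z, Khat R z -> `|r z| <= C * M.
Proof.
have [C C0 HC] := gram_bound posdef.
exists (\sum_(a | S a) C); first exact: sumr_ge0.
move=> r M [c rc] M0 rM z [/= z1 z2].
pose x (a : I) := c a.1 a.2.
have rE : r = pol x by rewrite funeqE.
have xM a : S a -> `|x a| <= C * M.
  apply: HC => // b Sb; have := rM b.1 b.2 Sb.
  by rewrite rE (polG x b.1 b.2).2.
rewrite rE /pol mulr_suml; apply: le_trans (ler_norm_sum _ _ _) _.
apply: ler_sum => a Sa; apply: le_trans (xM _ Sa); rewrite normrM ler_piMr//.
move: z1 z2; rewrite !in_itv/= => /andP[z10 z11] /andP[z20 z21].
by rewrite /mono normrM !normrX !ger0_norm// mulr_ile1 ?exprn_ge0// exprn_ile1.
Qed.

End Weight.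
End AePoly.

(** * Integrals over the square and integrability of normal traces *)

Section IntK.
Context {R : realType}.
Local Notation leb := (@lebesgue_measure R).
Local Notation leb2 := (leb \x leb)%E.
Implicit Types (f g : R * R -> R).

Lemma intKE f : intK f = \int[leb2]_z (f \_ (Khat R)) z.
Proof. by rewrite /intK Rintegral_mkcond. Qed.

Lemma LpK1P f : LpK 1 f <-> L1K (f \_ (Khat R)).
Proof.
rewrite /LpK; split.
  by move=> /Lfun1_integrable fi; split=> // z nz; rewrite patchE memNset.
by move=> [fi _]; apply/Lfun1_integrable.
Qed.

Lemma LpK1D f g : LpK 1 f -> LpK 1 g -> LpK 1 (f \+ g).
Proof. by move=> /LpK1P Lf /LpK1P Lg; apply/LpK1P; rewrite restrKD; exact: L1KD. Qed.

Lemma LpK1B f g : LpK 1 f -> LpK 1 g -> LpK 1 (f \- g).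
Proof. by move=> /LpK1P Lf /LpK1P Lg; apply/LpK1P; rewrite restrKB; exact: L1KB. Qed.

Lemma intKD f g : LpK 1 f -> LpK 1 g -> intK (fun z => f z + g z) = intK f + intK g.
Proof.
move=> /LpK1P [fi _] /LpK1P[gi _]; rewrite !intKE -RintegralD//.
by rewrite (restrKD f g).
Qed.

Lemma intKB f g : LpK 1 f -> LpK 1 g -> intK (fun z => f z - g z) = intK f - intK g.
Proof.
move=> /LpK1P [fi _] /LpK1P[gi _]; rewrite !intKE -RintegralB//.
by rewrite (restrKB f g).
Qed.

Lemma intKZ a f : LpK 1 f -> intK (fun z => a * f z) = a * intK f.
Proof.
move=> /LpK1P [fi _]; rewrite !intKE -RintegralZl//; apply: eq_Rintegral => z _.
by rewrite !restrK_JJ; lra.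
Qed.

Lemma LpK1_bipoly n f : bipoly n f -> LpK 1 f.
Proof. by move=> bf; apply/LpK1P; exact: L1K_bipoly bf. Qed.

Lemma mono_K i j z : Khat R z -> `|mono i j z| <= 1.
Proof.
move=> -[/= z1 z2]; move: z1 z2; rewrite !in_itv/= => /andP[z10 z11] /andP[z20 z21].
by rewrite /mono normrM !normrX !ger0_norm// mulr_ile1 ?exprn_ge0// exprn_ile1.
Qed.

Lemma bipoly_bounded n f : bipoly n f -> exists2 M : R, 0 <= M & forall z, Khat R z -> `|f z| <= M.
Proof.
move=> [c fc]; exists (\sum_(a : 'I_n * 'I_n | (a.1 + a.2 < n)%N) `|c a.1 a.2|); first exact: sumr_ge0.
move=> z zK; rewrite fc; apply: le_trans (ler_norm_sum _ _ _) _.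
by apply: ler_sum => a _; rewrite normrM ler_piMr// mono_K.
Qed.

Lemma restrKM f g : (fun z => f z * g z) \_ (Khat R) = (f \_ (Khat R)) \* (g \_ (Khat R)).
Proof.
rewrite funeqE => z /=; rewrite !patchE; case: ifPn => //; by rewrite mulr0.
Qed.

Lemma LpK1M_bipoly n f g : LpK 1 f -> bipoly n g -> LpK 1 (fun z => f z * g z).
Proof.
move=> /LpK1P [fi f0] bg; apply/LpK1P; have [M M0 HM] := bipoly_bounded bg.
rewrite restrKM; split; last by move=> z nz /=; rewrite f0// mul0r.
have mg := integrable_EFin_measurable (L1K_bipoly bg).1.
have bd z : `|(g \_ (Khat R)) z| <= M.
  by rewrite patchE; case: ifPn => [|_]; rewrite ?inE ?normr0//; exact: HM.
have := @integrable_bounded_mul _ _ _ leb2 _ _ _ mg bd fi.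
by congr (_.-integrable _ _); rewrite funeqE => z /=; rewrite mulrC.
Qed.

Lemma intKM_bipoly0 n f : LpK 1 f ->
  (forall i j, (i + j < n)%N -> intK (fun z => f z * mono i j z) = 0) ->
  forall q, bipoly n q -> intK (fun z => f z * q z) = 0.
Proof.
move=> fi f0 q bq; suff [] : bipoly n q /\ intK (fun z => f z * q z) = 0 by [].
move: q bq; apply: bipoly_ind.
- split; first exact: bipoly0.
  rewrite intKE (@eq_Rintegral _ _ _ _ _ (cst 0)) ?Rintegral_cst ?mul0r//.
  by move=> z _; rewrite restrK_JJ !mulr0.
- move=> q1 q2 [b1 e1] [b2 e2]; split; first exact: bipolyD.
  under [X in intK X]eq_fun do rewrite mulrDr.
  by rewrite (intKD (LpK1M_bipoly fi b1) (LpK1M_bipoly fi b2)) e1 e2 addr0.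
- move=> c i j ij; split; first exact: bipoly_cmono.
  under [X in intK X]eq_fun do rewrite mulrCA.
  by rewrite (intKZ _ (LpK1M_bipoly fi (bipoly_mono ij))) f0// mulr0.
Qed.

Lemma bipoly_ypoly n (A : {poly R}) : (size A <= n)%N -> bipoly n (fun z => A.[z.2]).
Proof.
move=> sA; suff H m : (m <= n)%N -> bipoly n (fun z => \sum_(i < m) A`_i * mono 0 i z).
  have := H n (leqnn n); congr bipoly; rewrite funeqE => z.
  by rewrite (horner_coef_wide _ sA); apply: eq_bigr => i _; rewrite /mono expr0 mul1r.
elim: m => [_|m IH mn].
  by under eq_fun do rewrite big_ord0; exact: bipoly0.
under eq_fun do rewrite big_ord_recr; apply: bipolyD; first exact: IH (ltnW mn).
exact: bipoly_cmono.
Qed.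

Lemma bipoly_xpoly n (A : {poly R}) : (size A <= n)%N -> bipoly n (fun z => A.[z.1]).
Proof.
move=> sA; suff H m : (m <= n)%N -> bipoly n (fun z => \sum_(i < m) A`_i * mono i 0 z).
  have := H n (leqnn n); congr bipoly; rewrite funeqE => z.
  by rewrite (horner_coef_wide _ sA); apply: eq_bigr => i _; rewrite /mono expr0 mulr1.
elim: m => [_|m IH mn].
  by under eq_fun do rewrite big_ord0; exact: bipoly0.
under eq_fun do rewrite big_ord_recr; apply: bipolyD; first exact: IH (ltnW mn).
by apply: bipoly_cmono; rewrite addn0.
Qed.

(** For a continuous field the trace is continuous along the compact edge; in the distributional
    case integrability is part of the definition. *)
Lemma normal_trace_integrable (u : R * R -> R * R) (g : edge -> R -> R) :
  is_normal_trace u g -> forall F, leb.-integrable `[0, 1] (EFin \o g F).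
Proof.
move=> [[cu gu]|[d [_ + _]]] F; last exact.
have gE : {in `[0, 1]%classic, EFin \o (fun t => dot (u (edge_point F t)) (edge_normal R F)) =1 EFin \o g F}.
  by move=> t; rewrite inE => tI /=; rewrite gu.
apply: (@eq_integrable _ _ _ leb _ (measurable_itv _) _ _ gE).
apply: continuous_compact_integrable; first exact: segment_compact.
apply/subspace_continuousP => t tI.
have eK s : `[0, 1]%classic s -> Khat R (edge_point F s).
  move=> sI; rewrite /edge_point; case: F.1; split=> //=; rewrite in_itv/=; by case: F.2; rewrite /= ?ler01 ?lexx.
have ce : edge_point F s @[s --> t] --> edge_point F t.
  rewrite /edge_point; case: F.1 => /=.
    exact: (@cvg_pair _ _ _ (nbhs t) (nbhs t) (nbhs (F.2%:R : R)) _ _ _ _ _ cvg_id (cvg_cst _)).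
  exact: (@cvg_pair _ _ _ (nbhs t) (nbhs (F.2%:R : R)) (nbhs t) _ _ _ _ _ (cvg_cst _) cvg_id).
have cue : u (edge_point F s) @[s --> within `[0, 1] (nbhs t)] --> u (edge_point F t).
  have cu1 := (subspace_continuousP (Khat R) u).1 cu _ (eK t tI).
  move=> P /cu1 uP.
  change (nbhs t (fun s => `[0, 1]%classic s -> P (u (edge_point F s)))).
  exact: (@filterS _ (nbhs (t : R)) (nbhs_filter (t : R)) _ _ (fun s hs sI => hs (eK s sI)) (ce _ uP)).
have c1 : (u (edge_point F s)).1 @[s --> within `[0, 1] (nbhs t)] --> (u (edge_point F t)).1.
  exact: (cvg_comp _ _ cue (@cvg_fst _ _ _ _ _)).
have c2 : (u (edge_point F s)).2 @[s --> within `[0, 1] (nbhs t)] --> (u (edge_point F t)).2.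
  exact: (cvg_comp _ _ cue (@cvg_snd _ _ _ _ _)).
apply: cvgD; (apply: cvgM; last exact: cvg_cst) => //.
Qed.

End IntK.

(** * Existence of the interpolant *)

Section Interp.
Context {R : realType}.
Local Notation leb := (@lebesgue_measure R).
Local Notation leb2 := (leb \x leb)%E.
Local Notation J := (\1_(`[0, 1]%classic : set R) : R -> R).
Implicit Types (f g : R * R -> R).

Section GramK.
Variables (m : nat) (om : R * R -> R).
Hypothesis bom : bipoly m om.
Hypothesis om0 : forall z, Khat R z -> 0 <= om z.
Hypothesis omgt0 : forall z : R * R, 0 < z.1 < 1 -> 0 < z.2 < 1 -> 0 < om z.

Let W := om \_ (Khat R).

Let mW : measurable_fun setT W.
Proof. by have [/integrable_EFin_measurable] := L1K_bipoly bom. Qed.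

Let WM : exists M : R, forall z, `|W z| <= M.
Proof.
have [M M0 HM] := bipoly_bounded bom; exists M => z; rewrite /W patchE.
by case: ifPn => [|_]; rewrite ?inE ?normr0//; exact: HM.
Qed.

Let W0 z : 0 <= W z.
Proof. by rewrite /W patchE; case: ifPn => [|_]; rewrite ?inE//; exact: om0. Qed.

Let Wgt0 (z : R * R) : 0 < z.1 < 1 -> 0 < z.2 < 1 -> 0 < W z.
Proof.
move=> z1 z2; rewrite /W patchE mem_set; first exact: omgt0.
case/andP: z1 => z10 z11; case/andP: z2 => z20 z21.
by split; rewrite /= in_itv/= !ltW.
Qed.

Let Wout z : ~ Khat R z -> W z = 0.
Proof. by move=> nz; rewrite /W patchE memNset. Qed.

Let intKW f : \int[leb2]_z (W z * f z) = intK (fun z => om z * f z).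
Proof. by rewrite intKE; apply: eq_Rintegral => z _; rewrite /W !restrK_JJ; lra. Qed.

Lemma gramK_solve n (c : nat -> nat -> R) : exists2 r, bipoly n r &
  forall i j, (i + j < n)%N -> intK (fun z => om z * (r z * mono i j z)) = c i j.
Proof.
have [M HM] := WM.
have [r br Hr] := gram2_solve mW HM W0 Wgt0 Wout n c.
by exists r => // i j ij; rewrite -intKW; exact: Hr.
Qed.

Lemma gramK_bound n : exists2 C : R, 0 <= C & forall r M, bipoly n r -> 0 <= M ->
  (forall i j, (i + j < n)%N -> `|intK (fun z => om z * (r z * mono i j z))| <= M) ->
  forall z, Khat R z -> `|r z| <= C * M.
Proof.
have [M HM] := WM.
have [C C0 HC] := gram2_bound mW HM W0 Wgt0 Wout n.
exists C => // r N br N0 rN; apply: HC => // i j ij.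
by rewrite intKW; exact: rN.
Qed.

End GramK.

Lemma is_derive_pow i (x : R) :
  is_derive x (1 : R) (fun s : R => s ^+ i.+1) (i.+1%:R * x ^+ i).
Proof.
have := is_derive_poly 'X^(i.+1) x; rewrite derivXn hornerMn hornerXn -mulr_natl.
by congr is_derive; rewrite funeqE => s; rewrite hornerXn.
Qed.

Lemma is_derive_id1 (x : R) : is_derive x (1 : R) (id : R -> R) (cst 1 x).
Proof. exact: is_derive_id. Qed.

Lemma curl_powx m (z : R * R) :
  curl (fun y : R * R => y.1 ^+ m.+1 * y.2) z = (z.1 ^+ m.+1, - (m.+1%:R * z.1 ^+ m * z.2)).
Proof.
rewrite /curl.
have -> : (fun y : R * R => y.1 ^+ m.+1 * y.2) = tens (fun x => x ^+ m.+1) id by [].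
rewrite (pdy_tens _ is_derive_id1).
by rewrite (pdx_tens _ (is_derive_pow m)) /tens /= mulr1.
Qed.

Lemma curl_powy m (z : R * R) :
  curl (fun y : R * R => y.1 * y.2 ^+ m.+1) z = (m.+1%:R * z.1 * z.2 ^+ m, - z.2 ^+ m.+1).
Proof.
rewrite /curl.
have -> : (fun y : R * R => y.1 * y.2 ^+ m.+1) = tens id (fun x => x ^+ m.+1) by [].
rewrite (pdy_tens _ (is_derive_pow m)).
rewrite (pdx_tens _ is_derive_id1).
by rewrite /tens /= mul1r; congr (_, _); lra.
Qed.

Lemma horner_take n (D : {poly R}) t : (size D <= n.+1)%N ->
  D.[t] = (take_poly n D).[t] + D`_n * t ^+ n.
Proof.
move=> sD; rewrite (horner_coef_wide _ sD) big_ord_recr/=; congr (_ + _).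
rewrite (@horner_coef_wide _ n) ?size_take_poly//; apply: eq_bigr => i _.
by rewrite coef_take_poly ltn_ord.
Qed.

Lemma bipoly_mulx n f : bipoly n f -> bipoly n.+1 (fun z => z.1 * f z).
Proof.
move=> /(bipoly_mulmono 1 0); rewrite addn0 addn1; congr bipoly.
by rewrite funeqE => z; rewrite /mono expr0 expr1 mulr1 mulrC.
Qed.

Lemma bipoly_muly n f : bipoly n f -> bipoly n.+1 (fun z => z.2 * f z).
Proof.
move=> /(bipoly_mulmono 0 1); rewrite add0n addn1; congr bipoly.
by rewrite funeqE => z; rewrite /mono expr0 expr1 mul1r mulrC.
Qed.

Lemma bipoly_cst n c : bipoly n.+1 (cst c : R * R -> R).
Proof.
have := @bipoly_cmono R n.+1 c 0 0 isT; congr bipoly.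
by rewrite funeqE => z; rewrite /mono !expr0 !mulr1.
Qed.

Lemma integrable_Jpow_mul i (g : R -> R) : leb.-integrable `[0, 1] (EFin \o g) ->
  leb.-integrable setT (EFin \o (fun t => Jpow i t * g t)).
Proof.
move=> gi; have gJi : leb.-integrable setT (EFin \o (g \_ `[0, 1])).
  rewrite -restrict_EFin.
  by have [h _] := @integrable_mkcond _ _ _ leb `[0, 1]%classic (EFin \o g) (measurable_itv _); exact: h.
have Jpow1 (t : R) : `|Jpow i t| <= 1.
  rewrite /Jpow indicE mem_setE; case: (boolP (t \in `[0, 1])).
    by rewrite in_itv/= mul1r => /andP[t0 t1]; rewrite normrX ger0_norm// exprn_ile1.
  by rewrite mul0r normr0.
have := @integrable_bounded_mul _ _ _ leb _ _ _ (integrable_EFin_measurable (integrable_Jpow i)) Jpow1 gJi.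
congr (_.-integrable _ _); rewrite funeqE => t /=; congr EFin.
rewrite patchE /Jpow indicE; case: (t \in _); first by [].
by rewrite mulr0 !mul0r.
Qed.

Lemma edge_moments (g : R -> R) (n : nat) : leb.-integrable `[0, 1] (EFin \o g) ->
  exists2 A : {poly R}, (size A <= n)%N &
    forall q : {poly R}, (size q <= n)%N -> int01 (fun t => (A.[t] - g t) * q.[t]) = 0.
Proof.
move=> gi; have gpi i := integrable_Jpow_mul i gi.
have [A sA HA] := gram1 n (fun i => \int[leb]_t (Jpow i t * g t)).
exists A => // q sq.
have JAi i : leb.-integrable setT (EFin \o (fun t => Jpow i t * A.[t])).
  have := @integrable_Jcont R (fun t => t ^+ i * A.[t]).
  have -> : (fun x => J x * (x ^+ i * A.[x])) = (fun t => Jpow i t * A.[t]).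
    by rewrite funeqE => t; rewrite /Jpow mulrA.
  apply; apply: continuous_subspaceT => t; apply: cvgM; first exact: continuous_expr.
  exact: continuous_horner.
rewrite /int01 Rintegral_indic.
have -> : (fun t => (A.[t] - g t) * q.[t] * \1_`[0, 1] t) =
   (fun t => \sum_(i < n) q`_i * (Jpow i t * A.[t] - Jpow i t * g t)).
  rewrite funeqE => t; rewrite (horner_coef_wide _ sq) mulr_sumr mulr_suml.
  by apply: eq_bigr => i _; rewrite /Jpow; lra.
have [i|_ ->] := @Rintegral_sum _ _ _ leb _ (index_enum 'I_n) xpredT
   (fun i t => q`_i * (Jpow i t * A.[t] - Jpow i t * g t)).
  exact: (integrableZl measurableT _ (integrableB_EFin (JAi i) (gpi i))).
rewrite big1// => i _; rewrite RintegralZl//; last exact: integrableB_EFin.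
by rewrite RintegralB// HA// subrr mulr0.
Qed.

(** The normal components are matched first, by affine interpolation between opposite edges together
    with the two curls. The interior moments are then corrected by terms that vanish on the relevant
    edges. *)
Lemma bdm_interpolant_exists k (u : R * R -> R * R) :
  LpK_field 1 u -> BDM_domain u -> exists w, is_BDM_interpolant k.+1 u w.
Proof.
move=> [Lu1 Lu2] [g gP].
have gi := normal_trace_integrable gP.
have exA F : exists A : {poly R}, (size A <= k.+2)%N /\
    forall q : {poly R}, (size q <= k.+2)%N -> int01 (fun t => (A.[t] - g F t) * q.[t]) = 0.
  by have [B sB HB] := edge_moments k.+2 (gi F); exists B.
have [A HA] := choice exA.
(* The outer normal at x = 0 and y = 0 points in the negative direction, whence the signs: the first
   component must equal [a0] and [a1] at x = 0 and 1, the second [c0] and [c1] at y = 0 and 1. *)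
pose a0 := - A (false, false); pose a1 := A (false, true).
pose c0 := - A (true, false); pose c1 := A (true, true).
have sz F : (size (A F) <= k.+2)%N by have [] := HA F.
pose D := a1 - a0; pose E := c1 - c0.
have sa0 : (size a0 <= k.+2)%N by rewrite size_polyN.
have sc0 : (size c0 <= k.+2)%N by rewrite size_polyN.
have sD : (size D <= k.+2)%N by rewrite (leq_trans (size_polyD _ _))// geq_max sz size_polyN sa0.
have sE : (size E <= k.+2)%N by rewrite (leq_trans (size_polyD _ _))// geq_max sz size_polyN sc0.
pose D' := take_poly k.+1 D; pose E' := take_poly k.+1 E.
have k2 : (k.+2%:R : R) != 0 by rewrite pnatr_eq0.
(* The interpolation x D(y) has one term of excess degree, D_(k+1) x y^(k+1). It is the first
   component of b curl(x y^(k+2)), which fixes b. Likewise E fixes a through the second component of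
   curl(x^(k+2) y). *)
pose b := D`_k.+1 / k.+2%:R; pose a := - E`_k.+1 / k.+2%:R.
have bk : b * k.+2%:R = D`_k.+1 by rewrite divfK.
have ak : a * k.+2%:R = - E`_k.+1 by rewrite divfK.
(* The curls also bring a x^(k+2) into the first component and -b y^(k+2) into the second. The
   linear terms -a x and b y cancel them at x = 1 and y = 1, and all of these vanish at 0. *)
pose e1 (z : R * R) := a0.[z.2] + z.1 * D'.[z.2] + - a * z.1.
pose e2 (z : R * R) := c0.[z.1] + z.2 * E'.[z.1] + b * z.2.
have be1 : bipoly k.+2 e1.
  apply: bipolyD; first apply: bipolyD.
  - exact: bipoly_ypoly.
  - by apply: bipoly_mulx; apply: bipoly_ypoly; exact: size_take_poly.
  - by apply: bipolyZ; have := bipoly_mulx (bipoly_cst k 1); congr bipoly; rewrite funeqE => z /=; rewrite mulr1.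
have be2 : bipoly k.+2 e2.
  apply: bipolyD; first apply: bipolyD.
  - exact: bipoly_xpoly.
  - by apply: bipoly_muly; apply: bipoly_xpoly; exact: size_take_poly.
  - by apply: bipolyZ; have := bipoly_muly (bipoly_cst k 1); congr bipoly; rewrite funeqE => z /=; rewrite mulr1.
pose x1 (z : R * R) := z.1 ^+ k.+2; pose x2 (z : R * R) := z.1 * z.2 ^+ k.+1.
pose B1 (z : R * R) := e1 z + a * z.1 ^+ k.+2 + b * (k.+2%:R * z.1 * z.2 ^+ k.+1).
pose B2 (z : R * R) := e2 z + a * - (k.+2%:R * z.1 ^+ k.+1 * z.2) + b * - z.2 ^+ k.+2.
have bB1 : bipoly k.+3 B1.
  apply: bipolyD; first apply: bipolyD.
  - exact: bipoly_leq be1.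
  - have := @bipoly_cmono R k.+3 a k.+2 0; rewrite addn0 => /(_ (leqnn _)); congr bipoly.
    by rewrite funeqE => z; rewrite /mono expr0 mulr1.
  - have := @bipoly_cmono R k.+3 (b * k.+2%:R) 1 k.+1; rewrite add1n => /(_ (leqnn _)); congr bipoly.
    by rewrite funeqE => z; rewrite /mono expr1 !mulrA.
have bB2 : bipoly k.+3 B2.
  apply: bipolyD; first apply: bipolyD.
  - exact: bipoly_leq be2.
  - have := @bipoly_cmono R k.+3 (- (a * k.+2%:R)) k.+1 1; rewrite addn1 => /(_ (leqnn _)); congr bipoly.
    by rewrite funeqE => z; rewrite /mono expr1; lra.
  - have := @bipoly_cmono R k.+3 (- b) 0 k.+2; rewrite add0n => /(_ (leqnn _)); congr bipoly.
    by rewrite funeqE => z; rewrite /mono expr0 mul1r mulNr mulrN.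
(* The first component is normal only on the edges x = 0 and x = 1, where [om1] vanishes; a multiple
   of [om1] added to it leaves all edge moments unchanged. The same holds for [om2] in the second
   component. *)
pose om1 (z : R * R) := z.1 * (1 - z.1); pose om2 (z : R * R) := z.2 * (1 - z.2).
have bx : bipoly 2 (fun z : R * R => z.1).
  by have := bipoly_mulx (bipoly_cst 0 1); congr bipoly; rewrite funeqE => z /=; rewrite mulr1.
have by_ : bipoly 2 (fun z : R * R => z.2).
  by have := bipoly_muly (bipoly_cst 0 1); congr bipoly; rewrite funeqE => z /=; rewrite mulr1.
have bo1 : bipoly 3 om1 by apply: bipoly_mulx; apply: (bipolyB (bipoly_cst 1 1)).
have bo2 : bipoly 3 om2 by apply: bipoly_muly; apply: (bipolyB (bipoly_cst 1 1)).
have om10 z : Khat R z -> 0 <= om1 z.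
  by move=> -[/= + _]; rewrite in_itv/= => /andP[z0 z1]; rewrite mulr_ge0// subr_ge0.
have om20 z : Khat R z -> 0 <= om2 z.
  by move=> -[/= _]; rewrite in_itv/= => /andP[z0 z1]; rewrite mulr_ge0// subr_ge0.
have om1p (z : R * R) : 0 < z.1 < 1 -> 0 < z.2 < 1 -> 0 < om1 z.
  by move=> /andP[z0 z1] _; rewrite mulr_gt0// subr_gt0.
have om2p (z : R * R) : 0 < z.1 < 1 -> 0 < z.2 < 1 -> 0 < om2 z.
  by move=> _ /andP[z0 z1]; rewrite mulr_gt0// subr_gt0.
(* At order k+1 the interior test space has degree at most k-1; [r] and [s] are sought in this very
   space, with the bubbles as weights. *)
have [r br Hr] := gramK_solve bo1 om10 om1p k
  (fun i j => intK (fun z => ((u z).1 - B1 z) * mono i j z)).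
have [s bs Hs] := gramK_solve bo2 om20 om2p k
  (fun i j => intK (fun z => ((u z).2 - B2 z) * mono i j z)).
have bor : bipoly k.+2 (fun z => om1 z * r z).
  have := bipoly_mulx (bipolyB (bipoly_leq (leqnSn k) br) (bipoly_mulx br)).
  by congr bipoly; rewrite funeqE => z; rewrite /om1 /=; lra.
have bos : bipoly k.+2 (fun z => om2 z * s z).
  have := bipoly_muly (bipolyB (bipoly_leq (leqnSn k) bs) (bipoly_muly bs)).
  by congr bipoly; rewrite funeqE => z; rewrite /om2 /=; lra.
pose w (z : R * R) := (B1 z + om1 z * r z, B2 z + om2 z * s z).
exists w; split.
- exists (fun z => (e1 z + om1 z * r z, e2 z + om2 z * s z)), a, b; split.
    have kk : k.+1%:Z = k.+2%:Z - 1 by rewrite -(addn1 k.+1) PoszD addrK.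
    split.
      by apply/(polyK_bipoly _ kk); have := bipolyD be1 bor.
    by apply/(polyK_bipoly _ kk); have := bipolyD be2 bos.
  move=> z; rewrite curl_powx curl_powy.
  rewrite /add_pair /=; congr (_, _).
    change (B1 z + om1 z * r z = e1 z + om1 z * r z + a * z.1 ^+ k.+2 +
      b * (k.+2%:R * z.1 * z.2 ^+ k.+1)).
    by rewrite /B1; lra.
  change (B2 z + om2 z * s z = e2 z + om2 z * s z +
    a * - (k.+2%:R * z.1 ^+ k.+1 * z.2) + b * - z.2 ^+ k.+2).
  by rewrite /B2; lra.
- exists g => // F q sq; have [_ /(_ q sq) <-] := HA F.
  apply: eq_Rintegral => t _; congr ((_ - _) * _).
  (* On the edges the truncated [D'] and [E'] recombine with the curl terms, by [bk'] and [ak'],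
     into the full [D] and [E]. *)
  have D0 := horner_take t sD; have E0 := horner_take t sE.
  rewrite {1}/D hornerD hornerN in D0; rewrite {1}/E hornerD hornerN in E0.
  rewrite -/D' in D0; rewrite -/E' in E0.
  have bk' : b * k.+2%:R * t ^+ k.+1 = D`_k.+1 * t ^+ k.+1 by rewrite bk.
  have ak' : a * k.+2%:R * t ^+ k.+1 = - E`_k.+1 * t ^+ k.+1 by rewrite ak.
  case: F => -[] []; rewrite /dot /edge_point /edge_normal /w /=.
  all: rewrite /B1 /B2 /e1 /e2 /om1 /om2 /=.
  + rewrite !expr1n /c1; lra.
  + rewrite !expr0n /c0 hornerN /=; lra.
  + rewrite !expr1n /a1; lra.
  + rewrite !expr0n /a0 hornerN /=; lra.
- move=> q [q1 q2]; pose q1' := fst \o q; pose q2' := snd \o q.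
  have kk : k.+1%:Z - 2 = k%:Z - 1 by rewrite -(addn1 k) PoszD -addrA.
  move/(polyK_bipoly _ kk) : q1 => q1; move/(polyK_bipoly _ kk) : q2 => q2.
  pose f1 z := (u z).1 - B1 z; pose f2 z := (u z).2 - B2 z.
  have Lf1 : LpK 1 f1 by apply: LpK1B Lu1 (LpK1_bipoly bB1).
  have Lf2 : LpK 1 f2 by apply: LpK1B Lu2 (LpK1_bipoly bB2).
  have Lor := LpK1_bipoly bor; have Los := LpK1_bipoly bos.
  have L1 := LpK1B Lor Lf1; have L2 := LpK1B Los Lf2.
  have i1 : intK (fun z => (om1 z * r z - f1 z) * q1' z) = 0.
    apply: (intKM_bipoly0 L1 _ q1) => i j ij.
    have mij := @bipoly_mono R _ _ _ ij.
    under [X in intK X]eq_fun do rewrite mulrBl.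
    rewrite (intKB (LpK1M_bipoly Lor mij) (LpK1M_bipoly Lf1 mij)) -(Hr _ _ ij).
    by under [X in intK X]eq_fun do rewrite -mulrA; rewrite subrr.
  have i2 : intK (fun z => (om2 z * s z - f2 z) * q2' z) = 0.
    apply: (intKM_bipoly0 L2 _ q2) => i j ij.
    have mij := @bipoly_mono R _ _ _ ij.
    under [X in intK X]eq_fun do rewrite mulrBl.
    rewrite (intKB (LpK1M_bipoly Los mij) (LpK1M_bipoly Lf2 mij)) -(Hs _ _ ij).
    by under [X in intK X]eq_fun do rewrite -mulrA; rewrite subrr.
  rewrite -[RHS]addr0 -{1}i1 -i2 -intKD; last 2 first.
  - exact: LpK1M_bipoly L1 q1.
  - exact: LpK1M_bipoly L2 q2.
  by congr intK; rewrite funeqE => z; rewrite /dot /w /f1 /f2 /q1' /q2' /=; lra.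
Qed.

End Interp.

(** * Green's formula for polynomial fields *)

Section GreenPoly.
Context {R : realType}.
Local Notation leb := (@lebesgue_measure R).
Local Notation leb2 := (leb \x leb)%E.
Implicit Types (f g : R * R -> R).

(** The truncated predecessor is harmless at i = 0, where the factor i is zero. *)
Lemma is_derive_exp i (x : R) :
  is_derive x (1 : R) (fun s : R => s ^+ i) (i%:R * x ^+ i.-1).
Proof.
case: i => [|i]; last exact: is_derive_pow.
by rewrite mul0r (_ : (fun s : R => s ^+ 0) = cst 1); [exact: is_derive_cst|rewrite funeqE => s; rewrite expr0].
Qed.

Lemma grad_mono i j (z : R * R) :
  grad (mono i j) z = (i%:R * mono i.-1 j z, j%:R * mono i j.-1 z).
Proof.
rewrite /grad (_ : mono i j = tens (fun x => x ^+ i) (fun y => y ^+ j))//.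
rewrite (pdx_tens _ (is_derive_exp i)) (pdy_tens _ (is_derive_exp j)).
by rewrite /tens /mono; congr (_, _); lra.
Qed.

Lemma Rintegral_Jpow i : \int[leb]_x Jpow i x = i.+1%:R^-1.
Proof.
transitivity (\int[leb]_(x in `[0, 1]) (x ^+ i)).
  by rewrite [RHS]Rintegral_indic; apply: eq_Rintegral => x _; rewrite /Jpow mulrC.
have dF := @is_derive_pow_div R i.
rewrite /Rintegral (@continuous_FTC2 _ _ (fun s => s ^+ i.+1 / i.+1%:R))//.
- by rewrite expr0n/= expr1n mul0r mul1r subr0.
- by apply: continuous_subspaceT; exact: continuous_expr.
- split.
  + by move=> s _; case: (dF s).
  + by apply: cvg_at_right_filter; exact: (is_derive1_continuous dF).
  + by apply: cvg_at_left_filter; exact: (is_derive1_continuous dF).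
- by move=> s _; rewrite derive1E; exact: derive_val.
Qed.

Lemma intK_mono i j : intK (@mono R i j) = i.+1%:R^-1 * j.+1%:R^-1.
Proof.
rewrite intKE -!Rintegral_Jpow -Rintegral_tens; try exact: integrable_Jpow.
by apply: eq_Rintegral => z _; rewrite restrK_JJ /tens /Jpow /mono; lra.
Qed.

Lemma int01_pow c i : int01 (fun t : R => c * t ^+ i) = c * i.+1%:R^-1.
Proof.
rewrite /int01 Rintegral_indic -Rintegral_Jpow -RintegralZl//; last exact: integrable_Jpow.
by apply: eq_Rintegral => t _; rewrite /Jpow; lra.
Qed.

Lemma test1_int_derive h : test1 h -> \int[leb]_x derive1 h x = 0.
Proof.
move=> th; have [dh sh'] := smooth1_derive th.1.
have t' := test1_derive th.
transitivity (\int[leb]_(x in `[0, 1]) derive1 h x).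
  by rewrite [RHS]Rintegral_indic; apply: eq_Rintegral => x _; rewrite mulrC test1_J.
rewrite /Rintegral (@continuous_FTC2 _ _ h)//.
- by rewrite (test1_out th (x := 1)) ?ltxx ?andbF// (test1_out th (x := 0)) ?ltxx// subee.
- by apply: continuous_subspaceT; exact: smooth1_continuous.
- have ch := smooth1_continuous th.1; split.
  + by move=> s _; case: (dh s).
  + by apply: cvg_at_right_filter; exact: ch.
  + by apply: cvg_at_left_filter; exact: ch.
Qed.

Lemma test1_pow i phi : test1 phi -> test1 (fun x : R => x ^+ i * phi x).
Proof. by move=> tp; apply: test1M tp; exact: smooth1X. Qed.

Lemma test1_cst c phi : test1 phi -> test1 (fun x : R => c * phi x).
Proof. by move=> tp; apply: (test1M _ tp); exact: (smooth1_cst c). Qed.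

Lemma derive1_powM i phi (x : R) : smooth1 phi ->
  derive1 (fun x : R => x ^+ i * phi x) x = x ^+ i * derive1 phi x + i%:R * (x ^+ i.-1 * phi x).
Proof.
move=> sp; have [dp _] := smooth1_derive sp; rewrite derive1E; apply: derive_val.
have := is_deriveM (is_derive_exp i x) (dp x).
by congr is_derive; rewrite -![_ *: _]/(_ * _); lra.
Qed.

(** The product x^i [phi] is a test function, so its derivative has integral zero. *)
Lemma test1_parts i phi : test1 phi ->
  \int[leb]_x (x ^+ i * derive1 phi x) = - \int[leb]_x (i%:R * (x ^+ i.-1 * phi x)).
Proof.
move=> tp; have ti := test1_pow i tp.
have := test1_int_derive ti.
under eq_Rintegral => x _ do rewrite (derive1_powM i x tp.1).
rewrite RintegralD//.
- by move/eqP; rewrite addr_eq0 => /eqP.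
- by apply: test1_integrable; apply: test1_pow; exact: test1_derive.
- by apply: test1_integrable; apply: test1_cst; exact: test1_pow.
Qed.

Lemma intK_tens f (phi psi : R -> R) : intK (fun z => f z * tens phi psi z) =
  \int[leb2]_z ((f \_ (Khat R)) z * tens phi psi z).
Proof. by rewrite intKE; apply: eq_Rintegral => z _; rewrite !restrK_JJ mulrA. Qed.

Lemma intK_test f phi psi : test1 phi -> test1 psi ->
  intK (fun z => f z * tens phi psi z) = \int[leb2]_z (f z * tens phi psi z).
Proof.
move=> tp ts; rewrite intKE; apply: eq_Rintegral => z _; rewrite restrK_JJ /tens.
by rewrite -[in RHS](test1_J z.1 tp) -[in RHS](test1_J z.2 ts); lra.
Qed.

Lemma intK_mono_test i j phi psi : test1 phi -> test1 psi ->
  intK (fun z => mono i j z * tens phi psi z) =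
  (\int[leb]_x (x ^+ i * phi x)) * \int[leb]_y (y ^+ j * psi y).
Proof.
move=> tp ts; rewrite intK_test// -Rintegral_tens; last 2 first.
- by apply: test1_integrable; exact: test1_pow.
- by apply: test1_integrable; exact: test1_pow.
by apply: eq_Rintegral => z _; rewrite /tens /mono; lra.
Qed.

(* [dv] is the divergence of the polynomial field [(f1, f2)], both in the weak
   sense and in Green's formula on the closed square. *)
Definition poly_div (f1 f2 dv : R * R -> R) : Prop :=
  [/\ exists n, [/\ bipoly n f1, bipoly n f2 & bipoly n dv],
    forall phi psi, test1 phi -> test1 psi ->
      intK (fun z => f1 z * tens (derive1 phi) psi z) + intK (fun z => f2 z * tens phi (derive1 psi) z)
      = - intK (fun z => dv z * tens phi psi z)
  & forall i j,
      intK (fun z => f1 z * (i%:R * mono i.-1 j z)) + intK (fun z => f2 z * (j%:R * mono i j.-1 z))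
      + intK (fun z => dv z * mono i j z) =
      int01 (fun t => f1 (1, t) * mono i j (1, t)) - int01 (fun t => f1 (0, t) * mono i j (0, t)) +
      (int01 (fun t => f2 (t, 1) * mono i j (t, 1)) - int01 (fun t => f2 (t, 0) * mono i j (t, 0)))].

Lemma LpK1_test f phi psi : LpK 1 f -> test1 phi -> test1 psi ->
  LpK 1 (fun z => f z * tens phi psi z).
Proof.
move=> /LpK1P Lf tp ts; apply/LpK1P.
have Li := L1K_mul_tens Lf tp ts; split; last by move=> z nz; rewrite patchE memNset.
move: Li; congr (_.-integrable _ _); rewrite funeqE => z /=; congr EFin.
by rewrite !restrK_JJ mulrA.
Qed.

Definition contp (h : R -> R) := {within `[0, 1], continuous h}.

Lemma int01D (h1 h2 : R -> R) : contp h1 -> contp h2 ->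
  int01 (fun t => h1 t + h2 t) = int01 h1 + int01 h2.
Proof.
move=> c1 c2; rewrite /int01 RintegralD//;
  by apply: continuous_compact_integrable => //; exact: segment_compact.
Qed.

Lemma continuous_bipoly n f : bipoly n f ->
  (forall c, continuous (fun t => f (c, t))) /\ (forall c, continuous (fun t => f (t, c))).
Proof.
move: f; apply: bipoly_ind.
- by split => c t; exact: cvg_cst.
- by move=> f g [cf1 cf2] [cg1 cg2]; split => c t; apply: cvgD; first [exact: cf1|exact: cf2|exact: cg1|exact: cg2].
- move=> c i j _; split => c' t; rewrite /mono /=.
    by apply: cvgM; [exact: cvg_cst|apply: cvgM; [exact: cvg_cst|exact: continuous_expr]].
  by apply: cvgM; [exact: cvg_cst|apply: cvgM; [exact: continuous_expr|exact: cvg_cst]].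
Qed.

Lemma int01_bipolyD n f g i j : bipoly n f -> bipoly n g ->
  (forall c, int01 (fun t => (f (c, t) + g (c, t)) * mono i j (c, t)) =
    int01 (fun t => f (c, t) * mono i j (c, t)) + int01 (fun t => g (c, t) * mono i j (c, t))) /\
  (forall c, int01 (fun t => (f (t, c) + g (t, c)) * mono i j (t, c)) =
    int01 (fun t => f (t, c) * mono i j (t, c)) + int01 (fun t => g (t, c) * mono i j (t, c))).
Proof.
move=> bf bg; have [cf1 cf2] := continuous_bipoly bf; have [cg1 cg2] := continuous_bipoly bg.
have [cm1 cm2] := continuous_bipoly (@bipoly_mono R _ i j (ltnSn _)).
split=> c; rewrite -int01D;
  first [by congr int01; rewrite funeqE => t; rewrite mulrDl | apply: continuous_subspaceT => t; apply: cvgM;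
    first [exact: cf1|exact: cf2|exact: cg1|exact: cg2|exact: cm1|exact: cm2]].
Qed.

Lemma poly_divD f1 f2 dv g1 g2 ev : poly_div f1 f2 dv -> poly_div g1 g2 ev ->
  poly_div (f1 \+ g1) (f2 \+ g2) (dv \+ ev).
Proof.
move=> [[n [bf1 bf2 bd]] wf Gf] [[m [bg1 bg2 be]] wg Gg].
have le1 := bipoly_leq (leq_maxl n m); have le2 := bipoly_leq (leq_maxr n m).
move: bf1 bf2 bd bg1 bg2 be => /le1 bf1 /le1 bf2 /le1 bd /le2 bg1 /le2 bg2 /le2 be.
split.
- by exists (maxn n m); split; exact: bipolyD.
- move=> phi psi tp ts.
  have D (h1 h2 : R * R -> R) (phi' psi' : R -> R) : bipoly (maxn n m) h1 -> bipoly (maxn n m) h2 -> test1 phi' -> test1 psi' ->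
     intK (fun z => (h1 \+ h2) z * tens phi' psi' z) =
     intK (fun z => h1 z * tens phi' psi' z) + intK (fun z => h2 z * tens phi' psi' z).
    move=> b1 b2 tp' ts'; rewrite -(intKD (LpK1_test (LpK1_bipoly b1) tp' ts') (LpK1_test (LpK1_bipoly b2) tp' ts')).
    by congr intK; rewrite funeqE => z /=; rewrite mulrDl.
  have tp' := test1_derive tp; have ts' := test1_derive ts.
  by rewrite !D//; have := wf _ _ tp ts; have := wg _ _ tp ts; lra.
- move=> i j.
  have D (h1 h2 : R * R -> R) (c : R) k l : bipoly (maxn n m) h1 -> bipoly (maxn n m) h2 ->
     intK (fun z => (h1 \+ h2) z * (c * mono k l z)) =
     intK (fun z => h1 z * (c * mono k l z)) + intK (fun z => h2 z * (c * mono k l z)).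
    move=> b1 b2; have bm := bipoly_cmono c (ltnSn (k + l)).
    rewrite -(intKD (LpK1M_bipoly (LpK1_bipoly b1) bm) (LpK1M_bipoly (LpK1_bipoly b2) bm)).
    by congr intK; rewrite funeqE => z /=; rewrite mulrDl.
  have D1 (h1 h2 : R * R -> R) : bipoly (maxn n m) h1 -> bipoly (maxn n m) h2 ->
     intK (fun z => (h1 \+ h2) z * mono i j z) =
     intK (fun z => h1 z * mono i j z) + intK (fun z => h2 z * mono i j z).
    move=> b1 b2; have bm := @bipoly_mono R _ i j (ltnSn (i + j)).
    rewrite -(intKD (LpK1M_bipoly (LpK1_bipoly b1) bm) (LpK1M_bipoly (LpK1_bipoly b2) bm)).
    by congr intK; rewrite funeqE => z /=; rewrite mulrDl.
  have [e1 _] := int01_bipolyD i j bf1 bg1; have [_ e2] := int01_bipolyD i j bf2 bg2.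
  rewrite !D// D1// !e1 !e2; have := Gf i j; have := Gg i j; lra.
Qed.

Lemma poly_div_monox c a b : poly_div (fun z => c * mono a b z) (cst 0) (fun z => c * a%:R * mono a.-1 b z).
Proof.
have z0 (h : R * R -> R) : intK (fun z => cst 0 z * h z) = 0.
  rewrite intKE (@eq_Rintegral _ _ _ _ _ (cst 0)) ?Rintegral_cst ?mul0r//.
  by move=> z _; rewrite restrK_JJ mul0r mulr0.
have z01 (h : R -> R) : int01 (fun t => cst (0 : R) (t, t) * h t) = 0.
  by rewrite /int01 (@eq_Rintegral _ _ _ _ _ (cst 0)) ?Rintegral_cst ?mul0r// => t _; rewrite mul0r.
split.
- exists (a + b).+1; split; [exact: bipoly_cmono|exact: bipoly0|].
  by apply: bipoly_cmono; rewrite ltnS leq_add2r leq_pred.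
- move=> phi psi tp ts; rewrite z0 addr0; have tp' := test1_derive tp.
  under [X in intK X = _]eq_fun do rewrite -mulrA.
  under [X in _ = - intK X]eq_fun do rewrite -mulrA.
  have Lm k l := LpK1_bipoly (@bipoly_mono R _ k l (ltnSn (k + l))).
  rewrite (intKZ c (LpK1_test (Lm a b) tp' ts)) (intKZ (c * a%:R) (LpK1_test (Lm a.-1 b) tp ts)).
  rewrite !intK_mono_test// test1_parts// RintegralZl//; first by lra.
  by apply: test1_integrable; exact: test1_pow.
- move=> i j; rewrite z0 addr0.
  have zz (h : R -> R) : int01 (fun t => 0 * h t) = 0.
    by rewrite /int01 (@eq_Rintegral _ _ _ _ _ (cst 0)) ?Rintegral_cst ?mul0r// => t _; rewrite mul0r.
  rewrite [X in _ = _ + (X - _)]zz [X in _ = _ + (_ - X)]zz subrr addr0.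
  have Lm k l := LpK1_bipoly (@bipoly_mono R _ k l (ltnSn (k + l))).
  have monoE (z : R * R) : c * mono a b z * (i%:R * mono i.-1 j z) = c * i%:R * mono (a + i).-1 (b + j) z.
    case: i => [|i]; first by rewrite !(mulr0, mul0r).
    by rewrite addnS /mono !exprD; lra.
  have monoE' (z : R * R) : c * a%:R * mono a.-1 b z * mono i j z = c * a%:R * mono (a + i).-1 (b + j) z.
    case: a {monoE} => [|a]; first by rewrite !(mulr0, mul0r).
    by rewrite addSn /mono !exprD; lra.
  under [X in intK X + _ = _]eq_fun do rewrite monoE.
  under [X in _ + intK X = _]eq_fun do rewrite monoE'.
  rewrite !(intKZ _ (Lm _ _)) intK_mono.
  have e1 (s : R) : (fun t => c * mono a b (s, t) * mono i j (s, t)) = (fun t => (c * s ^+ (a + i)) * t ^+ (b + j)).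
    by rewrite funeqE => t; rewrite /mono /= !exprD; lra.
  rewrite !e1 !int01_pow expr1n expr0n.
  set v := (b + j).+1%:R^-1.
  (* If a = i = 0 both sides vanish. Otherwise only the edge x = 1 contributes, and (a + i) / (a +
     i) = 1. *)
  have [ai0|ai0] := posnP (a + i)%N.
    move/eqP: ai0; rewrite addn_eq0 => /andP[/eqP -> /eqP ->].
    by rewrite addn0 !mulr0 !mul0r addr0 mulr1n subrr.
  have : (a + i)%N%:R * (a + i)%N.-1.+1%:R^-1 = 1 :> R.
    by rewrite prednK// mulfV// pnatr_eq0 -lt0n.
  rewrite natrD mulr0n; set w := (_.+1%:R^-1) => h.
  transitivity (c * v * ((a%:R + i%:R) * w)); first by lra.
  by rewrite h; lra.
Qed.

End GreenPoly.

(** * Exchange of the coordinates, and the divergence of the interpolant *)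

Section Swap.
Context {R : realType}.
Local Notation leb := (@lebesgue_measure R).
Implicit Types (f g : R * R -> R).

Lemma L1K_swap f : L1K f -> L1K (f \o swap_pair).
Proof.
move=> [fi f0]; have mf := integrable_EFin_measurable fi.
have ms : measurable_fun setT (@swap_pair R R) := @measurable_swap _ _ R R.
have msf : measurable_fun setT (f \o swap_pair) by apply: measurableT_comp mf ms.
split; last by move=> [x y] nz; apply: f0 => -[/= h1 h2]; apply: nz.
apply/integrable12ltyP; first exact/measurable_EFinP.
have mE : measurable_fun setT (EFin \o f) by exact/measurable_EFinP.
have := (integrable21ltyP leb leb mE).1 fi; exact.
Qed.

Lemma restrK_swap f : (f \o swap_pair) \_ (Khat R) = (f \_ (Khat R)) \o swap_pair.
Proof. by rewrite !restrK_JJ funeqE => -[x y] /=; lra. Qed.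

Lemma LpK1_swap f : LpK 1 f -> LpK 1 (f \o swap_pair).
Proof. by move=> /LpK1P Lf; apply/LpK1P; rewrite restrK_swap; exact: L1K_swap. Qed.

Lemma intK_swap f : LpK 1 f -> intK (f \o swap_pair) = intK f.
Proof.
move=> /LpK1P Lf; rewrite !intKE restrK_swap.
rewrite Rfubini12; last by case: (L1K_swap Lf).
by rewrite Rfubini21; last by case: Lf.
Qed.

Lemma mono_swap i j z : mono i j (swap_pair z) = mono j i z :> R.
Proof. by case: z => x y; rewrite /mono /= mulrC. Qed.

Lemma tens_swap (p q : R -> R) z : tens p q (swap_pair z) = tens q p z.
Proof. by case: z => x y; rewrite /tens /= mulrC. Qed.

Lemma bipoly_swap n f : bipoly n f -> bipoly n (f \o swap_pair).
Proof.
move: f; apply: bipoly_ind.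
- exact: bipoly0.
- by move=> f g bf bg; exact: bipolyD.
- move=> c i j; rewrite addnC => /(bipoly_cmono c); congr bipoly.
  by rewrite funeqE => z; rewrite /= mono_swap.
Qed.

(** Reflection in the diagonal exchanges the components and the pairs of opposite edges, so
    computations in the x direction suffice. *)
Lemma poly_div_swap f1 f2 dv : poly_div f1 f2 dv ->
  poly_div (f2 \o swap_pair) (f1 \o swap_pair) (dv \o swap_pair).
Proof.
move=> [[n [b1 b2 bd]] wf Gf]; split.
- by exists n; split; exact: bipoly_swap.
- move=> phi psi tp ts; have := wf _ _ ts tp.
  have tp' := test1_derive tp; have ts' := test1_derive ts.
  have e (f : R * R -> R) (p q : R -> R) : bipoly n f -> test1 p -> test1 q ->
      intK (fun z => (f \o swap_pair) z * tens p q z) = intK (fun z => f z * tens q p z).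
    move=> bf tp1 tq1; rewrite -(intK_swap (LpK1_test (LpK1_bipoly bf) tq1 tp1)).
    by congr intK; rewrite funeqE => z /=; rewrite tens_swap.
  by rewrite !e//; lra.
- move=> i j; have := Gf j i.
  have e (f : R * R -> R) (c : R) a b : bipoly n f ->
      intK (fun z => (f \o swap_pair) z * (c * mono a b z)) = intK (fun z => f z * (c * mono b a z)).
    move=> bf; rewrite -(intK_swap (LpK1M_bipoly (LpK1_bipoly bf) (bipoly_cmono c (ltnSn (b + a))))).
    by congr intK; rewrite funeqE => z /=; rewrite mono_swap.
  have e' (f : R * R -> R) a b : bipoly n f ->
      intK (fun z => (f \o swap_pair) z * mono a b z) = intK (fun z => f z * mono b a z).
    move=> bf; rewrite -(intK_swap (LpK1M_bipoly (LpK1_bipoly bf) (@bipoly_mono R _ _ _ (ltnSn (b + a))))).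
    by congr intK; rewrite funeqE => z /=; rewrite mono_swap.
  rewrite !e// e'//.
  under [X in _ -> _ = int01 X - _ + _]eq_fun do rewrite -mono_swap /=.
  under [X in _ -> _ = _ - int01 X + _]eq_fun do rewrite -mono_swap /=.
  under [X in _ -> _ = _ + (int01 X - _)]eq_fun do rewrite -mono_swap /=.
  under [X in _ -> _ = _ + (_ - int01 X)]eq_fun do rewrite -mono_swap /=.
  by lra.
Qed.

Lemma poly_div_monoy c a b :
  poly_div (cst 0) (fun z => c * mono a b z) (fun z => c * b%:R * mono a b.-1 z : R).
Proof.
have := poly_div_swap (poly_div_monox c b a).
by congr poly_div; rewrite funeqE => z /=; rewrite mono_swap.
Qed.

Lemma poly_div0 : poly_div (cst 0) (cst 0) (cst 0 : R * R -> R).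
Proof.
have := poly_div_monox (0 : R) 0 0.
by congr poly_div; rewrite funeqE => z /=; rewrite !mul0r.
Qed.

Lemma bipoly_div_x n f : bipoly n.+1 f -> exists2 dv, bipoly n dv & poly_div f (cst 0) dv.
Proof.
move: f; apply: bipoly_ind.
- by exists (cst 0); [exact: bipoly0|exact: poly_div0].
- move=> f g [d1 b1 p1] [d2 b2 p2]; exists (d1 \+ d2); first exact: bipolyD.
  have := poly_divD p1 p2; congr poly_div; by rewrite funeqE => z /=; rewrite addr0.
- move=> c [|i] j ij.
    exists (cst 0); first exact: bipoly0.
    have := poly_div_monox c 0 j; congr poly_div.
    by rewrite funeqE => z /=; rewrite mulr0 mul0r.
  exists (fun z => c * i.+1%:R * mono i j z); last exact: poly_div_monox.
  exact: bipoly_cmono.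
Qed.

Lemma bipoly_div n f g : bipoly n.+1 f -> bipoly n.+1 g ->
  exists2 dv, bipoly n dv & poly_div f g dv.
Proof.
move=> /bipoly_div_x[d1 b1 p1] /bipoly_swap/bipoly_div_x[d2 b2 p2].
exists (d1 \+ (d2 \o swap_pair)); first by apply: bipolyD => //; exact: bipoly_swap.
have := poly_divD p1 (poly_div_swap p2).
by congr poly_div; rewrite funeqE => -[x y] /=; rewrite ?addr0 ?add0r.
Qed.

(** The contributions of each curl to the divergence cancel, so only the part of degree k+1 counts
    and the divergence has degree at most k. *)
Lemma BDM_div k (w : R * R -> R * R) : BDM k.+1 w ->
  exists dv, bipoly k.+1 dv /\ poly_div (fst \o w) (snd \o w) dv.
Proof.
move=> [v [a [b [[v1 v2] wE]]]].
have kk : k.+1%:Z = k.+2%:Z - 1 by rewrite -(addn1 k.+1) PoszD addrK.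
move/(polyK_bipoly _ kk) : v1 => v1; move/(polyK_bipoly _ kk) : v2 => v2.
have [dv bdv pdv] := bipoly_div v1 v2.
exists dv; split=> //.
have pa : poly_div (fun z => a * z.1 ^+ k.+2) (fun z => - a * (k.+2%:R * z.1 ^+ k.+1 * z.2)) (cst 0).
  have := poly_divD (poly_div_monox a k.+2 0) (poly_div_monoy (- (a * k.+2%:R)) k.+1 1).
  by congr poly_div; rewrite funeqE => z; rewrite /mono /= ?expr0 ?expr1; lra.
have pb : poly_div (fun z => b * (k.+2%:R * z.1 * z.2 ^+ k.+1)) (fun z => - b * z.2 ^+ k.+2) (cst 0).
  have := poly_divD (poly_div_monox (b * k.+2%:R) 1 k.+1) (poly_div_monoy (- b) 0 k.+2).
  by congr poly_div; rewrite funeqE => z; rewrite /mono /= ?expr0 ?expr1; lra.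
have := poly_divD (poly_divD pdv pa) pb.
congr poly_div; rewrite funeqE => z /=; rewrite ?wE ?curl_powx ?curl_powy /add_pair /=.
- by [].
- by rewrite -!mulrN !mulNr -!mulrN.
- by rewrite !addr0.
Qed.

End Swap.

(** * Cutoff functions concentrating on the boundary *)

Section Cutoff.
Context {R : realType}.
Local Notation leb := (@lebesgue_measure R).
Local Notation leb2 := (leb \x leb)%E.
Local Notation J := (\1_(`[0, 1]%classic : set R) : R -> R).
Local Notation Jo := (\1_(`]0, 1[%classic : set R) : R -> R).
Implicit Types (f g : R * R -> R).

Lemma ae_neq (a : R) : \forall x \ae leb, x <> a.
Proof.
exists [set a]; split; [exact: measurable_set1|exact: lebesgue_measure_set1|].
by move=> x /= /contrapT ->.
Qed.

Lemma ae_J : \forall x \ae leb, J x = Jo x.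
Proof.
apply: aeS2 (ae_neq 0) (ae_neq 1) => x /eqP x0 /eqP x1.
by rewrite !indicE !mem_setE !in_itv/= !lt_neqAle (eq_sym 0) x0 x1.
Qed.

Lemma Jo_bound (x : R) : `|Jo x| <= 1.
Proof. by rewrite ger0_norm ?indicE//; case: (_ \in _). Qed.

Lemma measurable_Jo : measurable_fun setT Jo.
Proof. by apply: measurable_indic; exact: measurable_itv. Qed.

(** The boundary of the square is a null set; this is used section by section. *)
Lemma L1K_open G : L1K G ->
  \int[leb2]_z (G z * tens Jo Jo z) = \int[leb2]_z G z.
Proof.
move=> LG; have [Gi _] := LG.
have G1 := integrable_mul_fst Gi measurable_Jo Jo_bound.
have G2 := integrable_mul_snd G1 measurable_Jo Jo_bound.
have GT : leb2.-integrable setT (EFin \o (fun z => G z * tens Jo Jo z)).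
  by move: G2; congr (_.-integrable _ _); rewrite funeqE => z /=; rewrite /tens mulrA.
rewrite (Rfubini12 GT) (Rfubini12 Gi); apply: Rintegral_ae_eq.
- exact: integrable_EFin_measurable (integrable_Rint_xsection GT).
- exact: integrable_EFin_measurable (integrable_Rint_xsection Gi).
apply: aeS2 (ae_int_xsection GT) _ => [x Tx|].
  exact: id.
apply: aeS2 (ae_int_xsection Gi) (filterI (ae_int_xsection GT) ae_J).
move=> x Gx [Tx Jx]; apply: Rintegral_ae_eq.
- exact: integrable_EFin_measurable Tx.
- exact: integrable_EFin_measurable Gx.
apply: aeS ae_J => y Jy; rewrite -[in RHS](L1K_JJ LG (x, y)) /tens /= Jx Jy; lra.
Qed.

Lemma L1K_open_cvg G (eta : nat -> R -> R) : L1K G ->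
  (forall n, measurable_fun setT (eta n)) -> (forall n x, `|eta n x| <= 1) ->
  (forall x, eta n x @[n --> \oo] --> Jo x) ->
  \int[leb2]_z (G z * tens (eta n) (eta n) z) @[n --> \oo] --> \int[leb2]_z G z.
Proof.
move=> LG me e1 ec; have [Gi _] := LG; rewrite -(L1K_open LG).
have mG := integrable_EFin_measurable Gi.
have mt (h : R -> R) : measurable_fun setT h -> measurable_fun setT (fun z : R * R => G z * tens h h z).
  move=> mh; apply: measurable_funM => //; apply: measurable_funM.
    exact: measurableT_comp mh measurable_fst.
  exact: measurableT_comp mh measurable_snd.
apply: (@Rintegral_dominated_cvg _ _ _ leb2 _ _ (fun z => `|G z|)).
- by move=> n; exact: mt.
- by apply: mt; exact: measurable_Jo.
- exact: integrable_norm.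
- by move=> z; apply: cvgM; [exact: cvg_cst|apply: cvgM; exact: ec].
- move=> n z; rewrite normrM -[leRHS]mulr1 ler_wpM2l// normrM -[leRHS]mulr1.
  by apply: ler_pM.
Qed.

Section Kap.
Variables (a b : R) (rho : R -> R).
Hypothesis trho : test1 rho.
Hypothesis irho : \int[leb]_x rho x = 1.
Hypothesis rho_out : forall x, ~~ (a < x < b) -> rho x = 0.

Lemma kap_left s : s <= a -> kap rho s = 1.
Proof.
move=> sa; rewrite -irho; apply: eq_Rintegral => x _; rewrite /heaviside /=.
have [|xab] := boolP (a < x < b); last by rewrite rho_out// mulr0.
by move=> /andP[ax _]; rewrite (ltW (le_lt_trans sa ax)) mul1r.
Qed.

Lemma kap_right s : b <= s -> kap rho s = 0.
Proof.
move=> bs; rewrite /kap (@eq_Rintegral _ _ _ _ _ (cst 0)) ?Rintegral_cst ?mul0r// => x _.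
rewrite /heaviside /=.
have [|xab] := boolP (a < x < b); last by rewrite rho_out// mulr0.
by move=> /andP[_ xb]; rewrite leNgt (lt_le_trans xb bs) mul0r.
Qed.

End Kap.

(* [cutoff n] tends to 1 on ]0, 1[, and its derivative [rho0 n - rho1 n] to the
   difference of the point masses at 0 and 1; this produces the boundary terms. *)
Definition eps n : R := n.+4.+1%:R^-1.
Definition rho0 n := mollifier (eps n) (2 * eps n).
Definition rho1 n := mollifier (1 - 2 * eps n) (1 - eps n).
Definition cutoff n := tker (rho0 n) (rho1 n).

Lemma eps_itv n : 0 < eps n < 1 / 4.
Proof.
by rewrite /eps invr_gt0 ltr0n/= div1r ltf_pV2 ?posrE ?ltr0n// ltr_nat !ltnS.
Qed.

Lemma eps_near (e : R) : 0 < e -> \forall n \near \oo, eps n < e.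
Proof.
move=> e0; near=> n; have : n.+1%:R^-1 < e.
  by near: n; exact: (near_infty_natSinv_lt (PosNum e0)).
by apply: le_lt_trans; rewrite /eps lef_pV2 ?posrE ?ltr0n// ler_nat ltnS; exact: (leq_addl 4 n).
Unshelve. all: by end_near. Qed.

Lemma rho0P n : [/\ test1 (rho0 n), forall x, 0 <= rho0 n x,
  \int[leb]_x rho0 n x = 1 & forall x, ~~ (eps n < x < 2 * eps n) -> rho0 n x = 0].
Proof. have /andP[e0 e1] := eps_itv n; apply: mollifierP; lra. Qed.

Lemma rho1P n : [/\ test1 (rho1 n), forall x, 0 <= rho1 n x,
  \int[leb]_x rho1 n x = 1 & forall x, ~~ (1 - 2 * eps n < x < 1 - eps n) -> rho1 n x = 0].
Proof. have /andP[e0 e1] := eps_itv n; apply: mollifierP; lra. Qed.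

Lemma cutoff_test n : test1 (cutoff n) /\
  derive1 (cutoff n) = (fun x => rho0 n x - rho1 n x).
Proof.
have [t0 p0 i0 _] := rho0P n; have [t1 p1 i1 _] := rho1P n.
have [tc ->] := tkerP t0 i0 t1; split=> //.
by rewrite funeqE => x; rewrite i1 mul1r.
Qed.

(** As a difference of two smoothed steps, the cutoff equals 1 between 2 [eps n] and 1 - 2
    [eps n]. *)
Lemma cutoffE n s : cutoff n s = kap (rho1 n) s - kap (rho0 n) s.
Proof.
have [t0 p0 i0 _] := rho0P n; have [t1 p1 i1 _] := rho1P n.
have ti := test1_integrable t1.
have hi := int_heavisideM s ti.
rewrite /cutoff /tker /ker /kap -[X in _ = _ - X]mulr1 -i1.
rewrite -RintegralZl// -RintegralB//; last exact: (integrableZl measurableT _ ti).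
by apply: eq_Rintegral => x _; rewrite /= mulrBl.
Qed.

Lemma cutoff_bound n s : `|cutoff n s| <= 1.
Proof.
have [t0 p0 i0 _] := rho0P n; have [t1 p1 i1 _] := rho1P n.
have /andP[a0 a1] := kap_itv t0 p0 i0 s; have /andP[b0 b1] := kap_itv t1 p1 i1 s.
rewrite cutoffE; move: (kap _ _) (kap _ _) a0 a1 b0 b1 => u v a0 a1 b0 b1.
by clear -a0 a1 b0 b1; rewrite ler_norml; apply/andP; split; lra.
Qed.

Lemma cutoff_cvg s : cutoff n s @[n --> \oo] --> Jo s.
Proof.
rewrite indicE mem_setE in_itv /=; case: (boolP (0 < s < 1)) => s01.
  have /andP[s0 s1] := s01; apply: cvg_near_cst; near=> n.
  have es : eps n < s / 2 by near: n; apply: eps_near; lra.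
  have es' : eps n < (1 - s) / 2 by near: n; apply: eps_near; lra.
  have [t0 p0 i0 o0] := rho0P n; have [t1 p1 i1 o1] := rho1P n.
  have e1 : s <= 1 - 2 * eps n by clear -es'; lra.
  have e2 : 2 * eps n <= s by clear -es; lra.
  by rewrite cutoffE (kap_left i1 o1)// (kap_right o0)// subr0.
apply: cvg_near_cst; apply: nearW => n.
by rewrite (test1_out (cutoff_test n).1).
Unshelve. all: by end_near. Qed.

End Cutoff.

(** * Edge values of continuous functions as limits of integrals over thin strips *)

Section Edge.
Context {R : realType}.
Local Notation leb := (@lebesgue_measure R).
Local Notation leb2 := (leb \x leb)%E.
Local Notation J := (\1_(`[0, 1]%classic : set R) : R -> R).
Local Notation Jo := (\1_(`]0, 1[%classic : set R) : R -> R).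
Implicit Types (f g : R * R -> R).

Definition contK f := forall z, Khat R z -> f @ within (Khat R) (nbhs z) --> f z.

Lemma contKP f : contK f <-> forall z, Khat R z -> forall e, 0 < e -> exists2 r, 0 < r &
  forall w, Khat R w -> `|z.1 - w.1| < r -> `|z.2 - w.2| < r -> `|f z - f w| < e.
Proof.
split=> [cf z Kz e e0|H z Kz].
  have /cvgrPdist_lt/(_ e e0)/nbhs_ballP[r /= r0 br] := cf z Kz.
  by exists r => // w Kw w1 w2; apply: br.
apply/cvgrPdist_lt => e e0; have [r r0 br] := H z Kz e e0.
by apply/nbhs_ballP; exists r => //= w [w1 w2] Kw; exact: br.
Qed.

Lemma contK_swap f : contK f -> contK (f \o swap_pair).
Proof.
move=> /contKP cf; apply/contKP => -[x y] [/= Kx Ky] e e0.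
have [r r0 br] := cf (y, x) (conj Ky Kx) e e0; exists r => // -[x' y'] [/= Kx' Ky'] h1 h2.
exact: (br (y', x') (conj Ky' Kx')).
Qed.

Lemma contKM f g : contK f -> contK g -> contK (f \* g).
Proof. by move=> cf cg z Kz; apply: cvgM; [exact: cf|exact: cg]. Qed.

Lemma contK_mono i j : contK (@mono R i j).
Proof.
move=> z _; apply: cvg_within_filter; apply: cvgM.
  by apply: (@continuous_comp _ _ _ fst (fun x : R => x ^+ i)); [exact: cvg_fst|exact: continuous_expr].
by apply: (@continuous_comp _ _ _ snd (fun x : R => x ^+ j)); [exact: cvg_snd|exact: continuous_expr].
Qed.

Lemma contK_field (u : R * R -> R * R) : {within Khat R, continuous u} ->
  contK (fst \o u) /\ contK (snd \o u).
Proof.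
move=> /subspace_continuousP cu; split=> z Kz.
  by apply: (cvg_comp _ _ (cu z Kz)); exact: cvg_fst.
by apply: (cvg_comp _ _ (cu z Kz)); exact: cvg_snd.
Qed.

Lemma Khat_pair (x y : R) : 0 <= x <= 1 -> 0 <= y <= 1 -> Khat R (x, y).
Proof. by move=> x01 y01; split; rewrite /= in_itv. Qed.

Lemma contK_slice h c : contK h -> 0 <= c <= 1 -> {within `[0, 1], continuous (fun y => h (c, y))}.
Proof.
move=> /contKP ch c01; apply/subspace_continuousP => y; rewrite /= in_itv/= => y01.
apply/cvgrPdist_lt => e e0; have [r r0 br] := ch (c, y) (Khat_pair c01 y01) e e0.
apply/nbhs_ballP; exists r => //= y' yy'; rewrite in_itv/= => y'01.
by apply: (br (c, y') (Khat_pair c01 y'01)) => //=; rewrite subrr normr0.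
Qed.

(** Compactness of the segment makes continuity at x = c uniform in y; [del n] is the width of a
    shrinking strip. *)
Lemma contK_edge_unif h c (del : nat -> R) : contK h -> 0 <= c <= 1 ->
  (forall e, 0 < e -> \forall n \near \oo, del n < e) ->
  forall e, 0 < e -> \forall n \near \oo, forall y : R, 0 <= y <= 1 ->
    forall x : R, 0 <= x <= 1 -> `|x - c| < del n -> `|h (x, y) - h (c, y)| <= e.
Proof.
move=> /contKP ch c01 d0 e e0.
have cpt : compact (`[0, 1]%classic : set R) by exact: segment_compact.
have cov := (near_covering_withinP _).2 ((compact_near_coveringP _).1 cpt).
pose P n (y : R) := forall x : R, 0 <= x <= 1 -> `|x - c| < del n -> `|h (x, y) - h (c, y)| <= e.
have HP : forall y : R, [set` `[0, 1]] y -> \forall y' \near y & n \near \oo, [set` `[0, 1]] y' -> P n y'.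
  move=> y; rewrite /= in_itv/= => y01.
  have e20 : 0 < e / 2 by rewrite divr_gt0.
  have [r r0 br] := ch (c, y) (Khat_pair c01 y01) _ e20.
  exists (ball y r, [set n | del n < r]).
    by split; [exact: nbhsx_ballx|exact: d0].
  move=> [y' n] [/= yy' dn]; rewrite in_itv/= => y'01 x x01 xc.
  have h1 : `|h (c, y) - h (x, y')| < e / 2.
    by apply: (br (x, y') (Khat_pair x01 y'01)) => //=; rewrite distrC; exact: lt_trans dn.
  have h2 : `|h (c, y) - h (c, y')| < e / 2.
    by apply: (br (c, y') (Khat_pair c01 y'01)) => //=; rewrite subrr normr0.
  have -> : h (x, y') - h (c, y') = (h (c, y) - h (c, y')) - (h (c, y) - h (x, y')) by lra.
  by apply: le_trans (ler_normB _ _) _; move: h1 h2; lra.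
have [N _ HN] := cov nat \oo P _ HP; exists N => // n /HN Pn y y01; apply: Pn.
Qed.

(** Since [rho n] is supported in the strip around c, h(x, y) may be replaced by h(c, y) with
    uniformly small error. What remains is a one-dimensional integral with the cutoff as factor,
    settled by dominated convergence. *)
Lemma edge_cvg h c (rho : nat -> R -> R) (del : nat -> R) :
  LpK 1 h -> contK h -> 0 <= c <= 1 ->
  (forall e, 0 < e -> \forall n \near \oo, del n < e) ->
  (forall n, [/\ test1 (rho n), forall x, 0 <= rho n x,
     \int[leb]_x rho n x = 1 & forall x, ~~ (`|x - c| < del n) -> rho n x = 0]) ->
  \int[leb2]_z ((h \_ (Khat R)) z * tens (rho n) (@cutoff R n) z) @[n --> \oo] -->
  int01 (fun t => h (c, t)).
Proof.
move=> /LpK1P LH ch c01 d0 rhoP; set H := h \_ (Khat R).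
pose hc y := J y * h (c, y).
have hci : leb.-integrable setT (EFin \o hc).
  by apply: integrable_Jcont; exact: contK_slice.
have mhc := integrable_EFin_measurable hci.
have tcut n := (@cutoff_test R n).1.
have mcut n : measurable_fun setT (@cutoff R n) by apply: smooth1_measurable; exact: (tcut n).1.
have hcut n : leb.-integrable setT (EFin \o (fun y => hc y * cutoff n y)).
  have := @integrable_bounded_mul _ _ _ leb _ _ _ (mcut n) (@cutoff_bound R n) hci.
  by congr (_.-integrable _ _); rewrite funeqE => y /=; rewrite mulrC.
have cvI : \int[leb]_y (hc y * cutoff n y) @[n --> \oo] --> int01 (fun t => h (c, t)).
  have -> : int01 (fun t => h (c, t)) = \int[leb]_y (hc y * Jo y).
    rewrite /int01 Rintegral_indic; apply: Rintegral_ae_eq.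
    - move: mhc; congr measurable_fun; rewrite funeqE => y; exact: mulrC.
    - by apply: measurable_funM => //; exact: measurable_Jo.
    apply: aeS ae_J => y Jy; rewrite -Jy /hc indicE.
    by case: (_ \in _); rewrite ?mulr1 ?mulr0 ?mul1r.
  apply: (@Rintegral_dominated_cvg _ _ _ leb _ _ (fun y => `|hc y|)).
  - by move=> n; apply: measurable_funM => //; exact: mcut.
  - by apply: measurable_funM => //; exact: measurable_Jo.
  - exact: integrable_norm.
  - by move=> y; apply: cvgM; [exact: cvg_cst|exact: cutoff_cvg].
  - by move=> n y; rewrite normrM -[leRHS]mulr1 ler_wpM2l// cutoff_bound.
pose T n z := tens (rho n) (fun y => hc y * cutoff n y) z.
have iT n : leb2.-integrable setT (EFin \o T n).
  by have [tr _ _ _] := rhoP n; apply: integrable_tens => //; exact: test1_integrable.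
have ITE n : \int[leb2]_z T n z = \int[leb]_y (hc y * cutoff n y).
  by have [tr _ ir _] := rhoP n; rewrite Rintegral_tens// ?ir ?mul1r//; exact: test1_integrable.
have iH n : leb2.-integrable setT (EFin \o (fun z => H z * tens (rho n) (cutoff n) z)).
  by have [tr _ _ _] := rhoP n; exact: L1K_mul_tens.
(* The edge term converges by [cvI]. The rest is at most e for large n, because the product of
   [rho n] and the indicator of [0, 1] has integral 1. *)
rewrite [X in X @ _ --> _](_ : _ = (fun n => \int[leb]_y (hc y * cutoff n y) +
  (\int[leb2]_z (H z * tens (rho n) (cutoff n) z) - \int[leb2]_z T n z))); last first.
  by rewrite funeqE => n; rewrite ITE; lra.
rewrite -[X in _ --> X]addr0; apply: cvgD => //.
apply/cvgr0Pnorm_le => e e0.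
have := contK_edge_unif ch c01 d0 e0; apply: filterS => n Hn.
have [tr r0 ir ro] := rhoP n.
have iR := integrable_tens (test1_integrable tr) (@integrable_J R).
rewrite -RintegralB//; apply: le_trans (le_normr_Rintegral _ _) _ => //.
  exact: integrableB_EFin (iH n) (iT n).
have -> : e = \int[leb2]_z (e * tens (rho n) J z).
  by rewrite RintegralZl// Rintegral_tens// ?ir ?Rintegral_J ?mulr1//; [exact: test1_integrable|exact: integrable_J].
apply: le_Rintegral => //.
- exact: integrable_norm (integrableB_EFin (iH n) (iT n)).
- exact: (integrableZl measurableT e iR).
move=> [x y] _; rewrite /T /tens /H restrK_JJ /hc /=.
have [y01|ny] := boolP (0 <= y <= 1); last first.
  have ny' : ~~ (0 < y < 1) by apply: contra ny => /andP[? ?]; rewrite !ltW.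
  have -> : cutoff n y = 0 by exact: test1_out ny'.
  by rewrite !mulr0 subr0 normr0 mulr_ge0 ?mulr_ge0// ltW.
have Jy : J y = 1 by rewrite indicE mem_setE in_itv/= y01.
have [x01|nx] := boolP (0 <= x <= 1); last first.
  rewrite (test1_out tr); last by apply: contra nx => /andP[? ?]; rewrite !ltW.
  by rewrite !(mul0r, mulr0) subr0 normr0.
have Jx : J x = 1 by rewrite indicE mem_setE in_itv/= x01.
rewrite Jx Jy !mul1r mulr1.
have [xc|nxc] := boolP (`|x - c| < del n); last by rewrite ro// !(mul0r, mulr0) subr0 normr0.
have hh := Hn y y01 x x01 xc.
have -> : h (x, y) * (rho n x * cutoff n y) - rho n x * (h (c, y) * cutoff n y) =
   (h (x, y) - h (c, y)) * rho n x * cutoff n y by lra.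
rewrite normrM -[leRHS]mulr1; apply: ler_pM => //; last exact: cutoff_bound.
by rewrite normrM (ger0_norm (r0 x)) ler_wpM2r.
Qed.

End Edge.

(** * Green's formula for a field with a normal trace *)

Section Green.
Context {R : realType}.
Local Notation leb := (@lebesgue_measure R).
Local Notation leb2 := (leb \x leb)%E.
Implicit Types (f d : R * R -> R) (u : R * R -> R * R).

Lemma eps2_near (e : R) : 0 < e -> \forall n \near \oo, 2 * eps n < e.
Proof.
move=> e0; have e20 : 0 < e / 2 by rewrite divr_gt0.
by apply: filterS (eps_near e20) => n; lra.
Qed.

(** Differentiating x^i [cutoff n] gives i x^(i-1) [cutoff n] and x^i ([rho0 n] - [rho1 n]). The
    first part tends to the integral over the square, the second to the edge terms at x = 0 and x =
    1. *)
Lemma green_x f i j : LpK 1 f -> contK f ->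
  intK (fun z => f z * tens (derive1 (fun x => x ^+ i * cutoff n x))
                            (fun y => y ^+ j * cutoff n y) z) @[n --> \oo] -->
  intK (fun z => f z * (i%:R * mono i.-1 j z)) +
  (int01 (fun t => f (0, t) * mono i j (0, t)) - int01 (fun t => f (1, t) * mono i j (1, t))).
Proof.
move=> Lf cf; pose G z := f z * (i%:R * mono i.-1 j z); pose h := f \* mono i j.
have LG : LpK 1 G by apply: LpK1M_bipoly Lf (bipoly_cmono _ (ltnSn (i.-1 + j))).
have Lh : LpK 1 h by apply: LpK1M_bipoly Lf (bipoly_mono (ltnSn (i + j))).
have ch : contK h by apply: contKM => //; exact: contK_mono.
have LGK := (LpK1P _).1 LG; have LhK := (LpK1P _).1 Lh.
have tc n := (@cutoff_test R n).1.
have mc n : measurable_fun setT (@cutoff R n) by apply: smooth1_measurable; exact: (tc n).1.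
have lG := L1K_open_cvg LGK mc (@cutoff_bound R) (@cutoff_cvg R).
have l0 : \int[leb2]_z ((h \_ (Khat R)) z * tens (rho0 n) (cutoff n) z) @[n --> \oo] -->
    int01 (fun t => h (0, t)).
  apply: (edge_cvg Lh ch _ eps2_near) => [|n]; first by rewrite lexx ler01.
  have [t0 p0 i0 o0] := @rho0P R n; split=> // x nx; apply: o0; apply: contra nx => /andP[x1 x2].
  by have /andP[e0 _] := @eps_itv R n; rewrite subr0 gtr0_norm//; lra.
have l1 : \int[leb2]_z ((h \_ (Khat R)) z * tens (rho1 n) (cutoff n) z) @[n --> \oo] -->
    int01 (fun t => h (1, t)).
  apply: (edge_cvg Lh ch _ eps2_near) => [|n]; first by rewrite lexx ler01.
  have [t0 p0 i0 o0] := @rho1P R n; split=> // x nx; apply: o0; apply: contra nx => /andP[x1 x2].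
  have /andP[e0 _] := @eps_itv R n; clear -x1 x2 e0.
  by rewrite ler0_norm; lra.
rewrite [X in X @ _ --> _](_ : _ = (fun n =>
    \int[leb2]_z ((G \_ (Khat R)) z * tens (cutoff n) (cutoff n) z) +
    (\int[leb2]_z ((h \_ (Khat R)) z * tens (rho0 n) (cutoff n) z) -
     \int[leb2]_z ((h \_ (Khat R)) z * tens (rho1 n) (cutoff n) z)))).
  by rewrite intKE; exact: cvgD lG (cvgB l0 l1).
rewrite funeqE => n.
have [t0 _ _ _] := @rho0P R n; have [t1 _ _ _] := @rho1P R n.
have iG := L1K_mul_tens LGK (tc n) (tc n).
have i0 := L1K_mul_tens LhK t0 (tc n); have i1 := L1K_mul_tens LhK t1 (tc n).
rewrite -[X in _ = _ + X]RintegralB// -RintegralD//; last exact: integrableB_EFin.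
rewrite intKE; apply: eq_Rintegral => z _.
rewrite !restrK_JJ /G /h /tens derive1_powM; last exact: (tc n).1.
rewrite (cutoff_test n).2 /mono /=.
move: (\1_ _ _) (\1_ _ _) (f z) (z.1 ^+ i) (z.1 ^+ i.-1) (z.2 ^+ j) (cutoff n z.1) (cutoff n z.2).
by move: (rho0 n z.1) (rho1 n z.1); clear; move=> *; lra.
Qed.

Lemma weak_div_tens u d phi psi : is_weak_div u d -> test1 phi -> test1 psi ->
  intK (fun z => (u z).1 * tens (derive1 phi) psi z) +
  intK (fun z => (u z).2 * tens phi (derive1 psi) z) = - intK (fun z => d z * tens phi psi z).
Proof.
move=> [[L1 L2] Ld H] tp ts; have [dp _] := smooth1_derive tp.1; have [ds _] := smooth1_derive ts.1.
rewrite -(H _ (test_function_tens tp ts)) -intKD.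
- by congr intK; rewrite funeqE => z; rewrite /dot /grad (pdx_tens _ dp) (pdy_tens _ ds).
- exact: LpK1_test L1 (test1_derive tp) ts.
- exact: LpK1_test L2 tp (test1_derive ts).
Qed.

(** The second component is treated by [green_x] after a swap of the coordinates. *)
Lemma green_continuous u d i j : {within Khat R, continuous u} -> is_weak_div u d ->
  intK (fun z => (u z).1 * (i%:R * mono i.-1 j z)) +
  intK (fun z => (u z).2 * (j%:R * mono i j.-1 z)) + intK (fun z => d z * mono i j z) =
  int01 (fun t => (u (1, t)).1 * mono i j (1, t)) - int01 (fun t => (u (0, t)).1 * mono i j (0, t)) +
  (int01 (fun t => (u (t, 1)).2 * mono i j (t, 1)) - int01 (fun t => (u (t, 0)).2 * mono i j (t, 0))).
Proof.
move=> cu wd; have [[L1 L2] Ld _] := wd; have [c1 c2] := contK_field cu.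
have tc n := (@cutoff_test R n).1.
have lx := green_x (i := i) (j := j) L1 c1.
have ly := green_x (i := j) (j := i) (LpK1_swap L2) (contK_swap c2).
have LG : LpK 1 (fun z => d z * mono i j z) by apply: LpK1M_bipoly Ld (bipoly_mono (ltnSn (i + j))).
have mc n : measurable_fun setT (@cutoff R n) by apply: smooth1_measurable; exact: (tc n).1.
have ld := L1K_open_cvg ((LpK1P _).1 LG) mc (@cutoff_bound R) (@cutoff_cvg R).
rewrite -intKE in ld.
have cv := cvgD (cvgD lx ly) ld.
pose P k n (x : R) := x ^+ k * cutoff n x.
pose S n := intK (fun z => (u z).1 * tens (derive1 (P i n)) (P j n) z) +
  intK (fun z => ((snd \o u) \o swap_pair) z * tens (derive1 (P j n)) (P i n) z) +
  \int[leb2]_z (((fun z => d z * mono i j z) \_ (Khat R)) z * tens (cutoff n) (cutoff n) z).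
(* Each S n is the weak divergence identity for an admissible test function, so the limit computed
   above is zero. *)
have S0 n : S n = 0.
  rewrite /S.
  have tP k : test1 (P k n) := test1_pow k (tc n).
  have H := weak_div_tens wd (tP i) (tP j).
  have E1 : intK (fun z => (u z).2 * tens (P i n) (derive1 (P j n)) z) =
      intK (fun z => ((snd \o u) \o swap_pair) z * tens (derive1 (P j n)) (P i n) z).
    rewrite -(intK_swap (LpK1_test L2 (tP i) (test1_derive (tP j)))).
    by congr intK; rewrite funeqE => z /=; rewrite tens_swap.
  have E2 : intK (fun z => d z * tens (P i n) (P j n) z) =
      \int[leb2]_z (((fun z => d z * mono i j z) \_ (Khat R)) z * tens (cutoff n) (cutoff n) z).
    rewrite intKE; apply: eq_Rintegral => z _; rewrite !restrK_JJ /tens /P /mono.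
    move: (\1_ _ _) (\1_ _ _) (d z) (z.1 ^+ i) (z.2 ^+ j) (cutoff n _) (cutoff n _).
    by clear; move=> *; lra.
  by apply/eqP; rewrite addr_eq0 -E1 -E2 H.
move: cv; rewrite [X in X @ _ --> _](_ : _ = cst 0); last first.
  by rewrite funeqE => n; exact: S0.
move=> cv; have e0 := cvg_lim (@Rhausdorff R) (cv _ _).
rewrite lim_cst in e0; last exact: Rhausdorff.
have e1 : intK (fun z => ((snd \o u) \o swap_pair) z * (j%:R * mono j.-1 i z)) =
    intK (fun z => (u z).2 * (j%:R * mono i j.-1 z)).
  rewrite -(intK_swap (LpK1M_bipoly L2 (bipoly_cmono _ (ltnSn (i + j.-1))))).
  by congr intK; rewrite funeqE => z /=; rewrite mono_swap.
have e2 (s : R) : int01 (fun t => ((snd \o u) \o swap_pair) (s, t) * mono j i (s, t)) =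
    int01 (fun t => (u (t, s)).2 * mono i j (t, s)).
  by congr int01; rewrite funeqE => t /=; rewrite -mono_swap.
rewrite e1 !e2 in e0.
have {}e0 : 0 = intK (fun z => (u z).1 * (i%:R * mono i.-1 j z)) +
  (int01 (fun t => (u (0, t)).1 * mono i j (0, t)) - int01 (fun t => (u (1, t)).1 * mono i j (1, t))) +
  (intK (fun z => (u z).2 * (j%:R * mono i j.-1 z)) +
  (int01 (fun t => (u (t, 0)).2 * mono i j (t, 0)) - int01 (fun t => (u (t, 1)).2 * mono i j (t, 1)))) +
  intK (fun z => d z * mono i j z) := e0 _ _ _.
have Hf : Filter \oo by exact: _.
by move: (e0 eventually_filter Hf Hf); clear; lra.
Qed.

(** Both have the same integral against every product of test functions. *)
Lemma weak_div_unique u d d' : is_weak_div u d -> is_weak_div u d' ->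
  \forall z \ae leb2, (d \_ (Khat R)) z = (d' \_ (Khat R)) z.
Proof.
move=> wd wd'; have [_ /LpK1P Ld _] := wd; have [_ /LpK1P Ld' _] := wd'.
have [Li L0] := L1KB Ld Ld'.
suff : \forall z \ae leb2, (d \_ (Khat R) \- d' \_ (Khat R)) z = 0.
  by apply: aeS => z /eqP; rewrite subr_eq0 => /eqP.
apply: fundamental2 => // phi psi tp ts.
have := weak_div_tens wd tp ts; rewrite (weak_div_tens wd' tp ts) => /oppr_inj.
rewrite !intK_tens => e.
have i1 := L1K_mul_tens Ld tp ts; have i2 := L1K_mul_tens Ld' tp ts.
transitivity (\int[leb2]_z ((d \_ (Khat R)) z * tens phi psi z) -
  \int[leb2]_z ((d' \_ (Khat R)) z * tens phi psi z)).
  by rewrite -RintegralB//; apply: eq_Rintegral => z _ /=; rewrite mulrBl.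
by rewrite e subrr.
Qed.

Lemma sum_edge (F : edge -> R) : \sum_(e : edge) F e =
  F (true, true) + F (true, false) + (F (false, true) + F (false, false)).
Proof.
rewrite (eq_bigr (fun e : bool * bool => F (e.1, e.2))); last by case.
by rewrite -(pair_bigA _ (fun a b => F (a, b))) /= !big_bool /=.
Qed.

Lemma int01N (h : R -> R) : contp h -> int01 (fun t => - h t) = - int01 h.
Proof.
move=> ch; rewrite -mulN1r /int01 -RintegralZl//.
  by apply: eq_Rintegral => t _; rewrite mulN1r.
by apply: continuous_compact_integrable => //; exact: segment_compact.
Qed.

Lemma sum_edge_contK u i j : contK (fst \o u) -> contK (snd \o u) ->
  \sum_(F : edge) int01 (fun t =>
     dot (u (edge_point F t)) (edge_normal R F) * mono i j (edge_point F t)) =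
  int01 (fun t => (u (1, t)).1 * mono i j (1, t)) - int01 (fun t => (u (0, t)).1 * mono i j (0, t)) +
  (int01 (fun t => (u (t, 1)).2 * mono i j (t, 1)) - int01 (fun t => (u (t, 0)).2 * mono i j (t, 0))).
Proof.
move=> c1 c2; rewrite sum_edge.
have c01 (b : bool) : 0 <= (b%:R : R) <= 1 by case: b; rewrite ?lexx ?ler01.
have k1 (b : bool) : contp (fun t => (u (b%:R, t)).1 * mono i j (b%:R, t)).
  by have := contK_slice (contKM c1 (@contK_mono R i j)) (c01 b).
have k2 (b : bool) : contp (fun t => (u (t, b%:R)).2 * mono i j (t, b%:R)).
  by have := contK_slice (contK_swap (contKM c2 (@contK_mono R i j))) (c01 b).
have E1 : int01 (fun t => dot (u (edge_point (true, true) t)) (edge_normal R (true, true)) *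
    mono i j (edge_point (true, true) t)) = int01 (fun t => (u (t, 1)).2 * mono i j (t, 1)).
  by congr int01; rewrite funeqE => t; rewrite /dot /edge_normal /= mulr0 add0r mulr1.
have E2 : int01 (fun t => dot (u (edge_point (true, false) t)) (edge_normal R (true, false)) *
    mono i j (edge_point (true, false) t)) = - int01 (fun t => (u (t, 0)).2 * mono i j (t, 0)).
  rewrite -(int01N (k2 false)); congr int01; rewrite funeqE => t.
  by rewrite /dot /edge_normal /= mulr0 add0r mulrN1 mulNr.
have E3 : int01 (fun t => dot (u (edge_point (false, true) t)) (edge_normal R (false, true)) *
    mono i j (edge_point (false, true) t)) = int01 (fun t => (u (1, t)).1 * mono i j (1, t)).
  by congr int01; rewrite funeqE => t; rewrite /dot /edge_normal /= mulr0 addr0 mulr1.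
have E4 : int01 (fun t => dot (u (edge_point (false, false) t)) (edge_normal R (false, false)) *
    mono i j (edge_point (false, false) t)) = - int01 (fun t => (u (0, t)).1 * mono i j (0, t)).
  rewrite -(int01N (k1 false)); congr int01; rewrite funeqE => t.
  by rewrite /dot /edge_normal /= mulr0 addr0 mulrN1 mulNr.
by rewrite E1 E2 E3 E4; clear; lra.
Qed.

(** The distributional alternative carries its own divergence d', equal to d almost everywhere by
    uniqueness; there the formula is the definition applied to a monomial. *)
Lemma normal_trace_green u g d i j : is_weak_div u d -> is_normal_trace u g ->
  intK (fun z => (u z).1 * (i%:R * mono i.-1 j z)) +
  intK (fun z => (u z).2 * (j%:R * mono i j.-1 z)) + intK (fun z => d z * mono i j z) =
  \sum_(F : edge) int01 (fun t => g F t * mono i j (edge_point F t)).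
Proof.
move=> wd [[cu gu]|[d' [wd' _ H]]].
  rewrite green_continuous//.
  have e F : int01 (fun t => g F t * mono i j (edge_point F t)) =
      int01 (fun t => dot (u (edge_point F t)) (edge_normal R F) * mono i j (edge_point F t)).
    by apply: eq_Rintegral => t; rewrite inE /= => t01; rewrite gu.
  have [c1 c2] := contK_field cu.
  by rewrite -sum_edge_contK//; apply: eq_bigr => F _; rewrite e.
have [[L1 L2] Ld _] := wd; have [_ Ld' _] := wd'.
rewrite -H; last first.
  rewrite (_ : mono i j = tens (fun x => x ^+ i) (fun y => y ^+ j))//.
  by apply: smooth_tens; exact: smooth1X.
have Lm := LpK1M_bipoly Ld' (@bipoly_mono R _ i j (ltnSn (i + j))).
have L1m := LpK1M_bipoly L1 (@bipoly_cmono R _ i%:R i.-1 j (ltnSn _)).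
have L2m := LpK1M_bipoly L2 (@bipoly_cmono R _ j%:R i j.-1 (ltnSn _)).
have -> : intK (fun z => d z * mono i j z) = intK (fun z => d' z * mono i j z).
  have Lm' := LpK1M_bipoly Ld (@bipoly_mono R _ i j (ltnSn (i + j))).
  rewrite !intKE; apply: Rintegral_ae_eq.
  - exact: integrable_EFin_measurable ((LpK1P _).1 Lm').1.
  - exact: integrable_EFin_measurable ((LpK1P _).1 Lm).1.
  apply: aeS (weak_div_unique wd wd') => z; rewrite !restrK_JJ => e.
  by rewrite !mulrA e.
rewrite -(intKD L1m L2m) -(intKD (LpK1D L1m L2m) Lm).
by congr intK; rewrite funeqE => z; rewrite grad_mono /dot.
Qed.

End Green.

(** * Equality of the moments of the two divergences *)

Section Commute.
Context {R : realType}.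
Local Notation leb := (@lebesgue_measure R).
Local Notation J := (\1_(`[0, 1]%classic : set R) : R -> R).
Implicit Types (f d : R * R -> R) (u w : R * R -> R * R).

Lemma contK_bipoly n f : bipoly n f -> contK f.
Proof.
move: f; apply: bipoly_ind.
- by move=> z _; exact: cvg_cst.
- by move=> f g cf cg z Kz; apply: cvgD; [exact: cf|exact: cg].
- move=> c i j _ z Kz; apply: cvgM; first exact: cvg_cst.
  exact: (@contK_mono R i j).
Qed.

Lemma int01B_mono (a g : R -> R) c m : contp a -> leb.-integrable `[0, 1] (EFin \o g) ->
  int01 (fun t => (a t - g t) * (c * t ^+ m)) =
  int01 (fun t => a t * (c * t ^+ m)) - int01 (fun t => g t * (c * t ^+ m)).
Proof.
move=> ca gi.
have Hi (h : R -> R) : leb.-integrable `[0, 1] (EFin \o h) ->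
    leb.-integrable setT (EFin \o (fun t : R => h t * (c * t ^+ m) * J t)).
  move=> hi; have := integrableZl measurableT c (integrable_Jpow_mul m hi).
  congr (_.-integrable _ _); rewrite funeqE => t /=; rewrite -EFinM /Jpow; congr EFin.
  by move: (\1_ _ _) (t ^+ m) (h t); clear=> *; lra.
have ai : leb.-integrable `[0, 1] (EFin \o a).
  by apply: continuous_compact_integrable => //; exact: segment_compact.
have ia := Hi _ ai; have ig := Hi _ gi.
have I h : int01 h = \int[leb]_t (h t * J t) by exact: Rintegral_indic.
rewrite !I -(RintegralB measurableT ia ig).
by apply: eq_Rintegral => t _; rewrite /= !mulrBl.
Qed.

(** A monomial of degree at most k is admissible in the edge conditions of order k+1, and its
    gradient has degree at most k-1, as the interior conditions demand. Green's formulas for [u] and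
    [w] then differ only in the divergence terms. *)
Lemma bdm_div_commute k u w d dv i j : is_weak_div u d -> is_BDM_interpolant k.+1 u w ->
  poly_div (fst \o w) (snd \o w) dv -> (i + j < k.+1)%N ->
  intK (fun z => dv z * mono i j z) = intK (fun z => d z * mono i j z).
Proof.
move=> wd [_ [g gP Hedge] Hint] [[n [b1 b2 bd]] _ Gw] ij.
have [[L1 L2] Ld _] := wd.
have Gu := normal_trace_green i j wd gP.
have gi := normal_trace_integrable gP.
have {}Gw := Gw i j.
have cw1 := contK_bipoly b1; have cw2 := contK_bipoly b2.
have EW := sum_edge_contK i j cw1 cw2.
have EE : \sum_(F : edge) int01 (fun t =>
     dot (w (edge_point F t)) (edge_normal R F) * mono i j (edge_point F t)) =
   \sum_(F : edge) int01 (fun t => g F t * mono i j (edge_point F t)).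
  apply: eq_bigr => F _; apply/eqP; rewrite -subr_eq0; apply/eqP.
  (* On an edge one coordinate is constantly 0 or 1, and its power is the coefficient c; the power
     0^0 is 1. *)
  have [c [m [mk mE]]] : exists c m, (m <= k)%N /\ forall t : R, mono i j (edge_point F t) = c * t ^+ m.
    move: F => [[] s] ; rewrite /edge_point /mono /=.
      exists (s%:R ^+ j), i; split; first by rewrite -ltnS; apply: leq_ltn_trans ij; exact: leq_addr.
      by move=> t; rewrite mulrC.
    by exists (s%:R ^+ i), j; split => //; rewrite -ltnS; apply: leq_ltn_trans ij; exact: leq_addl.
  under [X in int01 X - _ = _]eq_fun do rewrite mE.
  under [X in _ - int01 X = _]eq_fun do rewrite mE.
  rewrite -int01B_mono//.
    rewrite -[RHS](Hedge F (c *: 'X^m)); last first.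
      apply: leq_trans (size_scale_leq _ _) _; rewrite size_polyXn ltnS.
      exact: leq_trans mk (leqnSn _).
    by congr int01; rewrite funeqE => t; rewrite hornerZ hornerXn.
  have c01 (b : bool) : 0 <= (b%:R : R) <= 1 by case: b; rewrite ?lexx ?ler01.
  move: F {mE} => [[] s]; rewrite /edge_point /edge_normal /dot /=.
    move=> t; apply: cvgD; apply: cvgM; try exact: cvg_cst.
      by have := contK_slice (contK_swap cw1) (c01 s); apply.
    by have := contK_slice (contK_swap cw2) (c01 s); apply.
  move=> t; apply: cvgD; apply: cvgM; try exact: cvg_cst.
    by have := contK_slice cw1 (c01 s); apply.
  by have := contK_slice cw2 (c01 s); apply.
have kk : k.+1%:Z - 2 = k%:Z - 1 by rewrite -(addn1 k) PoszD -addrA.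
(* The zero derivative at i = 0 is split off; it is the only case for k = 0, where the interior test
   space is trivial. *)
have bx : bipoly k (fun z : R * R => i%:R * mono i.-1 j z).
  case: i ij {Gu Gw EW EE} => [|i] ij; last exact: bipoly_cmono.
  by have := @bipoly0 R k; congr bipoly; rewrite funeqE => z; rewrite mul0r.
have by_ : bipoly k (fun z : R * R => j%:R * mono i j.-1 z).
  case: j ij {Gu Gw EW EE bx} => [|j] ij; last by apply: bipoly_cmono; rewrite addnS ltnS in ij.
  by have := @bipoly0 R k; congr bipoly; rewrite funeqE => z; rewrite mul0r.
have := Hint (fun z => (i%:R * mono i.-1 j z, j%:R * mono i j.-1 z)).
have -> : intK (fun z => dot (w z - u z) (i%:R * mono i.-1 j z, j%:R * mono i j.-1 z)) =
  (intK (fun z => (w z).1 * (i%:R * mono i.-1 j z)) - intK (fun z => (u z).1 * (i%:R * mono i.-1 j z))) +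
  (intK (fun z => (w z).2 * (j%:R * mono i j.-1 z)) - intK (fun z => (u z).2 * (j%:R * mono i j.-1 z))).
  have w1 := LpK1M_bipoly (LpK1_bipoly b1) bx; have u1 := LpK1M_bipoly L1 bx.
  have w2 := LpK1M_bipoly (LpK1_bipoly b2) by_; have u2 := LpK1M_bipoly L2 by_.
  rewrite -(intKB w1 u1) -(intKB w2 u2) -(intKD (LpK1B w1 u1) (LpK1B w2 u2)).
  by congr intK; rewrite funeqE => z; rewrite /dot /= !mulrBl.
have pf : polyK_field (k.+1%:Z - 2) (fun z : R * R => (i%:R * mono i.-1 j z, j%:R * mono i j.-1 z)).
  split; first by apply/(polyK_bipoly _ kk); exact: bx.
  by apply/(polyK_bipoly _ kk); exact: by_.
move=> /(_ pf) HI.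
have {}Gw : intK (fun z => (w z).1 * (i%:R * mono i.-1 j z)) +
  intK (fun z => (w z).2 * (j%:R * mono i j.-1 z)) + intK (fun z => dv z * mono i j z) =
  \sum_(F : edge) int01 (fun t => g F t * mono i j (edge_point F t)).
  by rewrite -EE EW -Gw.
by rewrite -Gu in Gw; move: Gw HI; clear; lra.
Qed.

End Commute.

(** * Approximation of the divergence and the final estimate *)

Section Final.
Context {R : realType}.
Local Notation leb := (@lebesgue_measure R).
Local Notation leb2 := (leb \x leb)%E.
Implicit Types (f d : R * R -> R) (u w : R * R -> R * R).

Lemma is_weak_partial_tens a b f g phi psi : is_weak_partial a b f g ->
  test1 phi -> test1 psi ->
  intK (fun z => f z * tens (iter a (@derive1 _ _) phi) (iter b (@derive1 _ _) psi) z) =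
  (-1) ^+ (a + b) * \int[leb2]_z ((g \_ (Khat R)) z * tens phi psi z).
Proof.
move=> [_ _ H] tp ts; rewrite -(partial_tens _ _ tp.1 ts.1) H; last exact: test_function_tens.
by rewrite intK_tens.
Qed.

(** Order a tested with the derivative of [phi] and order a+1 tested with [phi] have the same left
    side; the powers of -1 differ by one sign. *)
Lemma is_weak_partial_weakx a b f g h : is_weak_partial a b f g -> is_weak_partial a.+1 b f h ->
  weakx (g \_ (Khat R)) (h \_ (Khat R)).
Proof.
move=> Hg Hh phi psi tp ts.
have := is_weak_partial_tens Hh tp ts.
rewrite iterSr (is_weak_partial_tens Hg (test1_derive tp) ts) addSn exprS mulN1r mulNr -mulrN.
by apply: mulfI; rewrite expf_neq0// oppr_eq0 oner_neq0.
Qed.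

Lemma is_weak_partial_weaky a b f g h : is_weak_partial a b f g -> is_weak_partial a b.+1 f h ->
  weaky (g \_ (Khat R)) (h \_ (Khat R)).
Proof.
move=> Hg Hh phi psi tp ts.
have := is_weak_partial_tens Hh tp ts.
rewrite iterSr (is_weak_partial_tens Hg tp (test1_derive ts)) addnS exprS mulN1r mulNr -mulrN.
by apply: mulfI; rewrite expf_neq0// oppr_eq0 oner_neq0.
Qed.

Lemma is_weak_partial00 f : LpK 1 f -> is_weak_partial 0 0 f f.
Proof. by move=> Lf; split=> // phi _; rewrite mul1r. Qed.

Lemma sobolev_bramble_hilbert (p : R) (p1 : 1 <= p) l : (0 < l)%N -> exists2 C : R, 0 <= C &
  forall f, LpK 1 f -> sobolev l p f -> exists2 q, bipoly l q &
    ('N[leb2]_p%:E[EFin \o (f \_ (Khat R) \- q \_ (Khat R))%R] <=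
     C%:E * \sum_(a : 'I_l.+1 * 'I_l.+1 | (a.1 + a.2)%N == l) LpK_norm p (weak_partial a.1 a.2 f))%E.
Proof.
move=> l0; have [C C0 HC] := bramble_hilbert p1 l; exists C => // f Lf [_ Sf].
(* At order 0 the function itself is taken, since the chosen [weak_partial 0 0 f] agrees with [f]
   only almost everywhere. *)
pose g a b := if (a + b == 0)%N then f else weak_partial a b f.
have gP a b : (a + b <= l)%N -> is_weak_partial a b f (g a b).
  rewrite /g; case: eqP => [/eqP ab0|_] abl.
    by move: ab0; rewrite addn_eq0 => /andP[/eqP -> /eqP ->]; exact: is_weak_partial00.
  by have [h wh _] := Sf a b abl; exact: (@xgetPex _ (cst 0) [set h | is_weak_partial a b f h] (ex_intro _ h wh)).
have [a b abl|a b abl|q bq le_q] := HC (fun a b => (g a b) \_ (Khat R)).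
- by have [_ Lg _] := gP a b abl; exact/LpK1P.
- have h0 := gP a b (ltnW abl); have h1 : (a.+1 + b <= l)%N by rewrite addSn.
  have h2 : (a + b.+1 <= l)%N by rewrite addnS.
  by split; [exact: is_weak_partial_weakx h0 (gP _ _ h1)|exact: is_weak_partial_weaky h0 (gP _ _ h2)].
exists q => //; apply: le_trans le_q _.
rewrite le_eqVlt; apply/orP; left; apply/eqP; congr (_ * _)%E.
(* For each a the only index b is l - a, that is [rev_ord a]; as l > 0, the exceptional case of [g]
   is not in the sum. *)
rewrite -(pair_big_dep xpredT (fun a b : 'I_l.+1 => (a + b)%N == l)
  (fun a b : 'I_l.+1 => LpK_norm p (weak_partial a b f))) /=.
apply: eq_bigr => a _; rewrite (big_pred1 (rev_ord a)).
  rewrite /LpK_norm /g /= subSS subnKC -1?ltnS// eqn0Ngt l0 /=.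
  by congr Lnorm.
move=> b; rewrite /= -val_eqE /= subSS; apply/eqP/eqP.
  by move=> ab; apply/eqP; rewrite -(eqn_add2l a) ab subnKC// -ltnS.
by move=> ->; rewrite subnKC// -ltnS.
Qed.

Lemma weak_divP u : (exists d, is_weak_div u d) -> is_weak_div u (weak_div u).
Proof. by move=> [d wd]; exact: (@xgetPex _ (cst 0) [set d | is_weak_div u d] (ex_intro _ d wd)). Qed.

(** Tested on products, the divergence of the polynomial field [w] comes from [poly_div], and the
    fundamental lemma concludes. *)
Lemma weak_div_sub_ae u w d dv e : is_weak_div u d ->
  poly_div (fst \o w) (snd \o w) dv -> is_weak_div (fun z => u z - w z) e ->
  \forall z \ae leb2, (e \_ (Khat R)) z = (d \_ (Khat R) \- dv \_ (Khat R)) z.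
Proof.
move=> wd [[n [b1 b2 bd]] Wdv _] we.
have [[L1 L2] /LpK1P Ld _] := wd; have [_ /LpK1P Le _] := we.
have Ldv := (LpK1P _).1 (LpK1_bipoly bd).
have [Li L0] := L1KB Le (L1KB Ld Ldv).
suff : \forall z \ae leb2, (e \_ (Khat R) \- (d \_ (Khat R) \- dv \_ (Khat R))) z = 0.
  by apply: aeS => z /eqP; rewrite subr_eq0 => /eqP.
apply: fundamental2 => // phi psi tp ts.
have tp' := test1_derive tp; have ts' := test1_derive ts.
have h1 := weak_div_tens wd tp ts; have h2 := Wdv _ _ tp ts; have h3 := weak_div_tens we tp ts.
have e1 : intK (fun z => (u z - w z).1 * tens (derive1 phi) psi z) =
   intK (fun z => (u z).1 * tens (derive1 phi) psi z) - intK (fun z => (w z).1 * tens (derive1 phi) psi z).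
  rewrite -(intKB (LpK1_test L1 tp' ts) (LpK1_test (LpK1_bipoly b1) tp' ts)).
  by congr intK; rewrite funeqE => z /=; rewrite mulrBl.
have e2 : intK (fun z => (u z - w z).2 * tens phi (derive1 psi) z) =
   intK (fun z => (u z).2 * tens phi (derive1 psi) z) - intK (fun z => (w z).2 * tens phi (derive1 psi) z).
  rewrite -(intKB (LpK1_test L2 tp ts') (LpK1_test (LpK1_bipoly b2) tp ts')).
  by congr intK; rewrite funeqE => z /=; rewrite mulrBl.
have {}h2 : intK (fun z => (w z).1 * tens (derive1 phi) psi z) +
   intK (fun z => (w z).2 * tens phi (derive1 psi) z) = - intK (fun z => dv z * tens phi psi z) := h2.
rewrite e1 e2 in h3; rewrite !intK_tens in h1 h2 h3.
have i1 := L1K_mul_tens Le tp ts; have i2 := L1K_mul_tens Ld tp ts; have i3 := L1K_mul_tens Ldv tp ts.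
transitivity (\int[leb2]_z ((e \_ (Khat R)) z * tens phi psi z) -
  (\int[leb2]_z ((d \_ (Khat R)) z * tens phi psi z) - \int[leb2]_z ((dv \_ (Khat R)) z * tens phi psi z))).
  rewrite -(RintegralB measurableT i2 i3) -(RintegralB measurableT i1 (integrableB_EFin i2 i3)).
  by apply: eq_Rintegral => z _ /=; rewrite !mulrBl.
by move: h1 h2 h3; clear; lra.
Qed.

(* Both divergences have the same moments of degree below [k], so [dv - q] is
   controlled by the moments of [d - q]. *)
Lemma div_approx (p : R) (p1 : 1 <= p) k : exists2 C : R, 0 <= C &
  forall d dv q, LpK 1 d -> bipoly k dv -> bipoly k q ->
    (forall i j, (i + j < k)%N -> intK (fun z => dv z * mono i j z) = intK (fun z => d z * mono i j z)) ->
    ('N[leb2]_p%:E[EFin \o (d \_ (Khat R) \- dv \_ (Khat R))%R] <=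
     C%:E * 'N[leb2]_p%:E[EFin \o (d \_ (Khat R) \- q \_ (Khat R))%R])%E.
Proof.
have om1 : bipoly 1 (cst (1 : R) : R * R -> R) := bipoly_cst 0 1.
have [C C0 HC] := @gramK_bound R 1 (cst 1) om1 (fun z _ => ler01) (fun z _ _ => ltr01) k.
exists (1 + C); first by rewrite addr_ge0.
move=> d dv q Ld bdv bq Hm; set D := d \_ (Khat R) \- q \_ (Khat R).
have LD : L1K D by apply: L1KB; [exact/LpK1P|exact: L1K_bipoly bq].
have [Di D0] := LD; have mD := integrable_EFin_measurable Di.
pose r := q \- dv; have br : bipoly k r := bipolyB bq bdv.
pose M := \int[leb2]_z `|D z|.
have M0 : 0 <= M by apply: Rintegral_ge0 => z _.
(* The moments of r = q - dv are those of q - d, hence at most the L^1 norm M of [D]; with weight 1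
   they control r on the square. *)
have rM : forall z, Khat R z -> `|r z| <= C * M.
  apply: HC => // i j ij; have bm := @bipoly_mono R k i j ij.
  have -> : intK (fun z => cst 1 z * (r z * mono i j z)) = - intK (fun z => (d z - q z) * mono i j z).
    have Lq := LpK1M_bipoly (LpK1_bipoly bq) bm; have Ldv := LpK1M_bipoly (LpK1_bipoly bdv) bm.
    have Lm := LpK1M_bipoly Ld bm.
    transitivity (intK (fun z => q z * mono i j z) - intK (fun z => dv z * mono i j z)).
      by rewrite -(intKB Lq Ldv); congr intK; rewrite funeqE => z /=; rewrite mul1r mulrBl.
    rewrite Hm// -opprB -(intKB Lm Lq); congr (- intK _); rewrite funeqE => z /=.
    by rewrite mulrBl.
  rewrite normrN intKE.
  have LF : LpK 1 (fun z => (d z - q z) * mono i j z).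
    by apply: (LpK1M_bipoly _ bm); apply: LpK1B Ld (LpK1_bipoly bq).
  have [Fi _] := (LpK1P _).1 LF.
  apply: le_trans (le_normr_Rintegral _ _) _ => //.
  apply: le_Rintegral => //; [exact: integrable_norm|exact: integrable_norm|].
  move=> z _; rewrite restrKM normrM.
  have -> : ((fun z => d z - q z) \_ (Khat R)) z = D z by rewrite /D -restrKB.
  rewrite -[leRHS]mulr1 ler_wpM2l// patchE; case: ifPn => [|_]; last by rewrite normr0.
  by rewrite inE => Kz; exact: mono_K.
have -> : d \_ (Khat R) \- dv \_ (Khat R) = D \+ r \_ (Khat R).
  by rewrite /D /r restrKB funeqE => z /=; lra.
have [ri r0] := L1K_bipoly br; have mr := integrable_EFin_measurable ri.
apply: le_trans (LnormD_le leb2 p1 mD mr) _.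
rewrite EFinD ge0_muleDl ?lee_fin// mul1e leeD2l//.
apply: (@le_trans _ _ (C * M)%:E).
  apply: (Lnorm_le_cst (mu := leb2) p1 measurable_Khat leb2_Khat mr) => //.
    by rewrite mulr_ge0.
  move=> z; rewrite patchE; case: ifPn => [|_]; last by rewrite normr0 mulr_ge0.
  by rewrite inE => Kz; exact: rM.
rewrite EFinM lee_wpmul2l ?lee_fin//.
have := Lnorm1_le (mu := leb2) p1 measurable_Khat leb2_Khat mD D0.
by rewrite /M /Rintegral fineK//; exact: (integrable_fin_num measurableT (integrable_norm Di)).
Qed.

End Final.

Theorem theorem2p3 (R : realType) (k l : nat) (p : R)
    (l_ge1 : (1 <= l)%N) (l_le_k : (l <= k)%N) (p_ge1 : 1 <= p) :
  exists2 C : R, 0 < C &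
    forall u : R * R -> R * R,
      LpK_field 1 u ->
      BDM_domain u ->
      (exists d, is_weak_div u d) ->
      sobolev l p (weak_div u) ->
      (LpK_norm p (weak_div (fun z => (u z - BDM_interp k u z)%R)) <=
       C%:E * \sum_(a : 'I_l.+1 * 'I_l.+1 | (a.1 + a.2)%N == l)
                LpK_norm p (weak_partial a.1 a.2 (weak_div u)))%E.
Proof.
(* Order 0 contradicts 1 <= l <= k; from here on the order is k+1. *)
case: k l_le_k => [|k] l_le_k; first by move: (leq_trans l_ge1 l_le_k).
have [C1 C10 H1] := sobolev_bramble_hilbert p_ge1 l_ge1.
have [C2 C20 H2] := @div_approx R p p_ge1 k.+1.
(* The added 1 makes the constant strictly positive. *)
exists (C2 * C1 + 1); first by rewrite ltr_wpDl// mulr_ge0.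
move=> u Lu Du /weak_divP wd Su; set w := BDM_interp k.+1 u; set S := (\sum_(_ | _) _)%E.
have S0 : (0 <= S)%E by apply: sume_ge0 => a _; exact: Lnorm_ge0.
(* Existence ensures that the chosen [w] is a true interpolant and not the default zero field. *)
have wP : is_BDM_interpolant k.+1 u w.
  have [w' w'P] := bdm_interpolant_exists k Lu Du.
  exact: (@xgetPex _ (cst (0, 0)) [set w | is_BDM_interpolant k.+1 u w] (ex_intro _ w' w'P)).
have [Bw _ _] := wP; have [dv [bdv pdv]] := BDM_div Bw.
have [_ Ld _] := wd.
(* Without a weak divergence of u - w, [weak_div] takes its default value 0 and the left side is
   zero. *)
have [[e we]|ne] := pselect (exists e, is_weak_div (fun z => u z - w z) e); last first.
  have -> : weak_div (fun z => u z - w z) = cst 0.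
    by apply: xgetPN => e we; apply: ne; exists e.
  rewrite /LpK_norm (_ : EFin \o _ = cst 0%E); last first.
    by rewrite funeqE => z /=; rewrite restrK_JJ mulr0.
  rewrite Lnorm0; first by apply: mule_ge0 => //; rewrite lee_fin addr_ge0// mulr_ge0.
  by rewrite eqe gt_eqF// (lt_le_trans ltr01).
have {we}we : is_weak_div (fun z => u z - w z) (weak_div (fun z => u z - w z)).
  by apply: weak_divP; exists e.
have [q bq Hq] := H1 _ Ld Su.
have [_ /LpK1P[Lei _] _] := we; have [Ldi _] := (LpK1P _).1 Ld.
have [Ldvi _] := L1K_bipoly bdv.
rewrite /LpK_norm (Lnorm_ae_eq (mu := (@lebesgue_measure R \x @lebesgue_measure R)%E) p
  (integrable_EFin_measurable Lei)
  (integrable_EFin_measurable (integrableB_EFin Ldi Ldvi)) (weak_div_sub_ae wd pdv we)).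
(* The bound of l by the order places q, of degree below l, in the polynomial space of [dv]. *)
apply: le_trans (H2 _ dv q Ld bdv (bipoly_leq l_le_k bq) _) _.
  by move=> i j ij; exact: bdm_div_commute wd wP pdv ij.
apply: (@le_trans _ _ (C2%:E * (C1%:E * S))%E); first by rewrite lee_wpmul2l ?lee_fin.
rewrite muleA -EFinM lee_wpmul2r// lee_fin.
by rewrite lerDl.
Qed.
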